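(* Let $\mathcal{Q}^{A}_{\mathbb{F}_2}$ be the quantum differential system associated with the small quantum cohomology of the Hirzebruch surface $\mathbb{F}_2$ and $\mathcal{Q}^{B,qc}_F$ the one associated with the Landau–Ginzburg model $F=u_1+u_2+q_1\frac{u_2^2}{u_1}+q_2\frac1{u_2}$, written in the flat coordinates $(r_1,r_2)$, as in the context. Let $\gamma:\mathcal{Q}^A_{\mathbb{F}_2}\to\mathcal{Q}^{B,qc}_F$ be the map covering the identity $\nu$ of the $(r_1,r_2)$-space defined by $$\gamma(1)=\varepsilon_0,\quad\gamma(f)=\theta r_1\nabla_{\partial_{r_1}}\varepsilon_0,\quad\gamma(H)=\theta r_2\nabla_{\partial_{r_2}}\varepsilon_0,\quad\gamma(H\circ f)=(\theta r_2\nabla_{\partial_{r_2}})(\theta r_1\nabla_{\partial_{r_1}})\varepsilon_0.$$ Then $\gamma$ is an isomorphism of quantum differential systems, for which: 1. the small quantum product is given by $$f\circ c=\gamma^{-1}\big((\theta r_1\nabla_{\partial_{r_1}}\gamma(c))_{|\theta=0}\big),\qquad H\circ c=\gamma^{-1}\big((\theta r_2\nabla_{\partial_{r_2}}\gamma(c))_{|\theta=0}\big)$$ for any cohomology class $c\in H^*(\mathbb{F}_2)$; 2. the metric $g_{\mathbb{F}_2}$ of $\mathcal{Q}^A_{\mathbb{F}_2}$ is given by $g_{\mathbb{F}_2}(a,b)=S(\gamma(a),\gamma(b))$ for any cohomology classes $a,b\in H^*(\mathbb{F}_2)$ (where $S$ is written without its factor $\theta^2$).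
   Context: Quantum differential systems: bundles on $\mathbb{P}^1\times M$ (coordinate $\theta$ on $\mathbb{P}^1$, $\tau=\theta^{-1}$), trivial along $\mathbb{P}^1$, with a flat meromorphic connection $\nabla=\bigtriangledown+\frac\Phi\theta+(\frac{V_0}\theta+V_\infty)\frac{d\theta}\theta$ and a $\nabla$-flat non-degenerate pairing $S$ with values in $\theta^d\mathcal{O}$ (linear in the first argument, $h(\theta)\mapsto h(-\theta)$-linear in the second). An isomorphism is a bundle isomorphism compatible with connections and pairings. Both systems are considered on $\tilde M=\{(r_1,r_2)\in(\mathbb{C}^* )^2\mid r_1\neq\pm1\}$ (or its universal cover). B-side. $U=(\mathbb{C}^* )^2$, $M=\{(q_1,q_2)\in(\mathbb{C}^* )^2\mid q_1\ne\frac14\}$, $\mathbb{C}[M,\theta]=\mathbb{C}[q_1^{\pm1},q_2^{\pm1},(4q_1-1)^{-1},\theta]$, $G_0=\Omega^2(U)[M,\theta]/(\theta d-dF\wedge)\Omega^1(U)[M,\theta]$ ($d$ with respect to $u_1,u_2$ only), with connection on $G_0[\theta^{-1}]$: $\theta^2\nabla_{\partial_\theta}[\eta]=[F\eta]$, $\theta\nabla_{\partial_{q_i}}[\eta]=-[\frac{\partial F}{\partial q_i}\eta]$ for $\eta\in\Omega^2(U)$. Basis of $G_0$: $\omega_0=[\frac{du_1}{u_1}\wedge\frac{du_2}{u_2}]$, $\omega_1=-\theta q_2\nabla_{\partial_{q_2}}\omega_0$, $\omega_2=\theta q_2\nabla_{\partial_{q_2}}\theta q_1\nabla_{\partial_{q_1}}\omega_0$,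 $\omega_3=-\theta q_1\nabla_{\partial_{q_1}}\omega_0$. Put $q_1=\frac{r_1}{(1+r_1)^2}$, $q_2=r_2(1+r_1)$, with the branch $(1-4q_1)^{1/2}=\frac{r_1-1}{r_1+1}$, and $\varepsilon_0=\omega_0$, $\varepsilon_1=\omega_1$, $\varepsilon_2=\omega_2$, $\varepsilon_3=(1-4q_1)^{1/2}\omega_3-\frac12\big((1-4q_1)^{1/2}+1\big)\omega_1$. $\mathcal{Q}_F^{B,qc}$ is the pull-back to $\tilde M$ of the bundle with basis of global sections $\varepsilon$ (a basis flat for the residual connection $\bigtriangledown$), with connection $\nabla$, $d=2$ and the symmetric pairing $S(\varepsilon_0,\varepsilon_2)=\theta^2$, $S(\varepsilon_1,\varepsilon_1)=2\theta^2$, $S(\varepsilon_3,\varepsilon_1)=-\theta^2$, $S(\varepsilon_i,\varepsilon_j)=0$ otherwise. Equalities at $\theta=0$ are in $G_0/\theta G_0$, identified with the span of $\varepsilon$. A-side. $H^*(\mathbb{F}_2,\mathbb{C})=\mathbb{C}[f,H]/\langle f^2,H^2-2Hf\rangle$, $f$ the class of a fiber, $H$ the class of the zero section, $\int f\cup H=1$, $\int H\cup H=2$, $\int f\cup f=0$, $c_1=2H$. The small quantum product $\circ$ is $\int(a\circ b)\cup c=\sum_\beta\langle a,b,c\rangle_{0,3,\beta}\,r_1^{f\cdot\beta}r_2^{H\cdot\beta}$; it is known that $f\circ f=r_1r_2$, $H\circ H=2\,f\circ H+r_2(1-r_1)$, $f\circ(f\circ H)=r_1r_2H$, $H\circ(f\circ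 H)=r_2(1-r_1)f+2r_1r_2H$, and that the Poincaré pairing $g_{\mathbb{F}_2}(a,b)=\int a\cup b$ satisfies $g_{\mathbb{F}_2}(1,f\circ H)=g_{\mathbb{F}_2}(f,H)=1$, $g_{\mathbb{F}_2}(H,H)=2$, $g_{\mathbb{F}_2}(f\circ H,f\circ H)=2r_1r_2$, the other pairings of $1,f,H,f\circ H$ being $0$. $\mathcal{Q}^A_{\mathbb{F}_2}$ is the trivial bundle with fiber $H^*(\mathbb{F}_2,\mathbb{C})$, with $d=2$, pairing $g_{\mathbb{F}_2}\theta^2$ and connection $\nabla_{r_1\partial_{r_1}}=r_1\partial_{r_1}+\frac1\theta f\circ$, $\nabla_{r_2\partial_{r_2}}=r_2\partial_{r_2}+\frac1\theta H\circ$, $\nabla_{\theta\partial_\theta}=\theta\partial_\theta-\frac1\theta(2H)\circ+\frac12\deg$. The map $\gamma$ is extended linearly over functions. *)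

(* Defs.v *)
From HB Require Import structures.
From mathcomp Require Import all_boot all_order all_algebra.
From mathcomp Require Import boolp reals complex ring.
From mathcomp Require Import finmap mpoly.

Set Implicit Arguments.
Unset Strict Implicit.
Unset Printing Implicit Defensive.

Import GRing.Theory.
Local Open Scope ring_scope.

Local Notation "x %:F" := (FracField.tofrac x).

(* Everything below is algebraic: bundles are modules of algebraic sections,
   functions are regular functions. *)

(* ------------------------------------------------------------------------ *)
(* Regular functions on a principal open subset {s <> 0} of the affine plane *)

Section Regular.
Variables (K : fieldType) (s : {mpoly K[2]}).

Definition is_regular (x : {fraction {mpoly K[2]}}) : bool :=
  `[< exists p : {mpoly K[2]}, exists n : nat, x * s%:F ^+ n = p%:F >].

Lemma is_regular_subring : subring_closed is_regular.
Proof.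
split.
- by apply/asboolP; exists 1, 0%N; rewrite expr0 mulr1 rmorph1.
- move=> x y /asboolP[p [n hp]] /asboolP[q [m hq]]; apply/asboolP.
  exists (p * s ^+ m - q * s ^+ n), (n + m)%N.
  rewrite rmorphB !rmorphM !rmorphXn /= -hp -hq exprD mulrBl.
  by rewrite !mulrA; congr (_ - _); rewrite mulrAC.
- move=> x y /asboolP[p [n hp]] /asboolP[q [m hq]]; apply/asboolP.
  by exists (p * q), (n + m)%N; rewrite rmorphM /= -hp -hq exprD mulrACA.
Qed.

HB.instance Definition _ :=
  GRing.isSubringClosed.Build {fraction {mpoly K[2]}} is_regular
    is_regular_subring.

Record regular := Regular {
  regular_val : {fraction {mpoly K[2]}};
  _ : regular_val \in is_regular }.

HB.instance Definition _ := [isSub for regular_val].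
HB.instance Definition _ := [Choice of regular by <:].
HB.instance Definition _ := [SubChoice_isSubComNzRing of regular by <:].

Definition regular_unit : {pred regular} :=
  [pred x | (val x != 0) && ((val x)^-1 \in is_regular)].
Definition regular_inv (x : regular) : regular := insubd x (val x)^-1.

Lemma regular_mulVr : {in regular_unit, left_inverse 1 regular_inv *%R}.
Proof.
move=> x /andP[x0 xV]; apply: val_inj.
by rewrite rmorphM rmorph1 /= /regular_inv insubdK // mulVf.
Qed.

Lemma regular_unitP (x y : regular) : y * x = 1 -> regular_unit x.
Proof.
move=> /(congr1 val); rewrite rmorphM rmorph1 /= => yx.
have x0 : val x != 0.
  by apply/eqP => x0; move/eqP: yx; rewrite x0 mulr0 eq_sym oner_eq0.
apply/andP; split=> //.
suff -> : (val x)^-1 = val y by apply: valP.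
by apply: (mulIf x0); rewrite mulVf.
Qed.

Lemma regular_inv_out : {in [predC regular_unit], regular_inv =1 id}.
Proof.
move=> x; rewrite !inE negb_and negbK => /orP[/eqP x0|xV].
  by apply: val_inj; rewrite /regular_inv x0 invr0 val_insubd x0 if_same.
by rewrite /regular_inv /insubd insubN.
Qed.

HB.instance Definition _ := GRing.ComNzRing_hasMulInverse.Build regular
  regular_mulVr regular_unitP regular_inv_out.

Lemma polynomial_regular (p : {mpoly K[2]}) : p%:F \in is_regular.
Proof. by apply/asboolP; exists p, 0%N; rewrite expr0 mulr1. Qed.

Definition of_mpoly (p : {mpoly K[2]}) : regular :=
  Regular (polynomial_regular p).

Definition coordinate (i : 'I_2) : regular := of_mpoly 'X_i.
Definition constant (c : K) : regular := of_mpoly c%:MP.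

(* A presentation x = p / s ^+ n; the definitions below do not depend on the
   presentation chosen when s <> 0. *)
Lemma presentation_ex (x : regular) :
  exists pn : {mpoly K[2]} * nat, val x * s%:F ^+ pn.2 = pn.1%:F.
Proof. by case: x => x /= /asboolP[p [n h]]; exists (p, n). Qed.

Definition presentation (x : regular) : {mpoly K[2]} * nat :=
  projT1 (cid (presentation_ex x)).

Lemma partial_subproof (i : 'I_2) (p : {mpoly K[2]}) (n : nat) :
  (p^`M(i) * s - (p * s^`M(i)) *+ n)%:F / s%:F ^+ n.+1 \in is_regular.
Proof.
apply/asboolP; have [s0|s0] := eqVneq (s%:F : {fraction {mpoly K[2]}}) 0.
  exists 0, 1%N.
  by rewrite s0 expr1 mulr0 rmorph0.
exists (p^`M(i) * s - (p * s^`M(i)) *+ n), n.+1.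
by rewrite divfK; [reflexivity | exact: expf_neq0].
Qed.

(* partial derivative, by the quotient rule for p / s ^+ n *)
Definition partial (i : 'I_2) (x : regular) : regular :=
  Regular (partial_subproof i (presentation x).1 (presentation x).2).

(* composition with the map y = (y_0, y_1) whose components are elements of a
   K-algebra in which s(y) is invertible *)
Definition regular_comp (S : comUnitRingType) (cst : K -> S) (y : 'I_2 -> S)
  (x : regular) : S :=
  mmap cst y (presentation x).1 / mmap cst y s ^+ (presentation x).2.

End Regular.

(* ------------------------------------------------------------------------ *)
Section Bases.
Variable R : realType.
Local Notation C := (complex R).

(* M = {(q_1, q_2) in (C^* )^2, q_1 <> 1/4} *)
Definition M_locus : {mpoly C[2]} :=
  'X_ord0 * 'X_ord_max * (4%:R *: 'X_ord0 - 1).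
Definition OM := regular M_locus.
HB.instance Definition _ := GRing.ComUnitRing.on OM.
Definition q1 : OM := coordinate M_locus ord0.
Definition q2 : OM := coordinate M_locus ord_max.
Definition q1d1 (x : OM) : OM := q1 * partial ord0 x.
Definition q2d2 (x : OM) : OM := q2 * partial ord_max x.

(* Mt = {(r_1, r_2) in (C^* )^2, r_1 <> 1, -1} *)
Definition Mt_locus : {mpoly C[2]} :=
  'X_ord0 * 'X_ord_max * ('X_ord0 - 1) * ('X_ord0 + 1).
Definition OMt := regular Mt_locus.
HB.instance Definition _ := GRing.ComUnitRing.on OMt.
Definition r1 : OMt := coordinate Mt_locus ord0.
Definition r2 : OMt := coordinate Mt_locus ord_max.
Definition r1d1 (x : OMt) : OMt := r1 * partial ord0 x.
Definition r2d2 (x : OMt) : OMt := r2 * partial ord_max x.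
Definition scal (c : C) : OMt := constant Mt_locus c.

(* pull-back of functions along
   (r_1, r_2) |-> (q_1, q_2) = (r_1 / (1 + r_1)^2, r_2 (1 + r_1)) *)
Definition coord_change (i : 'I_2) : OMt :=
  if i == ord0 then r1 / (1 + r1) ^+ 2 else r2 * (1 + r1).
Definition nu (x : OM) : OMt := regular_comp scal coord_change x.

End Bases.

(* ------------------------------------------------------------------------ *)
Section ModuleQuotient.
Variables (A : nzRingType) (V : lmodType A) (N : {pred V}).
Hypothesis N_submod : submod_closed N.

Definition submodule_pred : zmodClosed V :=
  HB.pack_for (zmodClosed V) (N : V -> bool)
    (GRing.isZmodClosed.Build V N (GRing.submod_closedB N_submod)).

Definition modquot := Quotient.quot submodule_pred.
HB.instance Definition _ := GRing.Zmodule.on modquot.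

Definition modpi (v : V) : modquot := \pi_(Quotient.quot submodule_pred)%qT v.
Definition modrepr (x : modquot) : V := repr (x : Quotient.quot submodule_pred).

Lemma modreprK : cancel modrepr modpi.
Proof. exact: reprK. Qed.

Lemma modpiP (v w : V) : (modpi v == modpi w) = (v - w \in N).
Proof. by rewrite /modpi -Quotient.idealrBE. Qed.

Lemma modpiB : {morph modpi : v w / v - w}.
Proof. by move=> v w; rewrite /modpi raddfB. Qed.

Lemma modpiD : {morph modpi : v w / v + w}.
Proof. by move=> v w; rewrite /modpi raddfD. Qed.

Definition modscale (a : A) (x : modquot) : modquot :=
  modpi (a *: modrepr x).

Lemma modscale_pi a v : modscale a (modpi v) = modpi (a *: v).
Proof.
apply/eqP; case: N_submod => N0 NL; rewrite modpiP -scalerBr -[_ *: _]addr0 NL //.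
by rewrite -modpiP modreprK.
Qed.

Lemma modscaleA a b x : modscale a (modscale b x) = modscale (a * b) x.
Proof. by rewrite -(modreprK x) !modscale_pi scalerA. Qed.
Lemma modscale1 : left_id 1 modscale.
Proof. by move=> x; rewrite -(modreprK x) modscale_pi scale1r. Qed.
Lemma modscaleDr : right_distributive modscale +%R.
Proof.
move=> a x y; rewrite -(modreprK x) -(modreprK y) -modpiD !modscale_pi.
by rewrite scalerDr modpiD.
Qed.
Lemma modscaleDl x : {morph modscale^~ x : a b / a + b}.
Proof.
by move=> a b; rewrite -(modreprK x) !modscale_pi scalerDl modpiD.
Qed.

HB.instance Definition _ := GRing.Zmodule_isLmodule.Build A modquot
  modscaleA modscale1 modscaleDr modscaleDl.

End ModuleQuotient.

From mathcomp Require Import monalg.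

(* ------------------------------------------------------------------------ *)
(* Laurent polynomials in u_1, u_2 over A, as finitely supported maps Z^2 -> A.
   The ring structure that monalg provides does not apply, since it asks for
   monomials without inverses; hence lmul. *)

Definition expo : choiceType := (int * int)%type.

Section Laurent.
Variable (A : comNzRingType).

Definition laurent := monalg.malg expo A.
HB.instance Definition _ := GRing.Lmodule.on laurent.

(* c u_1^a u_2^b *)
Definition monomial (c : A) (a b : int) : laurent :=
  monalg.mkmalgU ((a, b) : expo) c.

Definition lsum (V : zmodType) (h : expo -> A -> V) (g : laurent) : V :=
  \sum_(k <- monalg.msupp g) h k (monalg.mcoeff k g).

Lemma lsum_linear (V : lmodType A) (h : expo -> A -> V) :
  (forall k a b c, h k (a * b + c) = a *: h k b + h k c) -> linear (lsum h).
Proof.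
move=> hL a g1 g2.
have h0 k : h k 0 = 0.
  have := hL k 1 0 0; rewrite mul1r addr0 scale1r => /esym/eqP.
  by rewrite -subr_eq0 addrK => /eqP.
pose D := (monalg.msupp g1 `|` monalg.msupp g2)%fset.
have lsumE g : (monalg.msupp g `<=` D)%fset ->
    lsum h g = \sum_(k <- D) h k (monalg.mcoeff k g).
  move=> le; rewrite /lsum; apply: big_fset_incl => // k _.
  by move=> /monalg.mcoeff_outdom ->.
rewrite !lsumE ?fsubsetUl ?fsubsetUr //.
  rewrite scaler_sumr -big_split /=; apply: eq_bigr => k _.
  by rewrite monalg.mcoeffD monalg.mcoeffZ hL.
apply: fsubset_trans (monalg.msuppD_le _ _) _.
by rewrite fsetSU // monalg.msuppZ_le.
Qed.

Definition shift (k : expo) : laurent -> laurent :=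
  lsum (fun l c => monalg.mkmalgU (k + l : int * int) c).

Definition lmul (f g : laurent) : laurent :=
  lsum (fun k c => c *: shift k g) f.

(* u_1 d/du_1 and u_2 d/du_2 *)
Definition euler1 : laurent -> laurent :=
  lsum (fun k c => monalg.mkmalgU k (c *~ k.1)).
Definition euler2 : laurent -> laurent :=
  lsum (fun k c => monalg.mkmalgU k (c *~ k.2)).

Lemma mkmalgU_linear k a (b c : A) :
  monalg.mkmalgU (k : expo) (a * b + c) =
  a *: (monalg.mkmalgU k b : laurent) + monalg.mkmalgU k c.
Proof.
apply/monalg.malgP => l.
by rewrite monalg.mcoeffD monalg.mcoeffZ !monalg.mcoeffU mulrnDl mulrnAr.
Qed.

Lemma shift_linear k : linear (shift k).
Proof. by apply: lsum_linear => l a b c; rewrite mkmalgU_linear. Qed.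

Lemma scale_linear (V : lmodType A) (c a : A) (x y : V) :
  c *: (a *: x + y) = a *: (c *: x) + c *: y.
Proof. by rewrite scalerDr !scalerA mulrC. Qed.

Lemma sub_linear_comb (V : lmodType A) (c a : A) (x y z t : V) :
  a *: (c *: x - z) + (c *: y - t) = c *: (a *: x + y) - (a *: z + t).
Proof. by rewrite [in RHS]scale_linear scalerBr opprD addrACA. Qed.

Lemma lmul_linear f : linear (lmul f).
Proof.
move=> a g1 g2; rewrite /lmul /lsum scaler_sumr -big_split /=.
apply: eq_bigr => k _.
exact: etrans (congr1 _ (shift_linear k a g1 g2)) (scale_linear _ _ _ _).
Qed.

Lemma euler1_linear : linear euler1.
Proof.
by apply: lsum_linear => l a b c; rewrite mulrzDl -mulrzAr mkmalgU_linear.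
Qed.

Lemma euler2_linear : linear euler2.
Proof.
by apply: lsum_linear => l a b c; rewrite mulrzDl -mulrzAr mkmalgU_linear.
Qed.

End Laurent.

Definition lmap (A B : comNzRingType) (h : A -> B) : laurent A -> laurent B :=
  lsum (fun k c => monalg.mkmalgU k (h c)).

(* ------------------------------------------------------------------------ *)
(* The family F = u_1 + u_2 + q_1 u_2^2 / u_1 + q_2 / u_2 over a base with ring
   of functions O; functions on base x C_theta form {poly O}, with 'X = theta.

   The form g du_1/u_1 /\ du_2/u_2 is represented by g, and the form
   g1 du_1/u_1 + g2 du_2/u_2 by (g1, g2).  The operator (theta d - dF /\) only
   differentiates along u_1, u_2, so that for a map nu from another base, the
   tensor product of brieskorn O q1 q2 with the functions of the source is
   brieskorn O' (q1 o nu) (q2 o nu). *)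

Section Brieskorn.
Variables (O : comNzRingType) (q1 q2 : O).
Local Notation A := {poly O}.

Definition potential : laurent A :=
  monomial 1 1 0 + monomial 1 0 1
  + monomial q1%:P (-1) 2 + monomial q2%:P 0 (-1).

Definition twisted_d (g1 g2 : laurent A) : laurent A :=
  'X *: (euler1 g2 - euler2 g1)
  - (lmul (euler1 potential) g2 - lmul (euler2 potential) g1).

Definition exact_form : {pred laurent A} :=
  fun g => `[< exists g1 g2, g = twisted_d g1 g2 >].

Lemma exact_form_submod : submod_closed exact_form.
Proof.
have L0 (V W : lmodType A) (h : V -> W) : linear h -> h 0 = 0.
  move=> hL; have := hL (-1) 0 0; rewrite scaler0 addr0 => ->.
  by rewrite scaleN1r addNr.
split.
  apply/asboolP; exists 0, 0; rewrite /twisted_d.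
  rewrite (L0 _ _ _ (@euler1_linear A)) (L0 _ _ _ (@euler2_linear A)).
  by rewrite !(L0 _ _ _ (lmul_linear _)) !subrr scaler0 subrr.
move=> a _ _ /asboolP[g1 [g2 ->]] /asboolP[k1 [k2 ->]]; apply/asboolP.
have sub_linear (h h' : laurent A -> laurent A) : linear h -> linear h' ->
    h (a *: g2 + k2) - h' (a *: g1 + k1) =
    a *: (h g2 - h' g1) + (h k2 - h' k1).
  by move=> hL h'L; rewrite hL h'L scalerBr opprD addrACA.
exists (a *: g1 + k1), (a *: g2 + k2); rewrite /twisted_d.
have E1 := sub_linear _ _ (@euler1_linear A) (@euler2_linear A).
have E2 := sub_linear _ _ (lmul_linear (euler1 potential))
  (lmul_linear (euler2 potential)).
rewrite [X in _ = 'X *: X - _]E1 [X in _ = _ - X]E2.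
exact: sub_linear_comb.
Qed.

Definition brieskorn := modquot exact_form_submod.
HB.instance Definition _ := GRing.Lmodule.on brieskorn.

Definition form_class (g : laurent A) : brieskorn := modpi exact_form_submod g.

(* theta nabla_X for a vector field X on the base, acting on O as delta:
   theta nabla_X (h [eta]) = theta X(h) [eta] - h [X(F) eta] *)
Definition gm_base (delta : O -> O) (x : brieskorn) : brieskorn :=
  form_class ('X *: lmap (map_poly delta) (modrepr x)
              - lmul (lmap (map_poly delta) potential) (modrepr x)).

(* theta^2 nabla_{d/dtheta} (h [eta]) = theta^2 (dh/dtheta) [eta] + h [F eta] *)
Definition gm_theta (x : brieskorn) : brieskorn :=
  form_class ('X ^+ 2 *: lmap (@deriv O) (modrepr x)
              + lmul potential (modrepr x)).

End Brieskorn.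

Definition brieskorn_pullback (O O' : comNzRingType) (h : O -> O') (q1 q2 : O)
  (x : brieskorn q1 q2) : brieskorn (h q1) (h q2) :=
  form_class _ _ (lmap (map_poly h) (modrepr x)).

(* ------------------------------------------------------------------------ *)
(* Quantum differential systems over a base with coordinates r_1, r_2, ring of
   functions O and derivations d1 = r_1 d/dr_1, d2 = r_2 d/dr_2.

   qsec is the module of sections over (base x C_theta) and qframe a
   trivialization along P^1, so that the sections over base x P^1 are the
   O-combinations of qframe.  The poles along theta = 0 being those of
   nabla = D + Phi / theta + (V_0 / theta + V_oo) dtheta / theta, the operators
   theta nabla_X preserve qsec for X among r_1 d/dr_1, r_2 d/dr_2,
   theta d/dtheta; qconn X stands for theta nabla_X. *)

Inductive vfield := VR1 | VR2 | VTheta.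

Record qds (O : comUnitRingType) := Qds {
  qsec :> lmodType {poly O};
  qrank : nat;
  qframe : 'I_qrank -> qsec;
  qconn : vfield -> qsec -> qsec;
  qweight : nat;
  qpair : qsec -> qsec -> {poly O} }.

Section QuantumDifferentialSystems.
Variables (O : comUnitRingType) (d1 d2 : O -> O).

Definition vact (X : vfield) (h : {poly O}) : {poly O} :=
  match X with
  | VR1 => map_poly d1 h
  | VR2 => map_poly d2 h
  | VTheta => 'X * h^`()
  end.

(* h(theta) |-> h(- theta) *)
Definition theta_conj (h : {poly O}) : {poly O} := h \Po (- 'X).

Definition is_global (Q : qds O) (x : Q) : Prop :=
  exists c : 'I_(qrank Q) -> O, x = \sum_i (c i)%:P *: qframe i.

(* y is the restriction of x to theta = 0, where sections at theta = 0 are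
   identified with global sections *)
Definition at_theta0 (Q : qds O) (x y : Q) : Prop :=
  is_global y /\ exists z : Q, x = y + 'X *: z.

(* Flatness is [nabla_X, nabla_Y] = 0 for commuting X and Y; the terms in
   X(theta), Y(theta) and the sign in pair_flat come from the factors theta in
   qconn, one of which is conjugated. *)
Record is_qds (Q : qds O) : Prop := IsQds {
  frame_basis : forall x : Q,
    exists! c : {ffun 'I_(qrank Q) -> {poly O}}, x = \sum_i c i *: qframe i;
  conn_add : forall X, {morph @qconn O Q X : x y / x + y};
  conn_leibniz : forall X (h : {poly O}) (x : Q),
    qconn X (h *: x) = ('X * vact X h) *: x + h *: qconn X x;
  conn_poles : forall X (j : 'I_(qrank Q)),
    exists a b : 'I_(qrank Q) -> O,
      qconn X (qframe j) = \sum_i ((a i)%:P + (b i)%:P * 'X) *: qframe i;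
  conn_flat : forall X Y (x : Q),
    qconn X (qconn Y x) - vact X 'X *: qconn Y x =
    qconn Y (qconn X x) - vact Y 'X *: qconn X x;
  pair_linear : forall (h : {poly O}) (x y z : Q),
    qpair (h *: x + y) z = h * qpair x z + qpair y z;
  pair_conjlinear : forall (h : {poly O}) (x y z : Q),
    qpair z (h *: x + y) = theta_conj h * qpair z x + qpair z y;
  pair_nondegenerate : exists2 G : 'M[O]_(qrank Q), G \in unitmx &
    forall i j, qpair (qframe i) (qframe j) = (G i j)%:P * 'X^(qweight Q);
  pair_flat : forall X (x y : Q),
    'X * vact X (qpair x y) = qpair (qconn X x) y - qpair x (qconn X y) }.

Record is_qds_isomorphism (Q Q' : qds O) (gamma : {linear Q -> Q'}) : Prop :=
  IsQdsIsomorphism {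
    iso_bij : bijective gamma;
    iso_global : forall x : Q, is_global (gamma x) <-> is_global x;
    iso_conn : forall X (x : Q), gamma (qconn X x) = qconn X (gamma x);
    iso_pair : forall x y : Q, qpair (gamma x) (gamma y) = qpair x y }.

End QuantumDifferentialSystems.

(* coordinates of x in a basis e (arbitrary if there are none) *)
Definition coordinates (A : nzRingType) (E : lmodType A) (n : nat)
  (e : 'I_n -> E) (x : E) : 'I_n -> A :=
  match pselect (exists c : 'I_n -> A, x = \sum_i c i *: e i) with
  | left h => projT1 (cid h)
  | right _ => fun=> 0
  end.

(* ------------------------------------------------------------------------ *)
Section BSide.
Variable R : realType.
Local Notation r1 := (r1 R).
Local Notation r2 := (r2 R).
Local Notation q1 := (q1 R).
Local Notation q2 := (q2 R).

Definition G0 := brieskorn q1 q2.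
HB.instance Definition _ := GRing.Lmodule.on G0.

Definition omega0 : G0 := form_class q1 q2 (monomial 1 0 0).
Definition omega1 : G0 := - gm_base (@q2d2 R) omega0.
Definition omega2 : G0 := gm_base (@q2d2 R) (gm_base (@q1d1 R) omega0).
Definition omega3 : G0 := - gm_base (@q1d1 R) omega0.

Definition G0t := brieskorn (nu q1) (nu q2).
HB.instance Definition _ := GRing.Lmodule.on G0t.

Definition pull (x : G0) : G0t := @brieskorn_pullback _ _ (@nu R) q1 q2 x.

(* the branch of (1 - 4 q_1)^(1/2) *)
Definition root : OMt R := (r1 - 1) / (r1 + 1).

Definition epsilon (i : 'I_4) : G0t :=
  match val i with
  | 0 => pull omega0
  | 1 => pull omega1
  | 2 => pull omega2
  | _ => root%:P *: pull omega3 - (2%:R^-1 * (root + 1))%:P *: pull omega1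
  end.

(* S(epsilon_i, epsilon_j) without its factor theta^2 *)
Definition epsilon_gram (i j : 'I_4) : OMt R :=
  match val i, val j with
  | 0, 2 | 2, 0 => 1
  | 1, 1 => 2%:R
  | 3, 1 | 1, 3 => - 1
  | _, _ => 0
  end.

Definition B_pair (x y : G0t) : {poly OMt R} :=
  \sum_i \sum_j coordinates epsilon x i * theta_conj (coordinates epsilon y j)
                * ((epsilon_gram i j)%:P * 'X^2).

(* The pulled-back connection along X is given by the chain rule
   X(F o nu) = sum_j X(q_j) dF/dq_j, i.e. by gm_base for the pulled-back F. *)
Definition B_conn (X : vfield) : G0t -> G0t :=
  match X with
  | VR1 => gm_base (@r1d1 R)
  | VR2 => gm_base (@r2d2 R)
  | VTheta => @gm_theta _ _ _
  end.

Definition Q_B : qds (OMt R) := Qds epsilon B_conn 2 B_pair.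

End BSide.

(* ------------------------------------------------------------------------ *)
(* H^*(F_2) with coefficients in A, in coordinates on the classical basis
   1, f, H, f \cup H. *)

Section Cohomology.
Variable A : comNzRingType.
Local Notation coh := 'rV[A]_4.

Definition c1 : coh := delta_mx 0 (inord 0).
Definition cf : coh := delta_mx 0 (inord 1).
Definition cH : coh := delta_mx 0 (inord 2).
Definition cfH : coh := delta_mx 0 (inord 3).

Definition bilinear_ext (t : 'I_4 -> 'I_4 -> coh) (a b : coh) : coh :=
  \sum_i \sum_j (a 0 i * b 0 j) *: t i j.

Definition cup_table (i j : 'I_4) : coh :=
  match val i, val j with
  | 0, _ => delta_mx 0 j
  | _, 0 => delta_mx 0 i
  | 1, 2 | 2, 1 => cfH
  | 2, 2 => 2%:R *: cfH
  | _, _ => 0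
  end.
Definition cup := bilinear_ext cup_table.
Definition integral (a : coh) : A := a 0 (inord 3).
Definition poincare (a b : coh) : A := integral (cup a b).

(* The small quantum product: the classical class f \cup H is
   f o H - r_1 r_2 (compare the pairings of f o H below), and the relations
   proved below, with associativity, determine the table. *)
Definition quantum_table (x1 x2 : A) (i j : 'I_4) : coh :=
  match val i, val j with
  | 0, _ => delta_mx 0 j
  | _, 0 => delta_mx 0 i
  | 1, 1 => (x1 * x2) *: c1
  | 1, 2 | 2, 1 => cfH + (x1 * x2) *: c1
  | 2, 2 => 2%:R *: cfH + (x2 * (1 + x1)) *: c1
  | 1, 3 | 3, 1 => (x1 * x2) *: (cH - cf)
  | 2, 3 | 3, 2 => (x2 * (1 - x1)) *: cf + (x1 * x2) *: cH
  | _, _ => (x1 * x2 ^+ 2) *: c1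
  end.
Definition qprod (x1 x2 : A) := bilinear_ext (quantum_table x1 x2).

Lemma bilinear_ext_delta t i j :
  bilinear_ext t (delta_mx 0 i) (delta_mx 0 j) = t i j.
Proof.
rewrite /bilinear_ext (bigD1 i) //= [X in _ + X]big1 => [|k /negPf ki].
  rewrite addr0 (bigD1 j) //= big1 => [|k /negPf kj].
    by rewrite !mxE !eqxx mulr1 scale1r addr0.
  by rewrite !mxE kj andbF mulr0 scale0r.
by rewrite big1 // => l _; rewrite !mxE ki andbF mul0r scale0r.
Qed.

Lemma bilinear_extDr t a b c :
  bilinear_ext t a (b + c) = bilinear_ext t a b + bilinear_ext t a c.
Proof.
rewrite -big_split /=; apply: eq_bigr => i _; rewrite -big_split /=.
by apply: eq_bigr => j _; rewrite mxE mulrDr scalerDl.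
Qed.

Lemma bilinear_extZr t x a b :
  bilinear_ext t a (x *: b) = x *: bilinear_ext t a b.
Proof.
rewrite scaler_sumr; apply: eq_bigr => i _; rewrite scaler_sumr.
by apply: eq_bigr => j _; rewrite mxE scalerA mulrCA.
Qed.

Lemma poincare_delta i j :
  poincare (delta_mx 0 i) (delta_mx 0 j) = integral (cup_table i j).
Proof. by rewrite /poincare /cup bilinear_ext_delta. Qed.

Lemma poincareDr a b c : poincare a (b + c) = poincare a b + poincare a c.
Proof. by rewrite /poincare /cup bilinear_extDr /integral mxE. Qed.

Lemma poincareZr x a b : poincare a (x *: b) = x * poincare a b.
Proof. by rewrite /poincare /cup bilinear_extZr /integral mxE. Qed.

Lemma poincareC a b : poincare a b = poincare b a.
Proof.
rewrite /poincare /cup /bilinear_ext exchange_big; congr integral.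
apply: eq_bigr => i _; apply: eq_bigr => j _; rewrite mulrC; congr (_ *: _).
by rewrite /cup_table; case: i j => [[|[|[|[|//]]]] ?] [[|[|[|[|//]]]] ?];
  rewrite //=; congr delta_mx; apply: val_inj.
Qed.

Section QuantumRelations.
Variables x1 x2 : A.
Local Notation qp := (qprod x1 x2).
Local Notation fH := (qp cf cH).

Let tabE := (bilinear_extDr, bilinear_extZr, bilinear_ext_delta).

Lemma qprod_1 a : qp c1 a = a.
Proof.
rewrite /qprod /bilinear_ext (bigD1 (inord 0)) //= [X in _ + X]big1.
  rewrite addr0 [RHS]row_sum_delta; apply: eq_bigr => j _.
  by rewrite /quantum_table /= inordK // mxE !eqxx mul1r.
move=> i /negPf i0; apply: big1 => j _.
by rewrite mxE i0 andbF mul0r scale0r.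
Qed.

Lemma qprodC a b : qp a b = qp b a.
Proof.
rewrite /qprod /bilinear_ext exchange_big; apply: eq_bigr => i _.
apply: eq_bigr => j _; rewrite mulrC; congr (_ *: _).
by rewrite /quantum_table; case: i j => [[|[|[|[|//]]]] ?] [[|[|[|[|//]]]] ?];
  rewrite //=; congr delta_mx; apply: val_inj.
Qed.

Lemma qprod_fH : fH = cfH + (x1 * x2) *: c1.
Proof. by rewrite /qprod tabE /quantum_table /= !inordK. Qed.

Lemma qprod_ff : qp cf cf = (x1 * x2) *: c1.
Proof. by rewrite /qprod tabE /quantum_table /= !inordK. Qed.

Lemma qprod_HH : qp cH cH = 2%:R *: fH + (x2 * (1 - x1)) *: c1.
Proof.
rewrite qprod_fH /qprod tabE /quantum_table /= !inordK //.
by rewrite scalerDr scalerA -addrA -scalerDl; congr (_ + _ *: _); ring.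
Qed.

Lemma qprod_f_fH : qp cf fH = (x1 * x2) *: cH.
Proof.
rewrite qprod_fH /qprod !tabE /quantum_table /= !inordK //=.
by rewrite scalerBr subrK.
Qed.

Lemma qprod_H_fH : qp cH fH = (x2 * (1 - x1)) *: cf + (2%:R * x1 * x2) *: cH.
Proof.
rewrite qprod_fH /qprod !tabE /quantum_table /= !inordK //=.
by rewrite -addrA -scalerDl -mulrA mulrDl !mul1r.
Qed.

Let pairE := (poincareDr, poincareZr, poincare_delta).

Lemma poincare_1_fH : poincare c1 fH = 1.
Proof.
rewrite qprod_fH !pairE /integral /cup_table /= !inordK //= !mxE.
by rewrite -!val_eqE /= !inordK //= mulr0 addr0.
Qed.

Lemma poincare_f_fH : poincare cf fH = 0.
Proof.
rewrite qprod_fH !pairE /integral /cup_table /= !inordK //= !mxE.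
by rewrite -!val_eqE /= !inordK //= mulr0 addr0.
Qed.

Lemma poincare_H_fH : poincare cH fH = 0.
Proof.
rewrite qprod_fH !pairE /integral /cup_table /= !inordK //= !mxE.
by rewrite -!val_eqE /= !inordK //= mulr0 addr0.
Qed.

Lemma poincare_fH_fH : poincare fH fH = 2%:R * x1 * x2.
Proof.
rewrite qprod_fH poincareDr poincareZr !(poincareC (_ + _)) !pairE.
rewrite /integral /cup_table /= !inordK //= !mxE -!val_eqE /= !inordK //=.
by ring.
Qed.

End QuantumRelations.

(* half of the degree, in the basis 1, f, H, f \cup H *)
Definition half_deg (a : coh) : coh :=
  \row_i (a 0 i *+ nth 0%N [:: 0; 1; 1; 2] i).

End Cohomology.

Section ASide.
Variable R : realType.

Local Notation T1 := ((r1 R)%:P).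
Local Notation T2 := ((r2 R)%:P).

Definition A_conn (X : vfield) (a : 'rV[{poly OMt R}]_4) :
    'rV[{poly OMt R}]_4 :=
  'X *: map_mx (vact (@r1d1 R) (@r2d2 R) X) a +
  match X with
  | VR1 => qprod T1 T2 (cf _) a
  | VR2 => qprod T1 T2 (cH _) a
  | VTheta => - qprod T1 T2 (2%:R *: cH _) a + 'X *: half_deg a
  end.

Definition A_pair (a b : 'rV[{poly OMt R}]_4) : {poly OMt R} :=
  poincare a (map_mx (@theta_conj _) b) * 'X^2.

Definition A_frame (i : 'I_4) : 'rV[{poly OMt R}]_4 := delta_mx 0 i.

Definition Q_A : qds (OMt R) := Qds A_frame A_conn 2 A_pair.

(* the section of Q_A given by a cohomology class *)
Definition of_class (c : 'rV[complex R]_4) : Q_A :=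
  map_mx (fun z => (scal z)%:P) c.

End ASide.

(* Main.v *)
(** Put e = [du_1/u_1 /\ du_2/u_2] in the pulled-back Brieskorn lattice G, and
    write nabla_i for theta nabla along r_i d/dr_i.  Explicit exact forms show
    that nabla_1^2 e = r_1 r_2 e and nabla_2^2 e = 2 nabla_1 nabla_2 e
    + r_2 (1 - r_1) e; commuting the nabla's, these determine the connection on
    e, nabla_1 e, nabla_2 e, nabla_2 nabla_1 e, and the result is the quantum
    connection.  Hence gamma, the linear map from the A-side to G defined on
    these elements, intertwines the connections.

    That gamma is bijective, i.e. that G is free of rank 4, is the main point.
    In G the class of u_1^a u_2^b moves to a neighbouring exponent under first
    order operators in nabla_1, nabla_2 (the exact forms being used to express
    multiplication by u_1 and u_2).  The same operators act on the A-side by the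
    quantum connection; starting from the class 1 they give a well defined
    element v(a, b) for each exponent, because they satisfy the same commutation
    relations and the two relations needed at 1.  Then u_1^a u_2^b |-> v(a, b)
    kills exact forms and induces the inverse of gamma.  All the statements on
    the B-side are then transported from the A-side. *)

Require Import Defs.
From HB Require Import structures.
From mathcomp Require Import all_boot all_order all_algebra.
From mathcomp Require Import boolp reals complex ring zify.
From mathcomp Require Import finmap mpoly.
From mathcomp Require monalg.

Set Implicit Arguments.
Unset Strict Implicit.
Unset Printing Implicit Defensive.

Import GRing.Theory.
Local Open Scope ring_scope.

(** * Derivations *)

(** The function t = r_1 / (1 + r_1) makes the square root rational: q_1 = t (1 - t), and s = 1 - 2
    t satisfies s^2 = 1 - 4 q_1 and is the opposite of the chosen branch. If K_i denotes theta nabla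
    along q_i d/dq_i, the chain rule gives nabla_1 = s K_1 + t K_2 and nabla_2 = K_2, so K_1 is
    recovered because s is invertible. On a monomial, K_1 is multiplication by - q_1 u_2^2 / u_1 and
    K_2 by - q_2 / u_2; the two exact forms attached to the monomial then express multiplication by
    u_1 and u_2 through theta, K_1 and K_2. This is the origin of the first order operators. The two
    relations at 1 are the cancellations u_2^(-1) u_2 = 1 and u_1 (u_2^2 / u_1) = u_2^2. On the
    A-side they are the hypergeometric equations K_2 (K_2 - 2 K_1) = q_2 and K_1^2 = q_1 (K_2 - 2
    K_1)(K_2 - 2 K_1 - theta), applied to 1; commutation carries them to all other exponents. The
    obstacle is injectivity of gamma: reducing every monomial to four classes only shows that they
    generate the quotient G, so a map out of G has to be constructed. *)

Definition derivation (A : pzRingType) (d : A -> A) : Prop :=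
  (forall x y, d (x + y) = d x + d y) /\
  (forall x y, d (x * y) = d x * y + x * d y).

Section DerivationTheory.
Variables (A : pzRingType) (d : A -> A).
Hypothesis dP : derivation d.

Lemma derD x y : d (x + y) = d x + d y. Proof. exact: dP.1. Qed.
Lemma derM x y : d (x * y) = d x * y + x * d y. Proof. exact: dP.2. Qed.
Lemma der0 : d 0 = 0.
Proof. by apply: (addIr (d 0)); rewrite -derD !add0r. Qed.
Lemma der1 : d 1 = 0.
Proof.
have /eqP := derM 1 1; rewrite !mulr1 mul1r -subr_eq0 opprD addrA subrr.
by rewrite sub0r oppr_eq0 => /eqP.
Qed.
Lemma derN x : d (- x) = - d x.
Proof. by apply: (addIr (d x)); rewrite -derD !addNr der0. Qed.
Lemma derB x y : d (x - y) = d x - d y.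
Proof. by rewrite derD derN. Qed.
Lemma der_nat n : d n%:R = 0.
Proof. by elim: n => [|n IH]; rewrite ?der0 // mulrS derD IH der1 addr0. Qed.
End DerivationTheory.

(** The extra factor [x] keeps the exponent at [n], so that no truncated [n - 1] appears. *)
Lemma derX (A : comPzRingType) (d : A -> A) : derivation d ->
  forall x n, x * d (x ^+ n) = (x ^+ n * d x) *+ n.
Proof.
move=> dP x; elim=> [|n IH]; first by rewrite expr0 (der1 dP) mulr0.
by rewrite exprS (derM dP) mulrDr IH; ring.
Qed.

Lemma der_divr (A : comUnitRingType) (d : A -> A) (x y : A) : derivation d ->
  y \is a GRing.unit -> d (x / y) = (d x - x / y * d y) / y.
Proof.
move=> dP yU; apply: (mulIr yU); rewrite (divrK yU).
have -> : d x = d (x / y) * y + x / y * d y by rewrite -(derM dP) divrK.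
by rewrite addrK.
Qed.

Lemma derV (A : comUnitRingType) (d : A -> A) (x : A) : derivation d ->
  x \is a GRing.unit -> d x^-1 = - x ^- 2 * d x.
Proof.
move=> dP xU; rewrite -[x^-1]mul1r (der_divr _ dP xU) (der1 dP).
by rewrite expr2 invrM //; ring.
Qed.

Lemma derivation_commutator (A : comPzRingType) (d d' : A -> A) :
  derivation d -> derivation d' -> derivation (fun x => d (d' x) - d' (d x)).
Proof.
move=> dP dP'; split=> x y; first by rewrite !(derD dP', derD dP); ring.
by rewrite !(derM dP', derM dP, derD dP', derD dP); ring.
Qed.

(** * Functions on principal open subsets of the plane *)

Section Localization.
Variables (P A : comNzRingType) (s : P) (iota : {rmorphism P -> A}).
Local Notation S := (iota s).
Hypothesis iota_inj : injective iota.
Hypothesis mulIS : forall n, injective (fun x : A => x * S ^+ n).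
Hypothesis fractionP : forall x : A, exists p n, x * S ^+ n = iota p.

(** This section reasons from equations [x * S ^+ n = iota p] rather than from a chosen
    presentation, so an operation given by a formula in [p] and [n] can be evaluated on whichever
    pair is at hand. *)
Lemma fraction_eq x p n q m : x * S ^+ n = iota p -> x * S ^+ m = iota q ->
  p * s ^+ m = q * s ^+ n.
Proof.
move=> xp xq; apply: iota_inj; rewrite !rmorphM !rmorphXn /= -xp -xq.
by rewrite mulrAC.
Qed.

Lemma fractionD x p n y q m : x * S ^+ n = iota p -> y * S ^+ m = iota q ->
  (x + y) * S ^+ (n + m) = iota (p * s ^+ m + q * s ^+ n).
Proof.
move=> xp yq; rewrite rmorphD !rmorphM !rmorphXn /= -xp -yq exprD mulrDl mulrA.
by rewrite [S ^+ n * _]mulrC [y * _]mulrA.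
Qed.

Lemma fractionM x p n y q m : x * S ^+ n = iota p -> y * S ^+ m = iota q ->
  (x * y) * S ^+ (n + m) = iota (p * q).
Proof. by move=> xp yq; rewrite rmorphM /= -xp -yq exprD mulrACA. Qed.

(** Two presentations satisfy [p * s ^+ m = q * s ^+ n]; applying [d] and multiplying by [s] shows
    that the quotient rule yields the same fraction from both. *)
Lemma quotient_rule (d : P -> P) x p n q m : derivation d ->
  x * S ^+ n = iota p -> x * S ^+ m = iota q ->
  (d p * s - (p * d s) *+ n) * s ^+ m.+1 =
  (d q * s - (q * d s) *+ m) * s ^+ n.+1.
Proof.
move=> dP xp xq; have pq := fraction_eq xp xq.
have dpq : d p * s ^+ m.+1 + (p * s ^+ m * d s) *+ m =
    d q * s ^+ n.+1 + (q * s ^+ n * d s) *+ n.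
  have := congr1 (fun z => s * d z) pq; rewrite !(derM dP) !mulrDr.
  rewrite !(mulrCA s) !(derX dP) => e; apply: etrans (etrans e _).
    by rewrite exprS; ring.
  by rewrite exprS; ring.
have -> : (d p * s - (p * d s) *+ n) * s ^+ m.+1 =
    s * (d p * s ^+ m.+1 + (p * s ^+ m * d s) *+ m
     - (p * s ^+ m * d s) *+ m - (p * s ^+ m * d s) *+ n).
  by rewrite exprS; ring.
by rewrite dpq pq exprS; ring.
Qed.

Section Derivation.
Variables (d : P -> P) (D : A -> A).
Hypothesis dP : derivation d.
Hypothesis DE : forall x p n, x * S ^+ n = iota p ->
  D x * S ^+ n.+1 = iota (d p * s - (p * d s) *+ n).

Lemma fraction_derivation : derivation D.
Proof.
split=> x y; have [p [n xp]] := fractionP x; have [q [m yq]] := fractionP y.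
  have := DE (fractionD xp yq) => xy.
  (* The quotient rule accounts for n + m + 1 factors; one more is needed to turn [d (s ^+ m)] into
     [s * d (s ^+ m)], where [derX] applies. *)
  apply: (@mulIS (n + m).+2); rewrite /= exprSr mulrA xy.
  have -> : (D x + D y) * (S ^+ (n + m).+1 * S) =
      D x * S ^+ n.+1 * S ^+ m.+1 + D y * S ^+ m.+1 * S ^+ n.+1.
    by rewrite -addSn exprD !exprS; ring.
  rewrite (DE xp) (DE yq) -!rmorphXn -!rmorphM -rmorphD; congr (iota _).
  rewrite (derD dP) !(derM dP).
  set e := d (s ^+ m); set e' := d (s ^+ n).
  have -> : (d p * s ^+ m + p * e + (d q * s ^+ n + q * e')) * s =
      (d p * s ^+ m + d q * s ^+ n) * s + (p * (s * e) + q * (s * e')) by ring.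
  by rewrite !(derX dP) !exprS; ring.
apply: (@mulIS (n + m).+1); rewrite /= (DE (fractionM xp yq)) mulrDl.
have -> : D x * y * S ^+ (n + m).+1 = (D x * S ^+ n.+1) * (y * S ^+ m).
  by rewrite -addSn exprD; ring.
have -> : x * D y * S ^+ (n + m).+1 = (x * S ^+ n) * (D y * S ^+ m.+1).
  by rewrite -addnS exprD; ring.
rewrite (DE xp) (DE yq) xp yq -!rmorphM -rmorphD; congr (iota _).
by rewrite (derM dP); ring.
Qed.

End Derivation.

(** Applying [D] to [x * S ^+ n = iota p] leaves [D x * S ^+ n = 0]. It is meant for the commutator
    of two partial derivatives, itself a derivation. *)
Lemma fraction_derivation_eq0 (D : A -> A) : derivation D ->
  (forall p, D (iota p) = 0) -> forall x, D x = 0.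
Proof.
move=> dD D0 x; have [p [n xp]] := fractionP x.
have := congr1 D xp; rewrite D0 (derM dD) -rmorphXn D0 mulr0 addr0 rmorphXn.
by move=> e; apply: (@mulIS n); rewrite /= mul0r.
Qed.

Section Morphism.
Variables (B : comUnitRingType) (g : {rmorphism P -> B}) (h : A -> B).
Hypothesis gU : g s \is a GRing.unit.
Hypothesis hE : forall x p n, x * S ^+ n = iota p -> h x = g p / g s ^+ n.

Lemma fraction_morphism_iota p : h (iota p) = g p.
Proof. by rewrite (@hE _ p 0) ?expr0 ?mulr1 ?divr1. Qed.

Lemma fraction_zmod_morphism : zmod_morphism h.
Proof.
move=> x y; have [p [n xp]] := fractionP x; have [q [m yq]] := fractionP y.
have yq' : (- y) * S ^+ m = iota (- q) by rewrite mulNr yq rmorphN.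
rewrite (hE (fractionD xp yq')) (hE xp) (hE yq).
rewrite rmorphD !rmorphM rmorphN !rmorphXn /= exprD.
by rewrite invrM ?unitrX // mulrDl; congr (_ + _);
  [rewrite mulrA mulrK|rewrite mulrCA mulrK 1?mulrC];
  rewrite ?unitrX // mulNr.
Qed.

Lemma fraction_monoid_morphism : monoid_morphism h.
Proof.
split; first by rewrite -(rmorph1 iota) fraction_morphism_iota rmorph1.
move=> x y; have [p [n xp]] := fractionP x; have [q [m yq]] := fractionP y.
rewrite (hE (fractionM xp yq)) (hE xp) (hE yq) rmorphM exprD.
by rewrite invrM ?unitrX // [_ ^-1 * _]mulrC mulrACA.
Qed.

End Morphism.
End Localization.

Section RegularTheory.
Variables (K : fieldType) (s : {mpoly K[2]}).

Lemma of_mpoly_zmod_morphism : zmod_morphism (of_mpoly s).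
Proof. by move=> p q; apply: val_inj; rewrite /= rmorphB. Qed.

Lemma of_mpoly_monoid_morphism : monoid_morphism (of_mpoly s).
Proof. by split=> [|p q]; apply: val_inj; rewrite /= ?rmorph1 ?rmorphM. Qed.

HB.instance Definition _ := GRing.isZmodMorphism.Build _ _ (of_mpoly s)
  of_mpoly_zmod_morphism.
HB.instance Definition _ := GRing.isMonoidMorphism.Build _ _ (of_mpoly s)
  of_mpoly_monoid_morphism.

Local Notation S := (of_mpoly s s).
Hypothesis s0 : s != 0.

Lemma of_mpoly_inj : injective (of_mpoly s).
Proof. by move=> p q [] /eqP; rewrite tofrac_eq => /eqP. Qed.

Lemma regular_mulIX n : injective (fun x : regular s => x * S ^+ n).
Proof.
move=> x y /(congr1 val); rewrite !rmorphM !rmorphXn /=.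
move=> /mulIf h; apply/val_inj/h; apply: expf_neq0.
by rewrite tofrac_eq0.
Qed.

Lemma presentationP (x : regular s) :
  x * S ^+ (presentation x).2 = of_mpoly s (presentation x).1.
Proof.
apply: val_inj; rewrite rmorphM rmorphXn /=.
by rewrite /presentation; case: cid.
Qed.

Lemma regular_fractionP (x : regular s) :
  exists p n, x * S ^+ n = of_mpoly s p.
Proof.
by exists (presentation x).1, (presentation x).2; exact: presentationP.
Qed.

Lemma mderiv_derivation (i : 'I_2) : derivation (@mderiv 2 K i).
Proof. by split=> x y; rewrite ?mderivD ?mderivM. Qed.

(** This frees [partial] from the presentation chosen in its definition. *)
Lemma partial_fraction (i : 'I_2) (x : regular s) p n :
  x * S ^+ n = of_mpoly s p ->
  partial i x * S ^+ n.+1 = of_mpoly s (p^`M(i) * s - (p * s^`M(i)) *+ n).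
Proof.
move=> xp; have := presentationP x; rewrite /partial.
case: (presentation x) => q m /= xq; apply: (@regular_mulIX m.+1).
have := quotient_rule of_mpoly_inj (mderiv_derivation i) xp xq.
move=> /(congr1 (of_mpoly s)); rewrite rmorphM rmorphXn => ->.
apply: val_inj; rewrite !rmorphM !rmorphXn /= mulrAC divfK //.
by rewrite expf_neq0 // tofrac_eq0.
Qed.

Lemma partial_of_mpoly (i : 'I_2) p :
  partial i (of_mpoly s p) = of_mpoly s p^`M(i).
Proof.
apply: (@regular_mulIX 1); rewrite (@partial_fraction i _ p 0).
  by rewrite mulr0n subr0 rmorphM expr1.
by rewrite expr0 mulr1.
Qed.

Lemma partial_derivation (i : 'I_2) : derivation (@partial K s i).
Proof.
apply: (fraction_derivation regular_mulIX regular_fractionP).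
  exact: mderiv_derivation.
exact: partial_fraction.
Qed.

Lemma partial_comm (i j : 'I_2) (x : regular s) :
  partial i (partial j x) = partial j (partial i x).
Proof.
have dI := partial_derivation.
pose c (y : regular s) := partial i (partial j y) - partial j (partial i y).
have cP : derivation c := derivation_commutator (dI i) (dI j).
apply/eqP; rewrite -subr_eq0; apply/eqP.
apply: (fraction_derivation_eq0 regular_mulIX regular_fractionP cP) => p.
by rewrite /c !partial_of_mpoly mderiv_comm subrr.
Qed.

(** Inverting [s] inverts its factors: this is how r_1 <> 0, 1, -1 and r_2 <> 0 turn into
    invertibility statements. *)
Lemma of_mpoly_unit p q : p * q = s -> of_mpoly s p \is a GRing.unit.
Proof.
move=> pq; have SU : S \is a GRing.unit.
  apply/andP; rewrite /= tofrac_eq0; split=> //; apply/asboolP; exists 1, 1%N.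
  by rewrite expr1 mulVf ?tofrac_eq0 // rmorph1.
by have := congr1 (of_mpoly s) pq; rewrite rmorphM => e; move: SU;
  rewrite -e unitrM => /andP[].
Qed.

Section Comp.
Variables (B : comUnitRingType) (cst : {rmorphism K -> B}) (y : 'I_2 -> B).
Hypothesis yU : mmap cst y s \is a GRing.unit.
Local Notation h := (@regular_comp K s B cst y).

Lemma regular_comp_fraction x p n :
  x * S ^+ n = of_mpoly s p -> h x = mmap cst y p / mmap cst y s ^+ n.
Proof.
move=> xp; have := presentationP x; rewrite /regular_comp.
case: (presentation x) => q m /= xq.
have := congr1 (mmap cst y) (fraction_eq of_mpoly_inj xp xq).
rewrite !rmorphM !rmorphXn /= => e.
apply: (mulIr (unitrX m yU)); apply: (mulIr (unitrX n yU)).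
by rewrite divrK ?unitrX // mulrAC divrK ?unitrX.
Qed.

Lemma regular_comp_of_mpoly p : h (of_mpoly s p) = mmap cst y p.
Proof. exact: fraction_morphism_iota regular_comp_fraction p. Qed.

Lemma regular_comp_zmod_morphism : zmod_morphism h.
Proof.
exact: fraction_zmod_morphism regular_fractionP _ _ _ yU
  regular_comp_fraction.
Qed.

Lemma regular_comp_monoid_morphism : monoid_morphism h.
Proof.
exact: fraction_monoid_morphism regular_fractionP _ _ _ yU
  regular_comp_fraction.
Qed.

End Comp.
End RegularTheory.

(** * The ring of Laurent polynomials *)

Lemma linear_morphD (A : pzRingType) (V W : lmodType A) (f : V -> W) :
  linear f -> {morph f : x y / x + y}.
Proof. by move=> fL x y; have := fL 1 x y; rewrite !scale1r. Qed.

Lemma morphD0 (V W : zmodType) (f : V -> W) :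
  {morph f : x y / x + y} -> f 0 = 0.
Proof. by move=> fD; apply: (addIr (f 0)); rewrite -fD !add0r. Qed.

Lemma morphDN (V W : zmodType) (f : V -> W) :
  {morph f : x y / x + y} -> {morph f : x / - x}.
Proof.
by move=> fD x; apply: (addIr (f x)); rewrite -fD !addNr (morphD0 fD).
Qed.

Section LaurentTheory.
Variable A : comNzRingType.
Local Notation L := (laurent A).
Local Notation U k c := (monalg.mkmalgU (k : expo) c : L).
Implicit Types (k l : int * int) (c : A).

(** Identities between additive operators are reduced to monomials by this lemma throughout. *)
Lemma laurent_ext (V : zmodType) (f g : L -> V) :
  {morph f : x y / x + y} -> {morph g : x y / x + y} ->
  (forall k c, f (U k c) = g (U k c)) -> f =1 g.
Proof.
move=> fD gD fg x; rewrite (monalg.monalgE x).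
apply: (big_ind (fun y => f y = g y)) => [|y z fy fz|k _].
- by rewrite (morphD0 fD) (morphD0 gD).
- by rewrite fD gD fy fz.
- exact: fg.
Qed.

Lemma UD k : {morph (fun c => U k c) : c d / c + d}.
Proof. by move=> c d; apply: monalg.monalgUD. Qed.

Lemma lsumU (V : zmodType) (h : expo -> A -> V) k c :
  h k 0 = 0 -> lsum h (U k c) = h k c.
Proof.
move=> h0; rewrite /lsum monalg.msuppU; case: eqP => [->|_].
  by rewrite big_seq_fset0 h0.
by rewrite big_seq_fset1 monalg.mcoeffUU.
Qed.

Lemma lsumD (V : zmodType) (h : expo -> A -> V) :
  (forall k, {morph h k : c d / c + d}) -> {morph lsum h : x y / x + y}.
Proof.
move=> hD x y; pose D := (monalg.msupp x `|` monalg.msupp y)%fset.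
have lsumE (g : L) : (monalg.msupp g `<=` D)%fset ->
    lsum h g = \sum_(k <- D) h k (monalg.mcoeff k g).
  move=> le; rewrite /lsum; apply: big_fset_incl => // k _.
  by move=> /monalg.mcoeff_outdom ->; exact: morphD0.
rewrite !lsumE ?fsubsetUl ?fsubsetUr //; last exact: monalg.msuppD_le.
by rewrite -big_split /=; apply: eq_bigr => k _; rewrite monalg.mcoeffD hD.
Qed.

Lemma scaleU a k c : a *: U k c = U k (a * c).
Proof.
apply/monalg.malgP => l.
by rewrite monalg.mcoeffZ !monalg.mcoeffU mulrnAr.
Qed.

Lemma shiftU k l c : shift k (U l c) = U (k + l) c.
Proof. by rewrite /shift lsumU // monalg.monalgU0. Qed.

Lemma lmulU k c (g : L) : lmul (U k c) g = c *: shift k g.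
Proof. by rewrite /lmul lsumU // scale0r. Qed.

Lemma lmulUU k l c d : lmul (U k c) (U l d) = U (k + l) (c * d).
Proof. by rewrite lmulU shiftU scaleU. Qed.

Lemma lmulDr (f : L) : {morph lmul f : x y / x + y}.
Proof. exact: linear_morphD (lmul_linear f). Qed.

Lemma lmulDl (g : L) : {morph (fun f => lmul f g) : x y / x + y}.
Proof. by apply: lsumD => k c d; rewrite scalerDl. Qed.

Lemma lmulC : commutative (@lmul A).
Proof.
move=> f g; move: f; apply: laurent_ext => [||k c]; first exact: lmulDl.
  exact: lmulDr.
move: g; apply: laurent_ext => [||l d]; [exact: lmulDr|exact: lmulDl|].
by rewrite !lmulUU addrC mulrC.
Qed.

Lemma lmulA : associative (@lmul A).
Proof.
move=> f g h; move: f; apply: laurent_ext => [||k c]; first exact: lmulDl.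
  by move=> x y; rewrite !lmulDl.
move: g; apply: laurent_ext => [||l d];
  try by move=> x y; rewrite lmulDl !lmulDr.
  by move=> x y; rewrite lmulDr !lmulDl.
move: h; apply: laurent_ext => [||m e]; try by move=> x y; rewrite !lmulDr.
by rewrite !lmulUU addrA mulrA.
Qed.

Lemma lmul1 : left_id (monomial 1 0 0 : L) (@lmul A).
Proof.
move=> g; rewrite /monomial lmulU scale1r; move: g.
apply: laurent_ext => [||l d] //; first exact: linear_morphD (shift_linear _).
by rewrite shiftU; congr (U _ _); case: l => a b; rewrite /= -[RHS]add0r.
Qed.

Lemma laurent1_neq0 : (monomial 1 0 0 : L) != 0.
Proof.
apply/eqP => /(congr1 (monalg.mcoeff ((0, 0) : expo))).
by rewrite monalg.mcoeffUU monalg.mcoeff0 => /eqP; rewrite oner_eq0.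
Qed.

Lemma euler1U k c : euler1 (U k c) = U k (c *~ k.1).
Proof. by rewrite /euler1 lsumU // mul0rz monalg.monalgU0. Qed.

Lemma euler2U k c : euler2 (U k c) = U k (c *~ k.2).
Proof. by rewrite /euler2 lsumU // mul0rz monalg.monalgU0. Qed.

Lemma euler1D : {morph @euler1 A : x y / x + y}.
Proof. exact: linear_morphD (@euler1_linear A). Qed.

Lemma euler2D : {morph @euler2 A : x y / x + y}.
Proof. exact: linear_morphD (@euler2_linear A). Qed.

Lemma lmul_derivation (D : L -> L) : {morph D : x y / x + y} ->
  (forall k l c d, D (U (k + l) (c * d)) =
     lmul (D (U k c)) (U l d) + lmul (U k c) (D (U l d))) ->
  forall f g, D (lmul f g) = lmul (D f) g + lmul f (D g).
Proof.
move=> DD DM f g; move: f.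
apply: laurent_ext => [x y|x y|k c]; first by rewrite lmulDl DD.
  by rewrite DD !lmulDl; exact: addrACA.
move: g; apply: laurent_ext => [x y|x y|l d]; first by rewrite lmulDr DD.
  by rewrite DD !lmulDr; exact: addrACA.
by rewrite lmulUU DM.
Qed.

Lemma euler1M f g :
  euler1 (lmul f g) = lmul (euler1 f) g + lmul f (euler1 g) :> L.
Proof.
apply: lmul_derivation f g => [|k l c d]; first exact: euler1D.
rewrite !euler1U !lmulUU -UD; congr (U _ _).
by rewrite mulrzDr mulrzAl mulrzAr.
Qed.

Lemma euler2M f g :
  euler2 (lmul f g) = lmul (euler2 f) g + lmul f (euler2 g) :> L.
Proof.
apply: lmul_derivation f g => [|k l c d]; first exact: euler2D.
rewrite !euler2U !lmulUU -UD; congr (U _ _).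
by rewrite mulrzDr mulrzAl mulrzAr.
Qed.

End LaurentTheory.

Section LaurentMap.
Variables (A B : comNzRingType) (h : A -> B).
Hypothesis hD : {morph h : c d / c + d}.
Local Notation U k c := (monalg.mkmalgU (k : expo) c).

Lemma lmapU k c : lmap h (U k c) = U k (h c).
Proof. by rewrite /lmap lsumU // (morphD0 hD) monalg.monalgU0. Qed.

Lemma lmapD : {morph lmap h : x y / x + y}.
Proof. by apply: lsumD => k c d; rewrite hD UD. Qed.

Lemma morphDMz c (z : int) : h (c *~ z) = h c *~ z.
Proof.
have hMn n : h (c *+ n) = h c *+ n.
  by elim: n => [|n IH]; rewrite ?mulr0n ?(morphD0 hD) // !mulrS hD IH.
case: z => n; first exact: hMn.
by rewrite NegzE !mulrNz (morphDN hD) hMn.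
Qed.

Lemma lmap_euler1 f : lmap h (euler1 f) = euler1 (lmap h f).
Proof.
move: f; apply: laurent_ext => [x y|x y|k c].
- by rewrite euler1D lmapD.
- by rewrite lmapD euler1D.
by rewrite euler1U !lmapU euler1U morphDMz.
Qed.

Lemma lmap_euler2 f : lmap h (euler2 f) = euler2 (lmap h f).
Proof.
move: f; apply: laurent_ext => [x y|x y|k c].
- by rewrite euler2D lmapD.
- by rewrite lmapD euler2D.
by rewrite euler2U !lmapU euler2U morphDMz.
Qed.

End LaurentMap.

Lemma lmap_lmul_derivation (A : comNzRingType) (d : A -> A) :
  derivation d -> forall f g : laurent A,
  lmap d (lmul f g) = lmul (lmap d f) g + lmul f (lmap d g).
Proof.
move=> dP; apply: lmul_derivation => [|k l a b]; first exact: lmapD (derD dP).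
by rewrite !(lmapU (derD dP)) !lmulUU -UD (derM dP).
Qed.

Lemma lmap_lmul (A B : comNzRingType) (h : A -> B) :
  {morph h : a b / a + b} -> {morph h : a b / a * b} -> forall f g,
  lmap h (lmul f g) = lmul (lmap h f) (lmap h g).
Proof.
move=> hD hM; have LD := lmapD hD.
move=> f g; move: f; apply: laurent_ext => [x y|x y|k c].
- by rewrite lmulDl LD.
- by rewrite LD lmulDl.
move: g; apply: laurent_ext => [x y|x y|l d].
- by rewrite lmulDr LD.
- by rewrite LD lmulDr.
by rewrite lmulUU !(lmapU hD) lmulUU hM.
Qed.

(* A wrapper, so that the ring structure does not compete with the structures
   that laurent inherits from monalg; the operations are opaque to keep
   unification from unfolding them. *)
Record lring (A : comNzRingType) := LRing { lval : laurent A }.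

Section LRing.
Variable A : comNzRingType.
Local Notation L := (lring A).

HB.instance Definition _ := [isNew for @lval A].
HB.instance Definition _ := [Choice of lring A by <:].

Lemma lval_inj : injective (@lval A).
Proof. by move=> [f] [g] /= ->. Qed.

Fact lring_add_sig :
  {m : L -> L -> L | forall f g, lval (m f g) = lval f + lval g}.
Proof. by exists (fun f g => LRing (lval f + lval g)). Qed.
Fact lring_opp_sig : {m : L -> L | forall f, lval (m f) = - lval f}.
Proof. by exists (fun f => LRing (- lval f)). Qed.
Fact lring_mul_sig :
  {m : L -> L -> L | forall f g, lval (m f g) = lmul (lval f) (lval g)}.
Proof. by exists (fun f g => LRing (lmul (lval f) (lval g))). Qed.
Fact lring0_sig : {m : L | lval m = 0}.
Proof. by exists (LRing 0). Qed.
Fact lring1_sig : {m : L | lval m = monomial 1 0 0}.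
Proof. by exists (LRing (monomial 1 0 0)). Qed.

Definition lring_add := sval lring_add_sig.
Definition lring_opp := sval lring_opp_sig.
Definition lring_mul := sval lring_mul_sig.
Definition lring0 := sval lring0_sig.
Definition lring1 := sval lring1_sig.

Let addE : forall f g, lval (lring_add f g) = lval f + lval g.
Proof. exact: (svalP lring_add_sig). Qed.
Let oppE : forall f, lval (lring_opp f) = - lval f.
Proof. exact: (svalP lring_opp_sig). Qed.
Let mulE : forall f g, lval (lring_mul f g) = lmul (lval f) (lval g).
Proof. exact: (svalP lring_mul_sig). Qed.
Let zeroE : lval lring0 = 0. Proof. exact: (svalP lring0_sig). Qed.
Let oneE : lval lring1 = monomial 1 0 0. Proof. exact: (svalP lring1_sig). Qed.

Fact lring_addA : associative lring_add.
Proof. by move=> x y z; apply: lval_inj; rewrite !addE addrA. Qed.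
Fact lring_addC : commutative lring_add.
Proof. by move=> x y; apply: lval_inj; rewrite !addE addrC. Qed.
Fact lring_add0 : left_id lring0 lring_add.
Proof. by move=> x; apply: lval_inj; rewrite addE zeroE add0r. Qed.
Fact lring_addN : left_inverse lring0 lring_opp lring_add.
Proof. by move=> x; apply: lval_inj; rewrite addE oppE zeroE addNr. Qed.
HB.instance Definition _ := GRing.isZmodule.Build (lring A)
  lring_addA lring_addC lring_add0 lring_addN.

Lemma lvalD (f g : L) : lval (f + g) = lval f + lval g.
Proof. exact: addE. Qed.
Lemma lvalN (f : L) : lval (- f) = - lval f.
Proof. exact: oppE. Qed.
Lemma lvalB (f g : L) : lval (f - g) = lval f - lval g.
Proof. by rewrite lvalD lvalN. Qed.
Lemma lval0 : lval (0 : L) = 0. Proof. exact: zeroE. Qed.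

Fact lring_mulA : associative lring_mul.
Proof. by move=> x y z; apply: lval_inj; rewrite !mulE lmulA. Qed.
Fact lring_mulC : commutative lring_mul.
Proof. by move=> x y; apply: lval_inj; rewrite !mulE lmulC. Qed.
Fact lring_mul1 : left_id lring1 lring_mul.
Proof. by move=> x; apply: lval_inj; rewrite mulE oneE lmul1. Qed.
Fact lring_mulD : left_distributive lring_mul +%R.
Proof.
by move=> x y z; apply: lval_inj; rewrite lvalD !mulE lvalD lmulDl.
Qed.
Fact lring1_neq0 : lring1 != 0.
Proof.
have /eqP n0 := laurent1_neq0 A; apply/eqP => /(congr1 (@lval A)).
by rewrite oneE lval0.
Qed.
HB.instance Definition _ := GRing.Zmodule_isComNzRing.Build (lring A)
  lring_mulA lring_mulC lring_mul1 lring_mulD lring1_neq0.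

Lemma lvalM (f g : L) : lval (f * g) = lmul (lval f) (lval g).
Proof. exact: mulE. Qed.
Lemma lval1 : lval (1 : L) = monomial 1 0 0. Proof. exact: oneE. Qed.

Fact cst_sig : {m : A -> L | forall c, lval (m c) = monomial c 0 0}.
Proof. by exists (fun c => LRing (monomial c 0 0)). Qed.
Definition cst := sval cst_sig.
Lemma lval_cst c : lval (cst c) = monomial c 0 0.
Proof. exact: (svalP cst_sig). Qed.

Fact mono_sig :
  {m : int -> int -> L | forall a b, lval (m a b) = monomial 1 a b}.
Proof. by exists (fun a b => LRing (monomial 1 a b)). Qed.
Definition mono := sval mono_sig.
Lemma lval_mono a b : lval (mono a b) = monomial 1 a b.
Proof. exact: (svalP mono_sig). Qed.

Fact cst_zmod_morphism : zmod_morphism cst.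
Proof.
move=> c d; apply: lval_inj; rewrite lvalB !lval_cst.
exact: monalg.monalgUB.
Qed.
Fact cst_monoid_morphism : monoid_morphism cst.
Proof.
split=> [|c d]; apply: lval_inj; first by rewrite lval_cst lval1.
by rewrite lvalM !lval_cst /monomial lmulUU.
Qed.
HB.instance Definition _ := GRing.isZmodMorphism.Build _ _ cst
  cst_zmod_morphism.
HB.instance Definition _ := GRing.isMonoidMorphism.Build _ _ cst
  cst_monoid_morphism.

Lemma mono0 : mono 0 0 = 1.
Proof. by apply: lval_inj; rewrite lval_mono lval1. Qed.

Lemma monoM a b a' b' : mono a b * mono a' b' = mono (a + a') (b + b').
Proof.
by apply: lval_inj; rewrite lvalM !lval_mono /monomial lmulUU mulr1.
Qed.

Lemma lval_monomial c a b : lval (cst c * mono a b) = monomial c a b.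
Proof.
by rewrite lvalM lval_cst lval_mono /monomial lmulUU mulr1; rewrite !add0r.
Qed.

Lemma lval_scale c (f : L) : c *: lval f = lval (cst c * f).
Proof.
rewrite lvalM lval_cst /monomial lmulU; congr (_ *: _).
move: (lval f); apply: laurent_ext => [||k a] //.
  exact: linear_morphD (shift_linear _).
by rewrite shiftU; case: k => a' b' /=; rewrite !add0r.
Qed.

Fact lder1_sig : {m : L -> L | forall f, lval (m f) = euler1 (lval f)}.
Proof. by exists (fun f => LRing (euler1 (lval f))). Qed.
Definition lder1 := sval lder1_sig.
Lemma lval_lder1 f : lval (lder1 f) = euler1 (lval f).
Proof. exact: (svalP lder1_sig). Qed.

Fact lder2_sig : {m : L -> L | forall f, lval (m f) = euler2 (lval f)}.
Proof. by exists (fun f => LRing (euler2 (lval f))). Qed.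
Definition lder2 := sval lder2_sig.
Lemma lval_lder2 f : lval (lder2 f) = euler2 (lval f).
Proof. exact: (svalP lder2_sig). Qed.

Lemma lder1_derivation : derivation lder1.
Proof.
split=> f g; apply: lval_inj; rewrite lval_lder1 ?(lvalD, lvalM).
  by rewrite euler1D !lval_lder1.
by rewrite euler1M !lval_lder1.
Qed.

Lemma lder2_derivation : derivation lder2.
Proof.
split=> f g; apply: lval_inj; rewrite lval_lder2 ?(lvalD, lvalM).
  by rewrite euler2D !lval_lder2.
by rewrite euler2M !lval_lder2.
Qed.

Lemma lder1_cst c : lder1 (cst c) = 0.
Proof.
by apply: lval_inj; rewrite lval_lder1 lval_cst euler1U monalg.monalgU0 lval0.
Qed.
Lemma lder2_cst c : lder2 (cst c) = 0.
Proof.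
by apply: lval_inj; rewrite lval_lder2 lval_cst euler2U monalg.monalgU0 lval0.
Qed.

Lemma lder1_mono a b : lder1 (mono a b) = cst a%:~R * mono a b.
Proof.
by apply: lval_inj; rewrite lval_lder1 lval_mono euler1U lval_monomial.
Qed.
Lemma lder2_mono a b : lder2 (mono a b) = cst b%:~R * mono a b.
Proof.
by apply: lval_inj; rewrite lval_lder2 lval_mono euler2U lval_monomial.
Qed.

Lemma lring_ext (V : zmodType) (f g : L -> V) :
  {morph f : x y / x + y} -> {morph g : x y / x + y} ->
  (forall c a b, f (cst c * mono a b) = g (cst c * mono a b)) -> f =1 g.
Proof.
move=> fD gD fg x.
have ext (h : L -> V) : {morph h : x y / x + y} ->
    {morph (fun l => h (LRing l)) : x y / x + y}.
  by move=> hD y z; rewrite -hD; congr h; apply: lval_inj; rewrite lvalD.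
have -> : x = LRing (lval x) by case: x.
move: (lval x); apply: (laurent_ext (ext _ fD) (ext _ gD)) => -[a b] c.
rewrite -[monalg.mkmalgU _ _]/(monomial c a b).
have -> : LRing (monomial c a b) = cst c * mono a b; last exact: fg.
by apply: lval_inj; rewrite lval_monomial.
Qed.

End LRing.

Section LRingMap.
Variables (A B : comNzRingType) (h : A -> B).

Fact lringmap_sig :
  {m : lring A -> lring B | forall f, lval (m f) = lmap h (lval f)}.
Proof. by exists (fun f => LRing (lmap h (lval f))). Qed.
Definition lringmap := sval lringmap_sig.
Lemma lval_lringmap f : lval (lringmap f) = lmap h (lval f).
Proof. exact: (svalP lringmap_sig). Qed.

Hypothesis hD : {morph h : c d / c + d}.

Lemma lringmapD : {morph lringmap : f g / f + g}.
Proof.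
move=> f g; apply: lval_inj.
by rewrite lvalD !lval_lringmap lvalD lmapD.
Qed.

Lemma lringmap_lder1 f : lringmap (lder1 f) = lder1 (lringmap f).
Proof.
apply: lval_inj.
by rewrite lval_lder1 !lval_lringmap lval_lder1 lmap_euler1.
Qed.

Lemma lringmap_lder2 f : lringmap (lder2 f) = lder2 (lringmap f).
Proof.
apply: lval_inj.
by rewrite lval_lder2 !lval_lringmap lval_lder2 lmap_euler2.
Qed.

Lemma lringmap_monomial c a b :
  lringmap (cst c * mono A a b) = cst (h c) * mono B a b.
Proof.
apply: lval_inj.
by rewrite lval_lringmap !lval_monomial /monomial lmapU.
Qed.

Lemma lringmap_cst c : lringmap (cst c) = cst (h c).
Proof.
by have := lringmap_monomial c 0 0; rewrite !mono0 !mulr1.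
Qed.

End LRingMap.

Lemma lringmap_derivation (A : comNzRingType) (d : A -> A) :
  derivation d -> derivation (lringmap d).
Proof.
move=> dP; split=> f g; first exact: lringmapD (derD dP) f g.
apply: lval_inj; rewrite lvalD !lvalM !lval_lringmap lvalM.
exact: lmap_lmul_derivation.
Qed.

Lemma lringmapM (A B : comNzRingType) (h : A -> B) :
  {morph h : a b / a + b} -> {morph h : a b / a * b} ->
  {morph lringmap h : f g / f * g}.
Proof.
move=> hD hM f g; apply: lval_inj; rewrite lvalM !lval_lringmap lvalM.
exact: lmap_lmul.
Qed.

Lemma lringmap_comm (A : comNzRingType) (h h' : A -> A) :
  {morph h : a b / a + b} -> {morph h' : a b / a + b} ->
  (forall a, h (h' a) = h' (h a)) ->
  forall f, lringmap h (lringmap h' f) = lringmap h' (lringmap h f).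
Proof.
move=> hD hD' hh'; apply: lring_ext => [f g|f g|c a b].
- by rewrite !lringmapD.
- by rewrite !lringmapD.
by rewrite !lringmap_monomial // hh'.
Qed.

(** * The Brieskorn lattice *)

Section MapPolyDerivation.
Variables (O : comNzRingType) (d : O -> O).
Hypothesis dP : derivation d.

Lemma map_poly_derivation : derivation (map_poly d).
Proof.
have cE p i : (map_poly d p)`_i = d p`_i by rewrite coef_map_id0 ?der0.
split=> p q; apply/polyP => i; first by rewrite coefD !cE coefD (derD dP).
rewrite coefD cE !coefM (big_morph d (derD dP) (der0 dP)) -big_split /=.
by apply: eq_bigr => j _; rewrite (derM dP) !cE.
Qed.

Lemma map_poly_derX : map_poly d 'X = 0.
Proof.
apply/polyP => i; rewrite coef_map_id0 ?(der0 dP) // coefX coef0.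
exact: der_nat.
Qed.

Lemma map_poly_derC c : map_poly d c%:P = (d c)%:P.
Proof.
apply/polyP => i; rewrite coef_map_id0 ?(der0 dP) // !coefC.
by case: ifP => _; rewrite ?(der0 dP).
Qed.

Lemma deriv_map_poly_der p : (map_poly d p)^`() = map_poly d p^`().
Proof.
apply/polyP => i; rewrite coef_map_id0 ?(der0 dP) // !coef_deriv.
rewrite coef_map_id0 ?(der0 dP) //.
by rewrite -[in RHS]mulr_natr (derM dP) (der_nat dP) mulr0 addr0 mulr_natr.
Qed.

End MapPolyDerivation.

Lemma map_poly_der_comm (O : comNzRingType) (d d' : O -> O) :
  derivation d -> derivation d' -> (forall x, d (d' x) = d' (d x)) ->
  forall p, map_poly d (map_poly d' p) = map_poly d' (map_poly d p).
Proof.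
move=> dP dP' dd' p; apply/polyP => i.
by rewrite !coef_map_id0 ?(der0 dP) ?(der0 dP').
Qed.

Lemma deriv_derivation (O : comNzRingType) : derivation (@deriv O).
Proof. by split=> p q; rewrite ?derivD ?derivM. Qed.

Section Twist.
Variables (L : comPzRingType) (theta F : L).

(* theta D conjugated by exp (F / theta); this covers both the differential of
   the twisted de Rham complex and the Gauss-Manin connection. *)
Definition twist (D : L -> L) (g : L) : L := theta * D g - D F * g.
Definition twist_theta (D : L -> L) (g : L) : L := theta ^+ 2 * D g + F * g.

Lemma twistB D : derivation D -> {morph twist D : f g / f - g}.
Proof. by move=> dP f g; rewrite /twist (derB dP); ring. Qed.

Lemma twistD D : derivation D -> {morph twist D : f g / f + g}.
Proof. by move=> dP f g; rewrite /twist (derD dP); ring. Qed.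

Lemma twistM D : derivation D -> forall f g,
  twist D (f * g) = theta * D f * g + f * twist D g.
Proof. by move=> dP f g; rewrite /twist (derM dP); ring. Qed.

(** Conjugation by exp (F / theta) preserves the commutation of theta D and theta D', which holds
    because both derivations kill theta. *)
Lemma twist_comm D D' : derivation D -> derivation D' ->
  (forall g, D (D' g) = D' (D g)) -> D theta = 0 -> D' theta = 0 ->
  forall g, twist D (twist D' g) = twist D' (twist D g).
Proof.
move=> dP dP' DD' Dt Dt' g; rewrite /twist.
rewrite !(derB dP, derB dP') !(derM dP, derM dP') Dt Dt' !DD'; ring.
Qed.

Lemma twist_thetaB D : derivation D -> {morph twist_theta D : f g / f - g}.
Proof. by move=> dP f g; rewrite /twist_theta (derB dP); ring. Qed.

Lemma twist_thetaD D : derivation D -> {morph twist_theta D : f g / f + g}.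
Proof. by move=> dP f g; rewrite /twist_theta (derD dP); ring. Qed.

Lemma twist_thetaM D : derivation D -> forall f g,
  twist_theta D (f * g) = theta ^+ 2 * D f * g + f * twist_theta D g.
Proof. by move=> dP f g; rewrite /twist_theta (derM dP); ring. Qed.

(** This is the commutator of theta^2 d/dtheta with theta D', namely theta (theta D'), after
    conjugation by exp (F / theta). *)
Lemma twist_theta_comm D D' : derivation D -> derivation D' ->
  (forall g, D (D' g) = D' (D g)) -> D' theta = 0 -> D theta = 1 -> D F = 0 ->
  forall g, twist_theta D (twist D' g) =
    twist D' (twist_theta D g) + theta * twist D' g.
Proof.
move=> dP dP' DD' Dt' Dt DF g; rewrite /twist_theta /twist.
rewrite !expr2 (derB dP) !(derM dP) (derD dP') !(derM dP') !DD' DF.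
by rewrite Dt Dt' (der0 dP'); ring.
Qed.

End Twist.

Section BrieskornTheory.
Variables (O : comNzRingType) (q1 q2 : O).
Local Notation A := {poly O}.
Local Notation L := (lring A).
Local Notation G := (brieskorn q1 q2).
Local Notation theta := (cst 'X : L).

Definition term1 : L := mono A 1 0.
Definition term2 : L := mono A 0 1.
Definition term3 : L := cst q1%:P * mono A (-1) 2.
Definition term4 : L := cst q2%:P * mono A 0 (-1).
Definition pot : L := term1 + term2 + term3 + term4.

Lemma lval_pot : lval pot = potential q1 q2.
Proof. by rewrite /pot /term1 /term2 !lvalD !lval_mono !lval_monomial. Qed.

Definition cls (f : L) : G := form_class q1 q2 (lval f).

Definition tw1 := twist theta pot (@lder1 A).
Definition tw2 := twist theta pot (@lder2 A).

Lemma lval_tw (g1 g2 : L) :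
  lval (tw1 g2 - tw2 g1) = twisted_d q1 q2 (lval g1) (lval g2).
Proof.
rewrite /twisted_d -lval_pot.
have -> : tw1 g2 - tw2 g1 = theta * (lder1 g2 - lder2 g1)
   - (lder1 pot * g2 - lder2 pot * g1) by rewrite /tw1 /tw2 /twist; ring.
by rewrite lvalB -lval_scale !(lvalB, lvalM) !(lval_lder1, lval_lder2).
Qed.

Lemma clsP (f g : L) :
  cls f = cls g <-> exists g1 g2, f - g = tw1 g2 - tw2 g1.
Proof.
split=> [/eqP|[g1 [g2 e]]].
  rewrite /cls /form_class modpiP => /asboolP[g1 [g2 e]].
  exists (LRing g1), (LRing g2); apply: lval_inj.
  by rewrite lval_tw lvalB; exact: e.
apply/eqP; rewrite /cls /form_class modpiP; apply/asboolP.
by exists (lval g1), (lval g2); rewrite -lval_tw -e lvalB.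
Qed.

Lemma clsD : {morph cls : f g / f + g}.
Proof. by move=> f g; rewrite /cls lvalD; apply: modpiD. Qed.

Lemma clsB : {morph cls : f g / f - g}.
Proof. by move=> f g; rewrite /cls lvalB; apply: modpiB. Qed.

Lemma clsZ a f : a *: cls f = cls (cst a * f).
Proof. by rewrite /cls -lval_scale; apply: modscale_pi. Qed.

Lemma cls_ind (P : G -> Prop) : (forall f, P (cls f)) -> forall x, P x.
Proof. by move=> Pc x; rewrite -(modreprK x); apply: (Pc (LRing _)). Qed.

Lemma cls_tw1 g : cls (tw1 g) = 0.
Proof.
have t0 : tw2 0 = 0.
  by rewrite /tw2 /twist (der0 (lder2_derivation _)) !mulr0 subr0.
rewrite -[RHS](_ : cls 0 = 0); last by apply: (morphD0 clsD).
by apply/clsP; exists 0, g; rewrite t0.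
Qed.

Lemma cls_tw2 g : cls (tw2 g) = 0.
Proof.
have t0 : tw1 0 = 0.
  by rewrite /tw1 /twist (der0 (lder1_derivation _)) !mulr0 subr0.
rewrite -[RHS](_ : cls 0 = 0); last by apply: (morphD0 clsD).
apply/clsP; exists (- g), 0; rewrite t0 subr0 sub0r /tw2.
by rewrite (morphDN (twistD _ _ (lder2_derivation _))) opprK.
Qed.

Lemma lder1_pot : lder1 pot = term1 - term3.
Proof.
rewrite /pot /term3 /term4 /term1 /term2 !(derD (lder1_derivation _)).
rewrite !(derM (lder1_derivation _)) !lder1_cst !lder1_mono.
by rewrite !rmorphN !rmorph1 !rmorph0; ring.
Qed.

Lemma lder2_pot : lder2 pot = term2 + 2%:R * term3 - term4.
Proof.
rewrite /pot /term3 /term4 /term1 /term2 !(derD (lder2_derivation _)).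
rewrite !(derM (lder2_derivation _)) !lder2_cst !lder2_mono.
rewrite !rmorphN !rmorph1 !rmorph0.
by have -> : cst (2%:~R : A) = 2%:R; [exact: rmorph_nat | ring].
Qed.

Section Connection.
Variable d : O -> O.
Hypothesis dP : derivation d.
Local Notation D := (lringmap (map_poly d)).
Let mP := map_poly_derivation dP.
Let DP : derivation D := lringmap_derivation mP.

(** [gm_base] acts on a chosen representative. The twisted operator along the base commutes with
    [tw1] and [tw2], so it carries the primitives of an exact form to primitives of its image, and
    the choice is immaterial. *)
Lemma gm_base_cls f : gm_base d (cls f) = cls (twist theta pot D f).
Proof.
have tw g : form_class q1 q2 ('X *: lmap (map_poly d) g
    - lmul (lmap (map_poly d) (potential q1 q2)) g) =
    cls (twist theta pot D (LRing g)).
  rewrite /cls /twist; congr form_class.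
  by rewrite lvalB -lval_scale lvalM !lval_lringmap lval_pot.
rewrite /gm_base tw; apply/clsP.
have /clsP [g1 [g2 e]] : cls (LRing (modrepr (cls f))) = cls f.
  exact: modreprK.
exists (twist theta pot D g1), (twist theta pot D g2).
have D1 := lder1_derivation A; have D2 := lder2_derivation A.
have Dt : D theta = 0.
  by rewrite (lringmap_cst (derD mP)) (map_poly_derX dP) rmorph0.
rewrite -(twistB _ _ DP) e (twistB _ _ DP) /tw1 /tw2.
rewrite (twist_comm pot DP D1) ?(twist_comm pot DP D2) ?lder1_cst ?lder2_cst //.
  by move=> g; exact: (lringmap_lder2 (derD mP)).
by move=> g; exact: (lringmap_lder1 (derD mP)).
Qed.

Lemma gm_baseD : {morph @gm_base O q1 q2 d : x y / x + y}.
Proof.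
move=> x y; elim/cls_ind: x => f; elim/cls_ind: y => g.
by rewrite -clsD !gm_base_cls -clsD (twistD _ _ DP).
Qed.

Lemma gm_baseZ h (x : G) :
  gm_base d (h *: x) = ('X * map_poly d h) *: x + h *: gm_base d x.
Proof.
elim/cls_ind: x => f; rewrite !(clsZ, gm_base_cls) -clsD (twistM _ _ DP).
by rewrite (lringmap_cst (derD mP)) rmorphM.
Qed.

End Connection.

Lemma gm_base_comm (d d' : O -> O) : derivation d -> derivation d' ->
  (forall x, d (d' x) = d' (d x)) -> forall x : G,
  gm_base d (gm_base d' x) = gm_base d' (gm_base d x).
Proof.
move=> dP dP' dd' x; elim/cls_ind: x => f; rewrite !gm_base_cls //.
have mP := map_poly_derivation dP; have mP' := map_poly_derivation dP'.
have DP := lringmap_derivation mP; have DP' := lringmap_derivation mP'.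
congr cls; apply: twist_comm => //; last first.
- by rewrite (lringmap_cst (derD mP')) (map_poly_derX dP') rmorph0.
- by rewrite (lringmap_cst (derD mP)) (map_poly_derX dP) rmorph0.
exact: lringmap_comm (derD mP) (derD mP') (map_poly_der_comm dP dP' dd').
Qed.

Section Theta.
Local Notation D := (lringmap (@deriv O)).
Let dP := deriv_derivation O.
Let DP : derivation D := lringmap_derivation dP.

Lemma deriv_pot : D pot = 0.
Proof.
rewrite /pot /term1 /term2 -[mono A 1 0]mul1r -[mono A 0 1]mul1r.
rewrite -(rmorph1 (@cst A)).
rewrite !(derD DP) !(lringmap_monomial (derD dP)) !derivC.
by rewrite rmorph0; ring.
Qed.

Lemma gm_theta_cls f : gm_theta (cls f) = cls (twist_theta theta pot D f).
Proof.
have tw g : form_class q1 q2 ('X ^+ 2 *: lmap (@deriv O) g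
    + lmul (potential q1 q2) g) = cls (twist_theta theta pot D (LRing g)).
  rewrite /cls /twist_theta; congr form_class.
  by rewrite lvalD -rmorphXn -lval_scale lvalM !lval_lringmap lval_pot.
rewrite /gm_theta tw; apply/clsP.
have /clsP [g1 [g2 e]] : cls (LRing (modrepr (cls f))) = cls f.
  exact: modreprK.
(* Here the operator commutes with [tw1] and [tw2] only up to [theta * tw1] and [theta * tw2]; the
   summands [theta * g1] and [theta * g2] absorb this. *)
exists (twist_theta theta pot D g1 + theta * g1),
  (twist_theta theta pot D g2 + theta * g2).
have D1 := lder1_derivation A; have D2 := lder2_derivation A.
have Dt : D theta = 1 by rewrite (lringmap_cst (derD dP)) derivX rmorph1.
rewrite -(twist_thetaB _ _ DP) e (twist_thetaB _ _ DP) /tw1 /tw2.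
rewrite (twist_theta_comm DP D1) ?(twist_theta_comm DP D2)
  ?lder1_cst ?lder2_cst ?deriv_pot //; last first.
- by move=> g; exact: (lringmap_lder1 (derD dP)).
- by move=> g; exact: (lringmap_lder2 (derD dP)).
rewrite !(twistD _ _ D1, twistD _ _ D2) !(twistM _ _ D1, twistM _ _ D2).
by rewrite lder1_cst lder2_cst; ring.
Qed.

Lemma gm_thetaD : {morph @gm_theta O q1 q2 : x y / x + y}.
Proof.
move=> x y; elim/cls_ind: x => f; elim/cls_ind: y => g.
by rewrite -clsD !gm_theta_cls -clsD (twist_thetaD _ _ DP).
Qed.

Lemma gm_thetaZ h (x : G) :
  gm_theta (h *: x) = ('X ^+ 2 * h^`()) *: x + h *: gm_theta x.
Proof.
elim/cls_ind: x => f.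
rewrite !(clsZ, gm_theta_cls) -clsD (twist_thetaM _ _ DP).
by rewrite (lringmap_cst (derD dP)) rmorphM rmorphXn.
Qed.

Lemma gm_theta_base (d : O -> O) : derivation d -> forall x : G,
  gm_theta (gm_base d x) = gm_base d (gm_theta x) + 'X *: gm_base d x.
Proof.
move=> dO x; elim/cls_ind: x => f.
have mP := map_poly_derivation dO; have mD := lringmap_derivation mP.
rewrite !(gm_theta_cls, gm_base_cls) // clsZ -clsD; congr cls.
apply: twist_theta_comm => //.
- exact: lringmap_comm (derD dP) (derD mP) (deriv_map_poly_der dO).
- by rewrite (lringmap_cst (derD mP)) (map_poly_derX dO) rmorph0.
- by rewrite (lringmap_cst (derD dP)) derivX rmorph1.
exact: deriv_pot.
Qed.

End Theta.

Lemma term2_term4 : term2 * term4 = cst q2%:P.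
Proof. by rewrite /term2 /term4 mulrCA monoM addr0 subrr mono0 mulr1. Qed.

Lemma term1_term3 : term1 * term3 = cst q1%:P * term2 ^+ 2.
Proof. by rewrite /term1 /term3 /term2 mulrCA expr2 !monoM. Qed.

Lemma tw1E g : tw1 g = theta * lder1 g - (term1 - term3) * g.
Proof. by rewrite /tw1 /twist lder1_pot. Qed.
Lemma tw2E g : tw2 g = theta * lder2 g - (term2 + 2%:R * term3 - term4) * g.
Proof. by rewrite /tw2 /twist lder2_pot. Qed.

Lemma lder1_term3 : lder1 term3 = - term3.
Proof.
rewrite /term3 (derM (lder1_derivation _)) lder1_cst lder1_mono.
rewrite !rmorphN !rmorph1.
by ring.
Qed.
Lemma lder2_term3 : lder2 term3 = 2%:R * term3.
Proof.
rewrite /term3 (derM (lder2_derivation _)) lder2_cst lder2_mono.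
by have -> : cst (2%:~R : A) = 2%:R; [exact: rmorph_nat | ring].
Qed.
Lemma lder2_term4 : lder2 term4 = - term4.
Proof.
rewrite /term4 (derM (lder2_derivation _)) lder2_cst lder2_mono.
rewrite !rmorphN !rmorph1.
by ring.
Qed.
Lemma lder2_term2 : lder2 term2 = term2.
Proof. by rewrite /term2 lder2_mono !rmorph1 mul1r. Qed.

(** F is homogeneous of degree 1 for deg u_1 = deg u_2 = 1, deg q_1 = 0, deg q_2 = 2, so modulo the
    exact forms [tw1 1] and [tw2 1] it equals 2 q_2 dF/dq_2. On the A-side this is c_1 = 2 H. *)
Lemma gm_theta1 : gm_theta (cls 1) = cls (2%:R * term4).
Proof.
rewrite gm_theta_cls; apply/eqP; rewrite -subr_eq0 -clsB; apply/eqP.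
rewrite /twist_theta (der1 (lringmap_derivation (deriv_derivation _))).
have -> : theta ^+ 2 * 0 + pot * 1 - 2%:R * term4 = - tw1 1 - tw2 1.
  rewrite tw1E tw2E (der1 (lder1_derivation _)) (der1 (lder2_derivation _)).
  by rewrite /pot; ring.
by rewrite clsB (morphDN clsD) cls_tw1 cls_tw2 oppr0 addr0.
Qed.

(** * The second order relations satisfied by the class of 1 *)

Section Relations.
Variables (d1 d2 : O -> O) (s t : O).
Hypotheses (d1P : derivation d1) (d2P : derivation d2).
Hypotheses (sE : s = 1 - 2%:R * t) (q1E : q1 = t * (1 - t)).
Hypotheses (d1q1 : d1 q1 = s * q1) (d1q2 : d1 q2 = t * q2) (d1t : d1 t = q1).
Hypotheses (d2q1 : d2 q1 = 0) (d2q2 : d2 q2 = q2).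
Local Notation D1 := (lringmap (map_poly d1)).
Local Notation D2 := (lringmap (map_poly d2)).
Local Notation e := (cls 1).
Local Notation S := (cst s%:P : L).
Local Notation T := (cst t%:P : L).
Local Notation Q1 := (cst q1%:P : L).
Local Notation Q2 := (cst q2%:P : L).

Let m1 := derD (map_poly_derivation d1P).
Let m2 := derD (map_poly_derivation d2P).
Let D1P := lringmap_derivation (map_poly_derivation d1P).
Let D2P := lringmap_derivation (map_poly_derivation d2P).

Let d1s : d1 s = - 2%:R * q1.
Proof.
by rewrite sE (derB d1P) (derM d1P) (der1 d1P) (der_nat d1P) d1t; ring.
Qed.

Let SE : S = 1 - 2%:R * T.
Proof.
by rewrite sE !(rmorphB, rmorphM, rmorph1) /= !rmorph_nat.
Qed.

Let Q1E : Q1 = T * (1 - T).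
Proof. by rewrite q1E !(rmorphM, rmorphB, rmorph1). Qed.

Lemma lringmap_coef (d : O -> O) : derivation d -> forall c a b,
  lringmap (map_poly d) (cst c%:P * mono A a b) = cst (d c)%:P * mono A a b.
Proof.
move=> dP c a b; rewrite (lringmap_monomial (derD (map_poly_derivation dP))).
by rewrite map_poly_derC.
Qed.

Lemma lringmap_coef0 (d : O -> O) : derivation d -> forall c,
  lringmap (map_poly d) (cst c%:P) = cst (d c)%:P.
Proof.
move=> dP c; rewrite (lringmap_cst (derD (map_poly_derivation dP))).
by rewrite map_poly_derC.
Qed.

Lemma lringmap_pot (d : O -> O) : derivation d -> forall a b,
  d q1 = a * q1 -> d q2 = b * q2 ->
  lringmap (map_poly d) pot = cst a%:P * term3 + cst b%:P * term4.
Proof.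
move=> dP a b dq1 dq2; have DP := lringmap_derivation (map_poly_derivation dP).
rewrite /pot !(derD DP) /term3 /term4 !(lringmap_coef dP) dq1 dq2 !rmorphM /=.
have m0 i j : lringmap (map_poly d) (mono A i j) = 0.
  rewrite -[mono A i j]mul1r -(rmorph1 (@cst A)) -polyC1 (lringmap_coef dP).
  by rewrite (der1 dP) !rmorph0 mul0r.
by rewrite /term1 /term2 !m0; ring.
Qed.

Let D1term3 : D1 term3 = S * term3.
Proof. by rewrite /term3 (lringmap_coef d1P) d1q1 !rmorphM mulrA. Qed.
Let D1term4 : D1 term4 = T * term4.
Proof. by rewrite /term4 (lringmap_coef d1P) d1q2 !rmorphM mulrA. Qed.
Let D2term4 : D2 term4 = term4.
Proof. by rewrite /term4 (lringmap_coef d2P) d2q2. Qed.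
Let D1pot : D1 pot = S * term3 + T * term4.
Proof. exact: lringmap_pot. Qed.
Let D2pot : D2 pot = term4.
Proof.
rewrite (@lringmap_pot _ d2P 0 1) ?mul0r ?mul1r //.
by rewrite !rmorph0 !rmorph1; ring.
Qed.

Lemma gm_base1 : gm_base d1 e = cls (- (S * term3 + T * term4)).
Proof. by rewrite gm_base_cls // /twist (der1 D1P) D1pot; congr cls; ring. Qed.

Lemma gm_base2 : gm_base d2 e = cls (- term4).
Proof. by rewrite gm_base_cls // /twist (der1 D2P) D2pot; congr cls; ring. Qed.

Lemma gm_base22 :
  gm_base d2 (gm_base d2 e) =
  2%:R *: gm_base d1 (gm_base d2 e) + (s * q2)%:P *: e.
Proof.
apply/eqP; rewrite gm_base2 !gm_base_cls // !clsZ -clsD -subr_eq0 -clsB.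
rewrite /twist (derN D1P) (derN D2P) D1term4 D2term4 D1pot D2pot.
have -> : cst (2%:R : A) = 2%:R by exact: rmorph_nat.
rewrite !rmorphM /= mulr1.
(* After the reduction term2 term4 = q_2, every coefficient contains 1 - 2 t = s, and a single exact
   form remains. *)
have -> : theta * - term4 - term4 * - term4 -
    (2%:R * (theta * - (T * term4) - (S * term3 + T * term4) * - term4)
     + S * Q2) =
    S * tw2 term4.
  by rewrite tw2E lder2_term4 -term2_term4 SE; ring.
by rewrite -clsZ cls_tw2 scaler0.
Qed.

Lemma gm_base11 : gm_base d1 (gm_base d1 e) = (t * q2)%:P *: e.
Proof.
apply/eqP; rewrite gm_base1 !gm_base_cls // !clsZ -subr_eq0 -clsB.
rewrite /twist (derN D1P) (derD D1P) (derM D1P S) (derM D1P T).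
rewrite D1term4 D1term3 D1pot.
rewrite !(lringmap_coef0 d1P) d1s d1t !rmorphM /= mulr1.
have -> : cst (- 2%:R)%:P = - 2%:R :> L by rewrite !rmorphN /= !rmorph_nat.
(* The quadratic part to be reached is s^2 x^2 + 2 s t x y + t^2 y^2 with x = term3, y = term4, s^2
   = 1 - 4 q_1. [tw1 term3] supplies x^2 but also - q_1 term2^2, because term1 x = q_1 term2^2;
   [tw2 term2] removes term2^2 at the cost of 2 q_1 term2 x; [tw2 term3] removes that product and
   supplies - 4 q_1 x^2; [tw2 1] removes theta q_1 term2; and [tw2 term4] supplies t^2 y^2. *)
rewrite [X in cls X](_ : _ = tw1 term3 + cst (- q1%:P) * tw2 term2
    + cst (2%:R * q1%:P) * tw2 term3 + cst (- 'X * q1%:P) * tw2 1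
    + cst (t%:P ^+ 2) * tw2 term4).
  by rewrite 4!clsD -!clsZ cls_tw1 !cls_tw2 !scaler0 !addr0.
rewrite !(rmorphM, rmorphN, rmorphXn, rmorph_nat) /= tw1E !tw2E.
rewrite (der1 (lder2_derivation _)) lder1_term3.
rewrite lder2_term3 lder2_term2 lder2_term4.
have b1 := term1_term3; have b2 := term2_term4; move: b1 b2 SE Q1E.
move: theta term1 term2 term3 term4 S T Q1 Q2.
move=> h u1 u2 x y S0 T0 q01 q02 b1 b2 -> q1e.
have -> : (u1 - x) * x = q01 * u2 ^+ 2 - x ^+ 2 by rewrite -b1; ring.
rewrite -b2 {}q1e; ring.
Qed.

(** Since t q_2 = r_1 r_2, the left side corresponds to the classical class f \cup H = f o H - r_1
    r_2, and the right side is the class that becomes epsilon_2. *)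
Lemma gm_base12 :
  gm_base d1 (gm_base d2 e) - (t * q2)%:P *: e = cls (term4 * term3).
Proof.
rewrite gm_base2 gm_base_cls // clsZ -clsB.
rewrite /twist (derN D1P) D1term4 D1pot !rmorphM /= mulr1.
have -> : theta * - (T * term4) - (S * term3 + T * term4) * - term4 - T * Q2 =
    term4 * term3 + T * tw2 term4.
  by rewrite tw2E lder2_term4 -term2_term4 SE; ring.
by rewrite clsD -clsZ cls_tw2 scaler0 addr0.
Qed.

End Relations.

(** The derivation stands for q_2 d/dq_2 on M, before the change of coordinates; with [gm_base_q1]
    this computes omega_2. *)
Lemma gm_base_term3 (d : O -> O) : derivation d -> d q1 = 0 -> d q2 = q2 ->
  gm_base d (cls (- term3)) = cls (term4 * term3).
Proof.
move=> dP dq1 dq2; have DP := lringmap_derivation (map_poly_derivation dP).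
have e1 : d q1 = 0 * q1 by rewrite mul0r.
have e2 : d q2 = 1 * q2 by rewrite mul1r.
rewrite gm_base_cls // /twist (derN DP) (lringmap_pot dP e1 e2).
rewrite /term3 (lringmap_coef dP) dq1 !rmorph0 !rmorph1.
by congr cls; ring.
Qed.

Lemma gm_base_q1 (d : O -> O) : derivation d -> d q1 = q1 -> d q2 = 0 ->
  gm_base d (cls 1) = cls (- term3).
Proof.
move=> dP dq1 dq2; have DP := lringmap_derivation (map_poly_derivation dP).
have e1 : d q1 = 1 * q1 by rewrite mul1r.
have e2 : d q2 = 0 * q2 by rewrite mul0r.
rewrite gm_base_cls // /twist (der1 DP) (lringmap_pot dP e1 e2).
by rewrite !rmorph0 !rmorph1; congr cls; ring.
Qed.

End BrieskornTheory.

Section Pullback.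
Variables (O O' : comNzRingType) (h : {rmorphism O -> O'}) (q1 q2 : O).
Local Notation H := (lringmap (map_poly h)).

Let hD : {morph map_poly h : p q / p + q}. Proof. exact: rmorphD. Qed.
Let hM : {morph map_poly h : p q / p * q}. Proof. exact: rmorphM. Qed.

Let HD := lringmapD hD.
Let HM := lringmapM hD hM.

Let H_monomial c a b :
  H (cst c%:P * mono _ a b) = cst (h c)%:P * mono _ a b.
Proof. by rewrite lringmap_monomial // map_polyC. Qed.

Let H_mono a b : H (mono _ a b) = mono _ a b.
Proof. by have := H_monomial 1 a b; rewrite !rmorph1 !mul1r. Qed.

Lemma lringmap1 : H 1 = 1.
Proof. by have := H_mono 0 0; rewrite !mono0. Qed.
Lemma lringmap_term3 : H (term3 q1) = term3 (h q1).
Proof. exact: H_monomial. Qed.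
Lemma lringmap_term4 : H (term4 q2) = term4 (h q2).
Proof. exact: H_monomial. Qed.

Let H_pot : H (pot q1 q2) = pot (h q1) (h q2).
Proof.
by rewrite /pot !HD /term1 /term2 !H_mono lringmap_term3 lringmap_term4.
Qed.

Let H_theta : H (cst 'X) = cst 'X.
Proof. by rewrite lringmap_cst // map_polyX. Qed.

(** Base change commutes with [tw1] and [tw2], so the representative used in [brieskorn_pullback]
    does not matter. *)
Lemma brieskorn_pullback_cls f :
  @brieskorn_pullback O O' h q1 q2 (cls q1 q2 f) = cls (h q1) (h q2) (H f).
Proof.
rewrite /brieskorn_pullback -[lmap _ _](lval_lringmap _ (LRing (modrepr _))).
apply/clsP.
have /clsP [g1 [g2 e]] :
    cls q1 q2 (LRing (modrepr (cls q1 q2 f))) = cls q1 q2 f.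
  exact: modreprK.
have HN := morphDN HD.
exists (H g1), (H g2); rewrite -HN -HD e HD HN /tw1 /tw2 /twist.
rewrite !HD !HN !HM H_theta.
by rewrite !(lringmap_lder1 hD, lringmap_lder2 hD) H_pot.
Qed.

End Pullback.

(** * Walks in the lattice of exponents *)

(* X a, Y b, Z and P lead from (a, b) to its translates by the exponents of the
   four terms of the potential: (1, 0), (0, 1), (0, - 1) and (- 1, 2). *)
Section LatticeWalk.
Variables (E : Type) (e : E) (X Y : int -> E -> E) (Z P : E -> E).
Hypothesis ZY : forall b v, Z (Y b v) = Y (b - 1) (Z v).
Hypothesis PY : forall b v, P (Y b v) = Y (b + 2) (P v).
Hypothesis PX : forall a v, P (X a v) = X (a - 1) (P v).
Hypothesis XY : forall a b v, X a (Y b v) = Y b (X a v).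
Hypothesis ZX : forall a v, Z (X a v) = X a (Z v).
Hypothesis ZP : forall v, Z (P v) = P (Z v).
Hypothesis ZYe : Z (Y 0 e) = e.
Hypothesis XPe : X (- 1) (P e) = Y 1 (Y 0 e).

Fixpoint walk (F : int -> E -> E) (n : nat) (v : E) : E :=
  if n is m.+1 then F m%:Z (walk F m v) else v.

Definition walk_col (b : int) : E :=
  match b with Posz n => walk Y n e | Negz n => iter n.+1 Z e end.

(** [P] also raises the second exponent by 2, so the walk to (- n, b) leaves the column at b - 2 n;
    [Negz n] being - (n + 1), the count is [n.+1]. *)
Definition walk_row (a b : int) : E :=
  match a with
  | Posz n => walk X n (walk_col b)
  | Negz n => iter n.+1 P (walk_col (b - 2 * n.+1%:Z))
  end.

Lemma walk_colN n : walk_col (- n%:Z) = iter n Z e.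
Proof. by case: n => [|n]; [rewrite oppr0 | rewrite -NegzE]. Qed.

Lemma iterZY n b v : iter n Z (Y b v) = Y (b - n%:Z) (iter n Z v).
Proof.
elim: n => [|n IH] /=; first by rewrite subr0.
by rewrite IH ZY; congr (Y _ _); lia.
Qed.

Lemma iterPY n b v : iter n P (Y b v) = Y (b + 2 * n%:Z) (iter n P v).
Proof.
elim: n => [|n IH] /=; first by rewrite mulr0 addr0.
by rewrite IH PY; congr (Y _ _); lia.
Qed.

Lemma iterPX n a v : iter n P (X a v) = X (a - n%:Z) (iter n P v).
Proof.
elim: n => [|n IH] /=; first by rewrite subr0.
by rewrite IH PX; congr (X _ _); lia.
Qed.

Lemma iterPZ n v : iter n P (Z v) = Z (iter n P v).
Proof. by elim: n => //= n ->. Qed.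

(** For b = - (n + 1), moving [Y b] inside [n.+1] copies of [Z] raises its index exactly to 0, where
    [ZYe] cancels it against one [Z]. *)
Lemma Y_walk_col b : Y b (walk_col b) = walk_col (b + 1).
Proof.
case: b => n; first by rewrite -PoszD addn1.
rewrite NegzE walk_colN (_ : _ + 1 = - n%:Z) ?walk_colN; last by lia.
have h : Y (- n.+1%:Z) (iter n.+1 Z e) = iter n.+1 Z (Y 0 e).
  by rewrite iterZY sub0r.
by rewrite h iterSr ZYe.
Qed.

Lemma Z_walk_col b : Z (walk_col b) = walk_col (b - 1).
Proof.
case: b => n; last by rewrite !NegzE -opprD -PoszD addn1 !walk_colN.
case: n => [|n]; first by rewrite sub0r (walk_colN 1).
have -> : n.+1%:Z - 1 = n%:Z by lia.
elim: n => [|n IH]; first exact: ZYe.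
rewrite -[walk_col n.+2%:Z]/(Y n.+1%:Z (walk_col n.+1%:Z)) ZY IH.
have -> : n.+1%:Z - 1 = n%:Z by lia.
by rewrite Y_walk_col -PoszD addn1.
Qed.

(** Only the cancellation [XPe] at [e] is assumed; since [Y] and [Z] can be moved out of [X (- 1)]
    and [P], it propagates up and down the column. *)
Lemma XP_walk_col b : X (- 1) (P (walk_col b)) = walk_col (b + 2).
Proof.
elim/int_ind: b => [|n IH|n IH]; first exact: XPe.
  rewrite -addn1 PoszD -Y_walk_col PY XY IH Y_walk_col.
  by congr walk_col; lia.
have -> : - n.+1%:Z = - n%:Z - 1 by lia.
rewrite -Z_walk_col -ZP -ZX IH Z_walk_col.
by congr walk_col; lia.
Qed.

Lemma walk_rowN n b :
  walk_row (- n%:Z) b = iter n P (walk_col (b - 2 * n%:Z)).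
Proof.
case: n => [|n]; last by rewrite -NegzE.
by rewrite oppr0 addr0.
Qed.

Lemma Y_walk_row a b : Y b (walk_row a b) = walk_row a (b + 1).
Proof.
case: a => n /=.
  rewrite -Y_walk_col; elim: n => [//|n IH] /=.
  by rewrite -XY IH.
rewrite (_ : b + 1 - _ = b - 2 * n.+1%:Z + 1); last by lia.
rewrite -Y_walk_col -!iterS iterPY; congr (Y _ _); lia.
Qed.

Lemma Z_walk_row a b : Z (walk_row a b) = walk_row a (b - 1).
Proof.
case: a => n /=.
  rewrite -Z_walk_col; elim: n => [//|n IH] /=.
  by rewrite ZX IH.
rewrite (_ : b - 1 - _ = b - 2 * n.+1%:Z - 1); last by lia.
by rewrite -Z_walk_col -!iterS iterPZ.
Qed.

(** For a = - (n + 1), moving [X a] inside [n] copies of [P] raises its index to - 1, facing the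
    last [P], and [XP_walk_col] concludes. *)
Lemma X_walk_row a b : X a (walk_row a b) = walk_row (a + 1) b.
Proof.
case: a => n; first by rewrite -PoszD addn1.
rewrite NegzE walk_rowN; have -> : - n.+1%:Z + 1 = - n%:Z by lia.
have -> : iter n.+1 P (walk_col (b - 2 * n.+1%:Z)) =
   iter n P (P (walk_col (b - 2 * n.+1%:Z))) by rewrite iterSr.
rewrite (_ : - n.+1%:Z = - 1 - n%:Z); last by lia.
rewrite -iterPX XP_walk_col walk_rowN; congr (iter _ _ (walk_col _)); lia.
Qed.

Lemma P_walk_row a b : P (walk_row a b) = walk_row (a - 1) (b + 2).
Proof.
case: a => n; last first.
  rewrite NegzE -opprD -PoszD addn1 !walk_rowN [RHS]iterS.
  by congr (P (iter _ _ (walk_col _))); lia.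
elim: n b => [|n IH] b.
  by rewrite sub0r (walk_rowN 1) /=; congr (P (walk_col _)); lia.
rewrite -[walk_row n.+1%:Z b]/(X n%:Z (walk_row n%:Z b)) PX IH X_walk_row.
by congr walk_row; lia.
Qed.

Lemma lattice_walk : exists v : int -> int -> E, v 0 0 = e /\
  forall a b, [/\ X a (v a b) = v (a + 1) b, Y b (v a b) = v a (b + 1),
    Z (v a b) = v a (b - 1) & P (v a b) = v (a - 1) (b + 2)].
Proof.
exists walk_row; split=> // a b.
by rewrite X_walk_row Y_walk_row Z_walk_row P_walk_row.
Qed.

End LatticeWalk.

(** The column a = 0 comes first; the first coordinate can be lowered only along (- 1, 2), so the
    claim at b is drawn from the one at b - 2. *)
Lemma lattice_ind (Q : int -> int -> Prop) : Q 0 0 ->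
  (forall a b, Q a b ->
    [/\ Q (a + 1) b, Q a (b + 1), Q a (b - 1) & Q (a - 1) (b + 2)]) ->
  forall a b, Q a b.
Proof.
move=> Q0 QS a b.
have col c : Q 0 c.
  elim/int_ind: c => [//|n /QS[_ h _ _]|n /QS[_ _ h _]].
    by rewrite -addn1 PoszD.
  by have -> : - n.+1%:Z = - n%:Z - 1 by lia.
elim/int_ind: a b => [//|n IH|n IH] b.
  by rewrite -addn1 PoszD; case: (QS _ _ (IH b)).
have -> : - n.+1%:Z = - n%:Z - 1 by lia.
by case: (QS _ _ (IH (b - 2))) => _ _ _; rewrite subrK.
Qed.

(** * The quantum connection *)

Local Notation i0 := (@inord 3 0).
Local Notation i1 := (@inord 3 1).
Local Notation i2 := (@inord 3 2).
Local Notation i3 := (@inord 3 3).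

Lemma ord4P (Q : 'I_4 -> Prop) : Q i0 -> Q i1 -> Q i2 -> Q i3 -> forall i, Q i.
Proof.
move=> Q0 Q1 Q2 Q3 i; have -> : i = inord i by rewrite inord_val.
by case: i => -[|[|[|[|]]]].
Qed.

Lemma sum4 (V : nmodType) (F : 'I_4 -> V) :
  \sum_i F i = F i0 + F i1 + F i2 + F i3.
Proof.
rewrite !big_ord_recl big_ord0 addr0 !addrA.
by congr (F _ + F _ + F _ + F _); apply: val_inj; rewrite /= inordK.
Qed.

Section Rows.
Variable P : comNzRingType.
Implicit Types a b c d : P.

Definition row4 a b c d : 'rV[P]_4 := \row_j nth 0 [:: a; b; c; d] j.

Lemma row4_0 a b c d : row4 a b c d 0 i0 = a. Proof. by rewrite mxE inordK. Qed.
Lemma row4_1 a b c d : row4 a b c d 0 i1 = b. Proof. by rewrite mxE inordK. Qed.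
Lemma row4_2 a b c d : row4 a b c d 0 i2 = c. Proof. by rewrite mxE inordK. Qed.
Lemma row4_3 a b c d : row4 a b c d 0 i3 = d. Proof. by rewrite mxE inordK. Qed.
Definition row4E := (row4_0, row4_1, row4_2, row4_3).

Lemma rowDE (u v : 'rV[P]_4) i : (u + v) 0 i = u 0 i + v 0 i.
Proof. by rewrite mxE. Qed.
Lemma rowNE (u : 'rV[P]_4) i : (- u) 0 i = - u 0 i.
Proof. by rewrite mxE. Qed.
Lemma rowZE c (u : 'rV[P]_4) i : (c *: u) 0 i = c * u 0 i.
Proof. by rewrite mxE. Qed.
Definition coord4E := (row4E, rowDE, rowNE, rowZE).

Lemma row4P (u v : 'rV[P]_4) : u 0 i0 = v 0 i0 -> u 0 i1 = v 0 i1 ->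
  u 0 i2 = v 0 i2 -> u 0 i3 = v 0 i3 -> u = v.
Proof. by move=> *; apply/rowP; apply: ord4P. Qed.

Lemma delta4 : (delta_mx 0 i0 = row4 1 0 0 0) * (delta_mx 0 i1 = row4 0 1 0 0) *
  (delta_mx 0 i2 = row4 0 0 1 0) * (delta_mx 0 i3 = row4 0 0 0 1).
Proof.
by do ![split]; apply: row4P; rewrite row4E mxE -!val_eqE /= !inordK.
Qed.

Lemma bilinear_ext_deltal (t : 'I_4 -> 'I_4 -> 'rV[P]_4) i (b : 'rV[P]_4) :
  bilinear_ext t (delta_mx 0 i) b = \sum_j b 0 j *: t i j.
Proof.
rewrite /bilinear_ext (bigD1 i) //= [X in _ + X]big1 => [|k /negPf ki].
  by rewrite addr0; apply: eq_bigr => j _; rewrite mxE !eqxx mul1r.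
by rewrite big1 // => l _; rewrite mxE ki andbF mul0r scale0r.
Qed.

Lemma qprod_cf (x1 x2 : P) (a : 'rV[P]_4) : qprod x1 x2 (cf P) a =
  row4 (x1 * x2 * (a 0 i1 + a 0 i2)) (a 0 i0 - x1 * x2 * a 0 i3)
       (x1 * x2 * a 0 i3) (a 0 i2).
Proof.
rewrite /qprod /cf bilinear_ext_deltal sum4 /quantum_table /= !inordK //=.
rewrite /c1 /cf /cH /cfH !delta4.
by apply: row4P; rewrite !mxE ?inordK //=; ring.
Qed.

Lemma qprod_cH (x1 x2 : P) (a : 'rV[P]_4) : qprod x1 x2 (cH P) a =
  row4 (x1 * x2 * a 0 i1 + x2 * (1 + x1) * a 0 i2) (x2 * (1 - x1) * a 0 i3)
       (a 0 i0 + x1 * x2 * a 0 i3) (a 0 i1 + 2%:R * a 0 i2).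
Proof.
rewrite /qprod /cH bilinear_ext_deltal sum4 /quantum_table /= !inordK //=.
rewrite /c1 /cf /cH /cfH !delta4.
by apply: row4P; rewrite !mxE ?inordK //=; ring.
Qed.

Lemma qprod_cHn (x1 x2 : P) (a : 'rV[P]_4) n :
  qprod x1 x2 (n *: cH P) a = n *: qprod x1 x2 (cH P) a.
Proof.
rewrite /qprod /bilinear_ext scaler_sumr; apply: eq_bigr => i _.
by rewrite scaler_sumr; apply: eq_bigr => j _; rewrite scalerA mxE mulrA.
Qed.

Lemma poincareE (a b : 'rV[P]_4) : poincare a b =
  a 0 i0 * b 0 i3 + a 0 i3 * b 0 i0 + a 0 i1 * b 0 i2 + a 0 i2 * b 0 i1
  + 2%:R * a 0 i2 * b 0 i2.
Proof.
rewrite /poincare /integral /cup /bilinear_ext sum4 !sum4 /cup_table /=.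
rewrite !inordK //= /cfH !delta4 !mxE !inordK //=; ring.
Qed.

Lemma half_degE (a : 'rV[P]_4) :
  half_deg a = row4 0 (a 0 i1) (a 0 i2) (2%:R * a 0 i3).
Proof. by apply: row4P; rewrite !mxE !inordK //=; ring. Qed.

End Rows.

Section ConnRow.
Variables (O : comUnitRingType) (d1 d2 : O -> O) (x1 x2 : O).
Local Notation P := {poly O}.

(** This is [A_conn] with r_1, r_2 replaced by symbols in any ring with two derivations, which turns
    the axioms into ring identities in coordinates. *)
Definition conn_row (X : vfield) (a : 'rV[P]_4) : 'rV[P]_4 :=
  'X *: map_mx (vact d1 d2 X) a +
  match X with
  | VR1 => qprod x1%:P x2%:P (cf _) a
  | VR2 => qprod x1%:P x2%:P (cH _) a
  | VTheta => - qprod x1%:P x2%:P (2%:R *: cH _) a + 'X *: half_deg a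
  end.

Definition pair_row (a b : 'rV[P]_4) : P :=
  poincare a (map_mx (@theta_conj _) b) * 'X^2.

Definition qds_row : qds O :=
  Qds (fun i : 'I_4 => (delta_mx 0 i : 'rV[P]_4)) conn_row 2 pair_row.

Local Notation D := (vact d1 d2).
Local Notation w := (x1%:P * x2%:P : P).
Local Notation z := (x2%:P * (1 - x1%:P) : P).
Local Notation k := (x2%:P * (1 + x1%:P) : P).
Local Notation h := ('X : P).

Lemma conn_row1 a : conn_row VR1 a =
  row4 (h * D VR1 (a 0 i0) + w * (a 0 i1 + a 0 i2))
       (h * D VR1 (a 0 i1) + (a 0 i0 - w * a 0 i3))
       (h * D VR1 (a 0 i2) + w * a 0 i3)
       (h * D VR1 (a 0 i3) + a 0 i2).
Proof. by rewrite /conn_row qprod_cf; apply: row4P; rewrite !mxE !inordK. Qed.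

Lemma conn_row2 a : conn_row VR2 a =
  row4 (h * D VR2 (a 0 i0) + (w * a 0 i1 + k * a 0 i2))
       (h * D VR2 (a 0 i1) + z * a 0 i3)
       (h * D VR2 (a 0 i2) + (a 0 i0 + w * a 0 i3))
       (h * D VR2 (a 0 i3) + (a 0 i1 + 2%:R * a 0 i2)).
Proof. by rewrite /conn_row qprod_cH; apply: row4P; rewrite !mxE !inordK. Qed.

Lemma conn_rowT a : conn_row VTheta a =
  row4 (h * D VTheta (a 0 i0) - 2%:R * (w * a 0 i1 + k * a 0 i2))
       (h * D VTheta (a 0 i1) - 2%:R * (z * a 0 i3) + h * a 0 i1)
       (h * D VTheta (a 0 i2) - 2%:R * (a 0 i0 + w * a 0 i3) + h * a 0 i2)
       (h * D VTheta (a 0 i3) - 2%:R * (a 0 i1 + 2%:R * a 0 i2)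
        + 2%:R * h * a 0 i3).
Proof.
rewrite /conn_row qprod_cHn qprod_cH half_degE.
by apply: row4P; rewrite !mxE !inordK //=; ring.
Qed.

Hypotheses (d1P : derivation d1) (d2P : derivation d2).
Hypothesis d12 : forall x, d1 (d2 x) = d2 (d1 x).
Hypotheses (d1x1 : d1 x1 = x1) (d1x2 : d1 x2 = 0).
Hypotheses (d2x1 : d2 x1 = 0) (d2x2 : d2 x2 = x2).

Lemma vact_derivation X : derivation (D X).
Proof.
case: X => /=; [exact: map_poly_derivation|exact: map_poly_derivation|].
by split=> p q /=; rewrite ?derivD ?derivM; ring.
Qed.
Let DP := vact_derivation.

Let D1h : D VR1 h = 0. Proof. exact: map_poly_derX. Qed.
Let D2h : D VR2 h = 0. Proof. exact: map_poly_derX. Qed.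
Let DTh : D VTheta h = h. Proof. by rewrite /= derivX mulr1. Qed.
Let D1x1 : D VR1 x1%:P = x1%:P. Proof. by rewrite /= map_poly_derC // d1x1. Qed.
Let D1x2 : D VR1 x2%:P = 0. Proof. by rewrite /= map_poly_derC // d1x2. Qed.
Let D2x1 : D VR2 x1%:P = 0. Proof. by rewrite /= map_poly_derC // d2x1. Qed.
Let D2x2 : D VR2 x2%:P = x2%:P. Proof. by rewrite /= map_poly_derC // d2x2. Qed.
Let DTC c : D VTheta c%:P = 0. Proof. by rewrite /= derivC mulr0. Qed.

Lemma vact_comm X Y p : D X (D Y p) = D Y (D X p).
Proof.
have c12 q : map_poly d1 (map_poly d2 q) = map_poly d2 (map_poly d1 q).
  exact: map_poly_der_comm.
have cT (d : O -> O) (q : P) : derivation d ->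
    map_poly d ('X * q^`()) = 'X * (map_poly d q)^`().
  move=> dP; rewrite (derM (map_poly_derivation dP)) map_poly_derX //.
  rewrite mul0r add0r.
  by rewrite deriv_map_poly_der.
by case: X Y => -[] //=; rewrite ?c12 // cT.
Qed.

Lemma conn_rowD X : {morph conn_row X : a b / a + b}.
Proof.
move=> a b; have DD := derD (DP X); case: X DD => DD.
all: rewrite ?conn_row1 ?conn_row2 ?conn_rowT.
all: by apply: row4P; rewrite !coord4E !DD; ring.
Qed.

Lemma conn_rowZ X c a :
  conn_row X (c *: a) = ('X * D X c) *: a + c *: conn_row X a.
Proof.
have DM := derM (DP X); case: X DM => DM.
all: rewrite ?conn_row1 ?conn_row2 ?conn_rowT.
all: by apply: row4P; rewrite !coord4E !DM; ring.
Qed.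

(** Behind the computation: f o and H o commute, r_1 d/dr_1 of the matrix of H o equals r_2 d/dr_2
    of that of f o, and for theta the product respects the grading with deg r_1 = 0, deg r_2 = 2. *)
Lemma conn_row_flat X Y a :
  conn_row X (conn_row Y a) - D X 'X *: conn_row Y a =
  conn_row Y (conn_row X a) - D Y 'X *: conn_row X a.
Proof.
have DD X' := derD (DP X'); have DM X' := derM (DP X').
have DN X' := derN (DP X'); have D1 X' := der1 (DP X').

have VC := vact_comm.
have flat12 : conn_row VR1 (conn_row VR2 a) = conn_row VR2 (conn_row VR1 a).
  rewrite !conn_row1 !conn_row2.
  move: DD DN DM D1 VC D1h D2h DTh DTC D1x1 D1x2 D2x1 D2x2.
  move: (vact d1 d2) => D' DD DN DM D1 VC D1h' D2h' DTh' DTC' e1 e2 e3 e4.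
  apply: row4P; rewrite !row4E;
    rewrite !(DD, DN, DM, e1, e2, e3, e4, D1h', D2h', D1);
    rewrite (VC VR1 VR2); ring.
have flatT1 : conn_row VTheta (conn_row VR1 a) =
    conn_row VR1 (conn_row VTheta a) + 'X *: conn_row VR1 a.
  rewrite !conn_row1 !conn_rowT.
  move: DD DN DM D1 VC D1h D2h DTh DTC D1x1 D1x2 D2x1 D2x2.
  move: (vact d1 d2) => D' DD DN DM D1 VC D1h' D2h' DTh' DTC' e1 e2 e3 e4.
  apply: row4P; rewrite !coord4E;
    rewrite !(DD, DN, DM, e1, e2, D1h', DTh', DTC', D1);
    rewrite ?(VC VR1 VTheta); ring.
have flatT2 : conn_row VTheta (conn_row VR2 a) =
    conn_row VR2 (conn_row VTheta a) + 'X *: conn_row VR2 a.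
  rewrite !conn_row2 !conn_rowT.
  move: DD DN DM D1 VC D1h D2h DTh DTC D1x1 D1x2 D2x1 D2x2.
  move: (vact d1 d2) => D' DD DN DM D1 VC D1h' D2h' DTh' DTC' e1 e2 e3 e4.
  apply: row4P; rewrite !coord4E;
    rewrite !(DD, DN, DM, e3, e4, D2h', DTh', DTC', D1);
    rewrite ?(VC VR2 VTheta); ring.
case: X; case: Y.
- exact: erefl.
- by rewrite D1h D2h !scale0r !subr0 flat12.
- by rewrite D1h DTh flatT1 scale0r subr0 addrK.
- by rewrite D1h D2h !scale0r !subr0 flat12.
- exact: erefl.
- by rewrite D2h DTh flatT2 scale0r subr0 addrK.
- by rewrite D1h DTh flatT1 scale0r subr0 addrK.
- by rewrite D2h DTh flatT2 scale0r subr0 addrK.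
- exact: erefl.
Qed.

Definition affine (p : P) := exists u v : O, p = u%:P + v%:P * 'X.

Lemma affineE p : affine p -> p = (p`_0)%:P + (p`_1)%:P * 'X.
Proof.
case=> u [v ->]; rewrite !coefD !coefC !coefMX !coefC /=.
by rewrite addr0 add0r.
Qed.

Lemma conn_row_const X (u : 'I_4 -> O) : (forall i, D X (u i)%:P = 0) ->
  forall i, affine (conn_row X (\row_i (u i)%:P) 0 i).
Proof.
move=> Du; apply: ord4P; case: X Du => Du;
  rewrite ?conn_row1 ?conn_row2 ?conn_rowT !row4E !mxE !Du.
- by exists (x1 * x2 * (u i1 + u i2)), 0; rewrite !rmorphM !rmorphD /=; ring.
- exists (x1 * x2 * u i1 + x2 * (1 + x1) * u i2), 0.
  by rewrite !(rmorphD, rmorphM, rmorph1) /=; ring.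
- exists (- 2%:R * (x1 * x2 * u i1 + x2 * (1 + x1) * u i2)), 0.
  by rewrite ?(rmorphD, rmorphM, rmorphN, rmorph1, rmorph_nat) /=; ring.
- exists (u i0 - x1 * x2 * u i3), 0.
  by rewrite ?(rmorphD, rmorphM, rmorphN, rmorph1, rmorph_nat) /=; ring.
- exists (x2 * (1 - x1) * u i3), 0.
  by rewrite ?(rmorphD, rmorphM, rmorphN, rmorph1, rmorph_nat) /=; ring.
- exists (- 2%:R * (x2 * (1 - x1) * u i3)), (u i1).
  by rewrite ?(rmorphD, rmorphM, rmorphN, rmorph1, rmorph_nat) /=; ring.
- exists (x1 * x2 * u i3), 0.
  by rewrite ?(rmorphD, rmorphM, rmorphN, rmorph1, rmorph_nat) /=; ring.
- exists (u i0 + x1 * x2 * u i3), 0.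
  by rewrite ?(rmorphD, rmorphM, rmorphN, rmorph1, rmorph_nat) /=; ring.
- exists (- 2%:R * (u i0 + x1 * x2 * u i3)), (u i2).
  by rewrite ?(rmorphD, rmorphM, rmorphN, rmorph1, rmorph_nat) /=; ring.
- exists (u i2), 0.
  by rewrite ?(rmorphD, rmorphM, rmorphN, rmorph1, rmorph_nat) /=; ring.
- exists (u i1 + 2%:R * u i2), 0.
  by rewrite ?(rmorphD, rmorphM, rmorphN, rmorph1, rmorph_nat) /=; ring.
- exists (- 2%:R * (u i1 + 2%:R * u i2)), (2%:R * u i3).
  by rewrite ?(rmorphD, rmorphM, rmorphN, rmorph1, rmorph_nat) /=; ring.
Qed.

Lemma conn_row_poles X (j : 'I_4) : exists a b : 'I_4 -> O,
  conn_row X (delta_mx 0 j) =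
  \sum_i ((a i)%:P + (b i)%:P * 'X) *: (delta_mx 0 i : 'rV[P]_4).
Proof.
have e : delta_mx 0 j = \row_k ((k == j)%:R)%:P :> 'rV[P]_4.
  by apply/rowP => k; rewrite !mxE eqxx /= rmorph_nat.
have D0 k : D X ((k == j)%:R)%:P = 0 by rewrite rmorph_nat (der_nat (DP X)).
exists (fun i => (conn_row X (delta_mx 0 j) 0 i)`_0),
  (fun i => (conn_row X (delta_mx 0 j) 0 i)`_1).
rewrite [LHS]row_sum_delta; apply: eq_bigr => i _; congr (_ *: _).
by rewrite e; apply: affineE; apply: conn_row_const.
Qed.

Lemma theta_conjD (p q : P) : theta_conj (p + q) = theta_conj p + theta_conj q.
Proof. exact: comp_polyD. Qed.
Lemma theta_conjM (p q : P) : theta_conj (p * q) = theta_conj p * theta_conj q.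
Proof. exact: comp_polyM. Qed.
Lemma theta_conjN (p : P) : theta_conj (- p) = - theta_conj p.
Proof. exact: raddfN. Qed.
Lemma theta_conjC c : theta_conj c%:P = c%:P :> P.
Proof. exact: comp_polyC. Qed.
Lemma theta_conjX : theta_conj 'X = - 'X :> P.
Proof. exact: comp_polyX. Qed.
Lemma theta_conj0 : theta_conj 0 = 0 :> P.
Proof. exact: comp_poly0. Qed.
Lemma theta_conj1 : theta_conj 1 = 1 :> P.
Proof. exact: theta_conjC. Qed.
Lemma theta_conj_nat n : theta_conj n%:R = n%:R :> P.
Proof. by rewrite -!polyC_natr theta_conjC. Qed.

Lemma theta_conj_vact X p : theta_conj (D X p) = D X (theta_conj p).
Proof.
have cd d : derivation d ->
    theta_conj (map_poly d p) = map_poly d (theta_conj p) :> P.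
  move=> dP; have mP := map_poly_derivation dP; elim/poly_ind: p => [|p c IH].
    by rewrite !(theta_conj0, der0 mP).
  rewrite !(theta_conjD, derD mP) !(derM mP) map_poly_derX // mulr0 addr0.
  rewrite map_poly_derC // !theta_conjM !theta_conjC theta_conjX IH.
  rewrite (derM mP) (derN mP) map_poly_derX // map_poly_derC //.
  by rewrite oppr0 mulr0 addr0.
case: X => /=; [exact: cd|exact: cd|].
rewrite theta_conjM theta_conjX /theta_conj deriv_comp derivN derivX.
by rewrite mulrN1 mulrN mulNr.
Qed.

Lemma map_row_E (A B : Type) (f : A -> B) (u : 'rV[A]_4) i :
  map_mx f u 0 i = f (u 0 i).
Proof. by rewrite mxE. Qed.

Lemma pair_row_linear c (x y u : 'rV[P]_4) :
  pair_row (c *: x + y) u = c * pair_row x u + pair_row y u.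
Proof. by rewrite /pair_row !poincareE !coord4E; ring. Qed.

Lemma pair_row_conjlinear c (x y u : 'rV[P]_4) :
  pair_row u (c *: x + y) = theta_conj c * pair_row u x + pair_row u y.
Proof.
by rewrite /pair_row !poincareE !mxE !theta_conjD !theta_conjM; ring.
Qed.

(** Quantum multiplication is self-adjoint for the Poincaré pairing, so its two contributions
    cancel. For theta d/dtheta, the exponent 2 of theta^2 is matched by the half degrees of dual
    classes, whose sum is 2; the sign change of theta in the second argument makes them add. *)
Lemma pair_row_flat X (x y : 'rV[P]_4) :
  'X * D X (pair_row x y) =
  pair_row (conn_row X x) y - pair_row x (conn_row X y).
Proof.
have DD := derD (DP X); have DM := derM (DP X); have D1 := der1 (DP X).
have DX2 : 'X * D X 'X^2 = 2%:R * D X 'X * 'X^2 by rewrite expr2 DM; ring.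
rewrite /pair_row !poincareE !map_row_E DM mulrDr [X in _ + X = _]mulrCA DX2.
rewrite !(DD, DM, D1) -!theta_conj_vact.
have cc := (theta_conjD, theta_conjM, theta_conjN, theta_conjX, theta_conjC,
  theta_conj1, theta_conj_nat).
case: X DX2 {DD DM D1} => _; rewrite ?conn_row1 ?conn_row2 ?conn_rowT !row4E.
all: by rewrite !cc ?D1h ?D2h ?DTh; ring.
Qed.

Lemma row_basis (x : 'rV[P]_4) : exists! c : {ffun 'I_4 -> P},
  x = \sum_i c i *: (delta_mx 0 i : 'rV[P]_4).
Proof.
exists [ffun i => x 0 i]; split.
  by rewrite [LHS]row_sum_delta; apply: eq_bigr => i _; rewrite ffunE.
move=> c e; apply/ffunP => i; rewrite ffunE e summxE (bigD1 i) //= big1.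
  by rewrite addr0 !mxE !eqxx mulr1.
by move=> j /negPf ji; rewrite !mxE eq_sym ji andbF mulr0.
Qed.

Lemma pair_row_nondegenerate : exists2 G : 'M[O]_4, G \in unitmx &
  forall i j, pair_row (delta_mx 0 i) (delta_mx 0 j) = (G i j)%:P * 'X^2.
Proof.
pose mx (s : seq (seq O)) : 'M[O]_4 := \matrix_(i, j) nth 0 (nth [::] s i) j.
exists (mx [:: [:: 0; 0; 0; 1]; [:: 0; 0; 1; 0]; [:: 0; 1; 2%:R; 0];
               [:: 1; 0; 0; 0]]).
  (* The second matrix is the inverse: the block of f, H is (0, 1; 1, 2), with inverse (- 2, 1; 1,
     0). *)
  apply: (proj1 (mulmx1_unit (B := mx [:: [:: 0; 0; 0; 1];
    [:: 0; - 2%:R; 1; 0]; [:: 0; 1; 0; 0]; [:: 1; 0; 0; 0]]) _)).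
  apply/matrixP => i j; rewrite !mxE sum4 !mxE !inordK //.
  move: i j; apply: ord4P; apply: ord4P; rewrite -!val_eqE /= !inordK //=;
    ring.
apply: ord4P; apply: ord4P; rewrite /pair_row poincareE !map_row_E !delta4;
  rewrite !row4E ?theta_conj1 ?theta_conj0 !mxE !inordK //= ?rmorph_nat; ring.
Qed.

Lemma qds_rowP : is_qds d1 d2 qds_row.
Proof.
split.
- exact: row_basis.
- exact: conn_rowD.
- exact: conn_rowZ.
- exact: conn_row_poles.
- exact: conn_row_flat.
- exact: pair_row_linear.
- exact: pair_row_conjlinear.
- exact: pair_row_nondegenerate.
- exact: pair_row_flat.
Qed.

End ConnRow.

(** * The mirror isomorphism *)

Section StepOperators.
Variables (P : comNzRingType) (h p1 p2 : P) (K1 K2 : 'rV[P]_4 -> 'rV[P]_4).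
Hypotheses (K1D : {morph K1 : u v / u + v}) (K2D : {morph K2 : u v / u + v}).
Hypotheses (K1h : forall c v, K1 ((h * c%:~R) *: v) = (h * c%:~R) *: K1 v)
  (K2h : forall c v, K2 ((h * c%:~R) *: v) = (h * c%:~R) *: K2 v).
Hypotheses (K1p1 : forall v, K1 (- p1 *: v) = (h * p1) *: v - p1 *: K1 v)
  (K2p1 : forall v, K2 (- p1 *: v) = - p1 *: K2 v)
  (K1p2 : forall v, K1 (- p2 *: v) = - p2 *: K1 v)
  (K2p2 : forall v, K2 (- p2 *: v) = (h * p2) *: v - p2 *: K2 v).
Hypothesis K_comm : forall v, K1 (K2 v) = K2 (K1 v).

(** These formulas are read off G. On the class of u_1^a u_2^b, [K1] gives - q_1 times the class at
    (a - 1, b + 2) and [K2] gives - q_2 times the class at (a, b - 1), whence [stepP] and [stepZ]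
    with p_i = 1 / q_i. The exactness of [tw1] and [tw2] of the monomial then gives the classes at
    (a + 1, b) and (a, b + 1), with theta a and theta b coming from differentiation in u_1 and
    u_2. *)
Definition stepX (a : int) v := (h * a%:~R) *: v - K1 v.
Definition stepY (b : int) v := (h * b%:~R) *: v + 2%:R *: K1 v - K2 v.
Definition stepZ v := - p2 *: K2 v.
Definition stepP v := - p1 *: K1 v.

Let K1N := morphDN K1D.
Let K2N := morphDN K2D.
Let K12 v : K1 (2%:R *: v) = 2%:R *: K1 v.
Proof. by rewrite !scaler_nat !mulr2n K1D. Qed.
Let K22 v : K2 (2%:R *: v) = 2%:R *: K2 v.
Proof. by rewrite !scaler_nat !mulr2n K2D. Qed.
Let KE := (K1D, K2D, K1N, K2N, K1h, K2h, K12, K22,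
  K1p1, K2p2, K1p2, K2p1, K_comm).

(** The index shifts required of a walk come from the Leibniz rule on 1 / q_1 and 1 / q_2, i.e. from
    the terms [h * p1] and [h * p2] in the hypotheses. *)
Lemma step_walk (e : 'rV[P]_4) : stepZ (stepY 0 e) = e ->
  stepX (- 1) (stepP e) = stepY 1 (stepY 0 e) ->
  exists v : int -> int -> 'rV[P]_4, v 0 0 = e /\
  forall a b, [/\ stepX a (v a b) = v (a + 1) b, stepY b (v a b) = v a (b + 1),
    stepZ (v a b) = v a (b - 1) & stepP (v a b) = v (a - 1) (b + 2)].
Proof.
move=> e1 e2; apply: lattice_walk => // [b v|b v|a v|a b v|a v|v].
- rewrite /stepZ /stepY !KE; apply/rowP => i; rewrite !mxE rmorphB /=; ring.
- rewrite /stepP /stepY !KE; apply/rowP => i; rewrite !mxE rmorphD /=; ring.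
- rewrite /stepP /stepX !KE; apply/rowP => i; rewrite !mxE rmorphB /=; ring.
- rewrite /stepX /stepY !KE; apply/rowP => i; rewrite !mxE; ring.
- rewrite /stepZ /stepX !KE; apply/rowP => i; rewrite !mxE; ring.
- rewrite /stepZ /stepP !KE; apply/rowP => i; rewrite !mxE; ring.
Qed.

End StepOperators.

Lemma der_int (A : pzRingType) (d : A -> A) (dP : derivation d) (a : int) :
  d a%:~R = 0.
Proof.
by case: a => n; rewrite ?NegzE ?mulrNz ?(derN dP) (der_nat dP) ?oppr0.
Qed.

Section Mirror.
Variables (O : comUnitRingType) (d1 d2 : O -> O) (x1 x2 q1 q2 s t : O).
Local Notation P := {poly O}.
Hypotheses (d1P : derivation d1) (d2P : derivation d2).
Hypothesis d12 : forall x, d1 (d2 x) = d2 (d1 x).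
Hypotheses (d1x1 : d1 x1 = x1) (d1x2 : d1 x2 = 0).
Hypotheses (d2x1 : d2 x1 = 0) (d2x2 : d2 x2 = x2).
Hypotheses (d1q1 : d1 q1 = s * q1) (d1q2 : d1 q2 = t * q2) (d1t : d1 t = q1).
Hypotheses (d2q1 : d2 q1 = 0) (d2q2 : d2 q2 = q2) (d2t : d2 t = 0).
Hypotheses (sE : s = 1 - 2%:R * t) (q1E : q1 = t * (1 - t)).
Hypotheses (wE : x1 * x2 = t * q2) (zE : x2 * (1 - x1) = s * q2)
  (kE : x2 * (1 + x1) = q2).
Hypotheses (sU : s \is a GRing.unit) (q1U : q1 \is a GRing.unit)
  (q2U : q2 \is a GRing.unit).

Local Notation conn := (conn_row d1 d2 x1 x2).
Local Notation D := (vact d1 d2).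
Local Notation sV := (s^-1)%:P.
Local Notation T := (t%:P : P).
Local Notation S := (s%:P : P).
Local Notation p1 := (q1^-1)%:P.
Local Notation p2 := (q2^-1)%:P.
Local Notation Q1 := (q1%:P : P).
Local Notation Q2 := (q2%:P : P).

Let DP X := vact_derivation d1P d2P X.
Let cD X := conn_rowD x1 x2 d1P d2P X.
Let cZ X := conn_rowZ x1 x2 d1P d2P X.

Let D1C c : D VR1 c%:P = (d1 c)%:P. Proof. exact: map_poly_derC. Qed.
Let D2C c : D VR2 c%:P = (d2 c)%:P. Proof. exact: map_poly_derC. Qed.
Let D1h : D VR1 'X = 0. Proof. exact: map_poly_derX. Qed.
Let D2h : D VR2 'X = 0. Proof. exact: map_poly_derX. Qed.

(* theta nabla along q_1 d/dq_1 and q_2 d/dq_2 *)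
Definition nablaq1 (v : 'rV[P]_4) := sV *: (conn VR1 v - T *: conn VR2 v).
Definition nablaq2 (v : 'rV[P]_4) := conn VR2 v.
Local Notation K1 := nablaq1.
Local Notation K2 := nablaq2.
(** The action of q_1 d/dq_1 on functions: the chain rule r_1 d/dr_1 = s q_1 d/dq_1 + t q_2 d/dq_2,
    r_2 d/dr_2 = q_2 d/dq_2, solved for q_1 d/dq_1. *)
Definition dq1 (c : P) : P := sV * (D VR1 c - T * D VR2 c).

Lemma nablaq1D : {morph K1 : u v / u + v}.
Proof.
move=> u v; rewrite /nablaq1 !cD.
move: (conn VR1 u) (conn VR2 u) (conn VR1 v) (conn VR2 v) => a b c d.
by apply/rowP => i; rewrite !mxE; ring.
Qed.

Lemma nablaq2D : {morph K2 : u v / u + v}.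
Proof. exact: cD. Qed.

Lemma nablaq1Z c v : K1 (c *: v) = ('X * dq1 c) *: v + c *: K1 v.
Proof.
rewrite /nablaq1 /dq1 !cZ; move: (conn VR1 v) (conn VR2 v) => a b.
by apply/rowP => i; rewrite !mxE; ring.
Qed.

Lemma nablaq2Z c v : K2 (c *: v) = ('X * D VR2 c) *: v + c *: K2 v.
Proof. exact: cZ. Qed.

Lemma dq1C c : dq1 c%:P = (s^-1 * (d1 c - t * d2 c))%:P.
Proof. by rewrite /dq1 D1C D2C !(rmorphM, rmorphB). Qed.

Lemma dq1_derivation : derivation dq1.
Proof.
split=> c e; first by rewrite /dq1 !(derD (DP _)); ring.
by rewrite /dq1 !(derM (DP _)); ring.
Qed.

Lemma dq1X : dq1 'X = 0.
Proof. by rewrite /dq1 D1h D2h; ring. Qed.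

Let d2s : d2 s = 0.
Proof.
by rewrite sE (derB d2P) (derM d2P) (der1 d2P) (der_nat d2P) d2t; ring.
Qed.

Let d1s : d1 s = - 2%:R * q1.
Proof.
by rewrite sE (derB d1P) (derM d1P) (der1 d1P) (der_nat d1P) d1t; ring.
Qed.

Let dq1p1 : dq1 p1 = - p1.
Proof.
rewrite dq1C (derV d1P q1U) (derV d2P q1U) d1q1 d2q1 -rmorphN; congr polyC.
rewrite -exprVn; set u := q1^-1; set v := s^-1.
have u1 : u * q1 = 1 by apply: mulVr.
have v1 : v * s = 1 by apply: mulVr.
have -> : v * (- u ^+ 2 * (s * q1) - t * (- u ^+ 2 * 0)) =
  - (v * s) * (u * q1) * u by ring.
by rewrite u1 v1; ring.
Qed.

Let dq1p2 : dq1 p2 = 0.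
Proof.
rewrite dq1C (derV d1P q2U) (derV d2P q2U) d1q2 d2q2 -[RHS](rmorph0 polyC).
by congr polyC; ring.
Qed.

Let dq2p1 : D VR2 p1 = 0.
Proof. by rewrite D2C (derV d2P q1U) d2q1 mulr0. Qed.

Let dq2p2 : D VR2 p2 = - p2.
Proof.
rewrite D2C (derV d2P q2U) d2q2 -rmorphN; congr polyC.
by rewrite mulNr expr2 invrM // -mulrA mulVr // mulr1.
Qed.

Lemma nablaq_comm v : K1 (K2 v) = K2 (K1 v).
Proof.
have := conn_row_flat d1P d2P d12 d1x1 d1x2 d2x1 d2x2 VR1 VR2 v.
rewrite D1h D2h !scale0r !subr0 => flat.
have cB : {morph conn VR2 : u v / u - v}.
  by move=> u u'; rewrite cD (morphDN (@cD VR2)).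
rewrite /nablaq1 /nablaq2 cZ cB cZ flat !D2C.
rewrite (derV d2P sU) d2s d2t mulr0 rmorph0.
move: (conn VR2 (conn VR2 v)) (conn VR2 (conn VR1 v)) (conn VR2 v) => a b c.
by move: (conn VR1 v) => d; apply/rowP => i; rewrite !mxE; ring.
Qed.

Let K1N := morphDN nablaq1D.
Let K2N := morphDN nablaq2D.
Let K1c c v : dq1 c = 0 -> K1 (c *: v) = c *: K1 v.
Proof. by move=> c0; rewrite nablaq1Z c0 mulr0 scale0r add0r. Qed.
Let K2c c v : D VR2 c = 0 -> K2 (c *: v) = c *: K2 v.
Proof. by move=> c0; rewrite nablaq2Z c0 mulr0 scale0r add0r. Qed.

Let K1h (a : int) v : K1 (('X * a%:~R) *: v) = ('X * a%:~R) *: K1 v.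
Proof.
apply: K1c; rewrite (derM dq1_derivation) dq1X (der_int dq1_derivation).
by rewrite mul0r mulr0 addr0.
Qed.
Let K2h (a : int) v : K2 (('X * a%:~R) *: v) = ('X * a%:~R) *: K2 v.
Proof.
by apply: K2c; rewrite (derM (DP VR2)) D2h (der_int (DP VR2)) mul0r mulr0 addr0.
Qed.
Let K1p1 v : K1 (- p1 *: v) = ('X * p1) *: v - p1 *: K1 v.
Proof. by rewrite scaleNr K1N nablaq1Z dq1p1 mulrN scaleNr opprD opprK. Qed.
Let K2p2 v : K2 (- p2 *: v) = ('X * p2) *: v - p2 *: K2 v.
Proof. by rewrite scaleNr K2N nablaq2Z dq2p2 mulrN scaleNr opprD opprK. Qed.
Let K1p2 v : K1 (- p2 *: v) = - p2 *: K1 v.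
Proof. by rewrite scaleNr K1N K1c // scaleNr. Qed.
Let K2p1 v : K2 (- p1 *: v) = - p1 *: K2 v.
Proof. by rewrite scaleNr K2N K2c // scaleNr. Qed.

Local Notation X_ := (stepX 'X K1).
Local Notation Y_ := (stepY 'X K1 K2).
Local Notation Z_ := (stepZ p2 K2).
Local Notation P_ := (stepP p1 K1).
Local Notation e0 := (row4 (1 : P) 0 0 0).

Let sV1 : sV * (1 - 2%:R * T) = 1.
Proof.
have -> : 1 - 2%:R * T = S.
  by rewrite sE !(rmorphB, rmorphM, rmorph1, rmorph_nat).
by rewrite -rmorphM mulVr ?rmorph1.
Qed.
Let p11 : p1 * (T * (1 - T)) = 1.
Proof.
have -> : T * (1 - T) = Q1 by rewrite q1E !(rmorphB, rmorphM, rmorph1).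
by rewrite -rmorphM mulVr ?rmorph1.
Qed.
Let p21 : p2 * Q2 = 1. Proof. by rewrite -rmorphM mulVr ?rmorph1. Qed.
Let Q1E : Q1 = T * (1 - T).
Proof. by rewrite q1E !(rmorphM, rmorphB, rmorph1). Qed.
Let wP : x1%:P * x2%:P = T * Q2.
Proof. by rewrite -!rmorphM wE. Qed.
Let kP : x2%:P * (1 + x1%:P) = Q2.
Proof. by rewrite -[in RHS]kE !(rmorphM, rmorphD, rmorph1). Qed.
Let D1T : D VR1 T = Q1. Proof. by rewrite D1C d1t. Qed.
Let D2T : D VR2 T = 0. Proof. by rewrite D2C d2t rmorph0. Qed.
Let D1sV : D VR1 sV = 2%:R * Q1 * sV ^+ 2.
Proof.
rewrite D1C (derV d1P sU) d1s -exprVn -rmorphXn -(rmorph_nat polyC) -!rmorphM.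
by congr polyC; ring.
Qed.
Let D2sV : D VR2 sV = 0.
Proof. by rewrite D2C (derV d2P sU) d2s mulr0 rmorph0. Qed.

(** For [ring], [sV] and [p1] are independent of [T]; the multipliers [c1], [c2] certify an equation
    modulo their two defining relations. *)
Lemma eq_modulo c1 c2 (a b : P) :
  a - b = c1 * (sV * (1 - 2%:R * T) - 1) + c2 * (p1 * (T * (1 - T)) - 1) ->
  a = b.
Proof.
by move/eqP; rewrite sV1 p11 !subrr !mulr0 addr0 subr_eq0 => /eqP.
Qed.

Let D10 := der0 (DP VR1).
Let D11 := der1 (DP VR1).
Let D20 := der0 (DP VR2).
Let D21 := der1 (DP VR2).

Lemma conn1_e0 : conn VR1 e0 = row4 0 1 0 0.
Proof.
rewrite conn_row1 !row4E D10 D11; apply: row4P; rewrite !row4E; ring.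
Qed.

Lemma conn2_e0 : conn VR2 e0 = row4 0 0 1 0.
Proof.
rewrite conn_row2 !row4E D20 D21; apply: row4P; rewrite !row4E; ring.
Qed.

Lemma nablaq1_e0 : K1 e0 = row4 0 sV (- (T * sV)) 0.
Proof.
rewrite /nablaq1 conn1_e0 conn2_e0.
by apply: row4P; rewrite !coord4E; ring.
Qed.

Lemma stepY_e0 : Y_ 0 e0 = row4 0 (2%:R * sV) (- sV) 0.
Proof.
rewrite /stepY nablaq1_e0 /nablaq2 conn2_e0.
apply: row4P; rewrite !coord4E ?mulr0z; try ring.
by apply: (@eq_modulo 1 0); ring.
Qed.

Lemma nablaq2_stepY : K2 (row4 0 (2%:R * sV) (- sV) 0) = row4 (- Q2) 0 0 0.
Proof.
rewrite /nablaq2 conn_row2 !row4E D20 (derM (DP VR2)) (derN (DP VR2)) D2sV.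
rewrite (der_nat (DP VR2)) wP kP.
apply: row4P; rewrite !row4E; try ring.
by apply: (@eq_modulo (- Q2) 0); ring.
Qed.

(** It says K_2 (K_2 - 2 K_1) 1 = q_2. As K_2 - 2 K_1 = s^(-1) (nabla_2 - 2 nabla_1), this is the
    quantum relation for H o H. *)
Lemma stepZY_e0 : Z_ (Y_ 0 e0) = e0.
Proof.
rewrite stepY_e0 /stepZ nablaq2_stepY.
by apply: row4P; rewrite !coord4E -?p21; ring.
Qed.

Lemma nablaq1_stepY : K1 (row4 0 (2%:R * sV) (- sV) 0) =
  row4 (sV * (T * Q2 * sV + T * Q2)) (4%:R * 'X * Q1 * sV ^+ 3)
    (- 2%:R * 'X * Q1 * sV ^+ 3) (- sV ^+ 2).
Proof.
have := nablaq2_stepY; rewrite /nablaq1 /nablaq2 => ->.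
rewrite conn_row1 !row4E D10 (derM (DP VR1)) (derN (DP VR1)) D1sV.
rewrite (der_nat (DP VR1)) wP.
by apply: row4P; rewrite !coord4E; ring.
Qed.

Lemma nablaq1_nablaq1_e0 : K1 (row4 0 sV (- (T * sV)) 0) =
  row4 (sV ^+ 2 * (T * Q2) * (1 - T)) (2%:R * 'X * Q1 * sV ^+ 3)
    (- 'X * sV * (2%:R * Q1 * sV ^+ 2 * T + sV * Q1)) (- sV ^+ 2 * T - T * sV).
Proof.
rewrite /nablaq1 conn_row1 conn_row2 !row4E !(derN (DP _)) !(derM (DP _)).
rewrite D10 D20 D1sV D2sV D1T D2T wP kP.
apply: row4P; rewrite !coord4E; try ring.
by apply: (@eq_modulo (- sV * T) 0); ring.
Qed.

(** The left side is q_1^(-1) K_1^2 1, the theta terms cancelling; the identity is the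
    hypergeometric equation K_1^2 = q_1 (K_2 - 2 K_1)(K_2 - 2 K_1 - theta) applied to 1. *)
Lemma stepXP_e0 : X_ (- 1) (P_ e0) = Y_ 1 (Y_ 0 e0).
Proof.
rewrite stepY_e0 /stepX /stepP K1p1 nablaq1_e0 nablaq1_nablaq1_e0.
rewrite /stepY nablaq1_stepY nablaq2_stepY.
apply: row4P; rewrite !coord4E ?Q1E.
- by apply: (@eq_modulo (Q2 * (1 + sV)) (sV ^+ 2 * Q2)); ring.
- by apply: (@eq_modulo (2%:R * 'X * sV * (sV * (1 - 2%:R * T) + 1))
    (2%:R * 'X * sV ^+ 3)); ring.
- by apply: (@eq_modulo ('X * sV * (sV - sV * (1 - 2%:R * T) - 1))
    (- 'X * sV ^+ 2 * (2%:R * sV * T + 1))); ring.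
- by apply: (@eq_modulo (p1 * sV * T) (- 2%:R * sV ^+ 2)); ring.
Qed.

Lemma walk_exists : exists v : int -> int -> 'rV[P]_4, v 0 0 = e0 /\
  forall a b, [/\ X_ a (v a b) = v (a + 1) b, Y_ b (v a b) = v a (b + 1),
    Z_ (v a b) = v a (b - 1) & P_ (v a b) = v (a - 1) (b + 2)].
Proof.
apply: step_walk => //; [exact: nablaq1D|exact: nablaq2D|exact: nablaq_comm
  |exact: stepZY_e0|exact: stepXP_e0].
Qed.

Local Notation G := (brieskorn q1 q2).
Local Notation L := (lring P).
Local Notation cl := (cls q1 q2).
Local Notation theta := (cst 'X : L).
Local Notation U a b := (mono P a b).

Lemma term1_mono a b : term1 O * U a b = U (a + 1) b.
Proof. by rewrite /term1 monoM add0r addrC. Qed.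
Lemma term2_mono a b : term2 O * U a b = U a (b + 1).
Proof. by rewrite /term2 monoM add0r addrC. Qed.
Lemma term3_mono a b : term3 q1 * U a b = cst Q1 * U (a - 1) (b + 2).
Proof. by rewrite /term3 -mulrA monoM addrC [2 + b]addrC. Qed.
Lemma term4_mono a b : term4 q2 * U a b = cst Q2 * U a (b - 1).
Proof. by rewrite /term4 -mulrA monoM add0r addrC. Qed.

Lemma tw1_mono a b : tw1 q1 q2 (U a b) =
  cst ('X * a%:~R) * U a b - U (a + 1) b + cst Q1 * U (a - 1) (b + 2).
Proof.
rewrite tw1E lder1_mono mulrBl term1_mono term3_mono opprB.
by rewrite addrA addrAC mulrA rmorphM.
Qed.

Lemma tw2_mono a b :
  tw2 q1 q2 (U a b) = cst ('X * b%:~R) * U a b - U a (b + 1)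
    - 2%:R * (cst Q1 * U (a - 1) (b + 2)) + cst Q2 * U a (b - 1).
Proof.
rewrite tw2E lder2_mono !mulrBl mulrDl term2_mono -mulrA term3_mono term4_mono.
by rewrite rmorphM; ring.
Qed.

(** * The connection on four generators, deduced from its relations at the first one *)

Section Frame.
Variable V : lmodType P.

Definition gamma_of (g0 g1 g2 g3 : V) (a : 'rV[P]_4) : V :=
  \sum_i a 0 i *: nth 0 [:: g0; g1; g2; g3] i.

Lemma gamma_of_linear g0 g1 g2 g3 : linear (gamma_of g0 g1 g2 g3).
Proof.
move=> c a b; rewrite /gamma_of scaler_sumr -big_split; apply: eq_bigr => i _.
by rewrite rowDE rowZE scalerDl scalerA.
Qed.
HB.instance Definition _ g0 g1 g2 g3 := GRing.isLinear.Build P 'rV[P]_4 V _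
  (gamma_of g0 g1 g2 g3) (gamma_of_linear g0 g1 g2 g3).

Variables (b : vfield -> V -> V) (g0 g1 g2 g3 : V).
Local Notation gamma := (gamma_of g0 g1 g2 g3).
Local Notation w := (x1 * x2)%:P.
Local Notation z := (x2 * (1 - x1))%:P.
Hypothesis bD : forall X, {morph b X : x y / x + y}.
Hypothesis bZ : forall X c x, b X (c *: x) = ('X * D X c) *: x + c *: b X x.
Hypothesis b12 : forall x, b VR1 (b VR2 x) = b VR2 (b VR1 x).
Hypothesis bT1 : forall x,
  b VTheta (b VR1 x) = b VR1 (b VTheta x) + 'X *: b VR1 x.
Hypothesis bT2 : forall x,
  b VTheta (b VR2 x) = b VR2 (b VTheta x) + 'X *: b VR2 x.
Hypotheses (b1g0 : b VR1 g0 = g1) (b2g0 : b VR2 g0 = g2)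
  (b2g1 : b VR2 g1 = g3 + w *: g0).
Hypotheses (b11 : b VR1 g1 = w *: g0)
  (b22 : b VR2 g2 = 2%:R *: b VR1 g2 + z *: g0)
  (bT0 : b VTheta g0 = - 2%:R *: g2).

Let gammaZ c a : gamma (c *: a) = c *: gamma a.
Proof. exact: linearZ. Qed.
Let gammaD : {morph gamma : a b / a + b}.
Proof. exact: linearD. Qed.
Let gammaN : {morph gamma : a / - a}.
Proof. exact: linearN. Qed.

Lemma gamma_ofE a : gamma a =
  a 0 i0 *: g0 + a 0 i1 *: g1 + a 0 i2 *: g2 + a 0 i3 *: g3.
Proof. by rewrite /gamma_of sum4 !inordK. Qed.

Lemma gamma_of_g0 : g0 = gamma (row4 1 0 0 0).
Proof. by rewrite gamma_ofE !row4E !scale0r scale1r !addr0. Qed.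
Lemma gamma_of_g1 : g1 = gamma (row4 0 1 0 0).
Proof. by rewrite gamma_ofE !row4E !scale0r scale1r !addr0 add0r. Qed.
Lemma gamma_of_g2 : g2 = gamma (row4 0 0 1 0).
Proof. by rewrite gamma_ofE !row4E !scale0r scale1r !addr0 !add0r. Qed.
Lemma gamma_of_g3 : g3 = gamma (row4 0 0 0 1).
Proof. by rewrite gamma_ofE !row4E !scale0r scale1r !add0r. Qed.

(** Both sides are gathered into values of a generalized [gamma], leaving one ring identity per
    coordinate. *)
Ltac combine :=
  let F := fresh in let FZ := fresh in let FD := fresh in let FN := fresh in
  let E0 := fresh in let E1 := fresh in let E2 := fresh in let E3 := fresh in
  move: gammaZ gammaD gammaN gamma_of_g0 gamma_of_g1 gamma_of_g2 gamma_of_g3;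
  move: gamma;
  intros F FZ FD FN E0 E1 E2 E3; rewrite ?E0 ?E1 ?E2 ?E3 -?(FZ, FD, FN);
  congr F; apply: row4P; rewrite !coord4E.

Let D1w : D VR1 w = w.
Proof. by rewrite D1C (derM d1P) d1x1 d1x2 mulr0 addr0. Qed.
Let D2w : D VR2 w = w.
Proof. by rewrite D2C (derM d2P) d2x1 d2x2 mul0r add0r. Qed.
Let D1z : D VR1 z = - w.
Proof.
rewrite D1C (derM d1P) d1x2 (derB d1P) (der1 d1P) d1x1 -rmorphN.
by congr polyC; ring.
Qed.
Let DTw : D VTheta w = 0.
Proof. by rewrite /= derivC mulr0. Qed.
Let D1n n : D VR1 n%:R = 0. Proof. exact: der_nat (DP VR1) n. Qed.
Let D2n n : D VR2 n%:R = 0. Proof. exact: der_nat (DP VR2) n. Qed.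

Let bN X : {morph b X : x / - x} := morphDN (@bD X).

Let b1g2 : b VR1 g2 = g3 + w *: g0.
Proof. by rewrite -b2g0 b12 b1g0. Qed.

Let b22' : b VR2 g2 = 2%:R *: g3 + (2%:R * w + z) *: g0.
Proof. by rewrite b22 b1g2 scalerDr scalerA -addrA -scalerDl. Qed.

Let g3b : g3 = b VR2 g1 - w *: g0.
Proof. by rewrite b2g1 addrK. Qed.

(** By flatness the new term is nabla_2 (nabla_1 g_1) = nabla_2 (r_1 r_2 g_0), already known; the
    terms theta r_1 r_2 g_0 cancel. *)
Let b1g3 : b VR1 g3 = gamma (row4 0 (- w) w 0).
Proof.
rewrite {1}g3b bD bN bZ b12 b11 bZ D1w D2w b1g0 b2g0.
by combine; ring.
Qed.

Let b2g3 : b VR2 g3 = gamma (row4 0 z w 0).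
Proof.
(* Commuting nabla_1 past nabla_2^2 brings the known value of nabla_2 g_2 into play. *)
have e : b VR2 (b VR2 g1) = b VR1 (b VR2 g2) by rewrite -b1g0 -!b12 b2g0.
rewrite {1}g3b bD bN bZ e b22' bD !bZ b1g3 b1g0 b2g0 D2w.
rewrite (derD (DP VR1) _ z) (derM (DP VR1) _ w) !D1n D1w D1z.
by combine; ring.
Qed.

Let bTg1 : b VTheta g1 = gamma (row4 (- 2%:R * w) 'X 0 (- 2%:R)).
Proof.
rewrite -b1g0 bT1 bT0 bZ b1g2 b1g0 (derN (DP VR1)) D1n.
by combine; ring.
Qed.

Let bTg2 : b VTheta g2 = gamma (row4 (- 2%:R * (2%:R * w + z)) 0 'X (- 4%:R)).
Proof.
rewrite -b2g0 bT2 bT0 bZ b22' b2g0 (derN (DP VR2)) D2n.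
by combine; ring.
Qed.

Let bTg3 : b VTheta g3 =
  gamma (row4 0 (- 2%:R * z) (- 2%:R * w) (2%:R * 'X)).
Proof.
have e : b VTheta g1 = - 2%:R *: (g3 + w *: g0) + 'X *: g1.
  by rewrite -b1g0 bT1 bT0 bZ b1g2 b1g0 (derN (DP VR1)) D1n; combine; ring.
rewrite {1}g3b bD bN bZ bT2 e bT0 DTw !(bD, bZ) (derN (DP VR2)) D2n D2h D2w.
rewrite b2g1 b2g3 b2g0.
by combine; ring.
Qed.

Lemma gamma_of_conn X a : b X (gamma a) = gamma (conn X a).
Proof.
have wE' : w = x1%:P * x2%:P by rewrite rmorphM.
have zE' : z = x2%:P * (1 - x1%:P) by rewrite !(rmorphM, rmorphB, rmorph1).
rewrite [in LHS]gamma_ofE !bD !bZ; case: X.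
- by rewrite b1g0 b11 b1g2 b1g3 conn_row1; combine; rewrite wE'; ring.
- rewrite b2g0 b2g1 b22' b2g3 conn_row2; combine; rewrite ?wE' ?zE'; ring.
- rewrite bT0 bTg1 bTg2 bTg3 conn_rowT; combine; rewrite ?wE' ?zE'; ring.
Qed.

End Frame.

Definition bconn (X : vfield) : G -> G :=
  match X with
  | VR1 => gm_base d1
  | VR2 => gm_base d2
  | VTheta => @gm_theta O q1 q2
  end.

Lemma bconnD X : {morph bconn X : x y / x + y}.
Proof. by case: X; [exact: gm_baseD|exact: gm_baseD|exact: gm_thetaD]. Qed.

Lemma bconnZ X c x :
  bconn X (c *: x) = ('X * D X c) *: x + c *: bconn X x.
Proof.
case: X; [exact: gm_baseZ|exact: gm_baseZ|].
by rewrite /= gm_thetaZ expr2 mulrA.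
Qed.

Definition gen0 : G := cl 1.
Definition gen1 : G := bconn VR1 gen0.
Definition gen2 : G := bconn VR2 gen0.
(** The coordinates on the A-side refer to the classical basis, and f \cup H = H o f - r_1 r_2;
    hence the correction. *)
Definition gen3 : G := bconn VR2 gen1 - (x1 * x2)%:P *: gen0.
Local Notation gamma := (gamma_of gen0 gen1 gen2 gen3).

Lemma gamma_conn X a : bconn X (gamma a) = gamma (conn X a).
Proof.
apply: gamma_of_conn; [exact: bconnD|exact: bconnZ| | | | | | | | |].
- by move=> x; exact: gm_base_comm.
- exact: gm_theta_base.
- exact: gm_theta_base.
- exact: erefl.
- exact: erefl.
- by rewrite /gen3 subrK.
- by rewrite wE; exact: (gm_base11 d1P sE q1E d1q1 d1q2 d1t).
- by rewrite zE; exact: (gm_base22 d1P d2P sE d1q1 d1q2 d2q1 d2q2).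
rewrite [LHS]gm_theta1 [gen2](gm_base2 d2P d2q1 d2q2) scaleNr clsZ rmorph_nat.
by rewrite -(morphDN (@clsD O q1 q2)) mulrN opprK.
Qed.

Let D1P := lringmap_derivation (map_poly_derivation d1P).
Let D2P := lringmap_derivation (map_poly_derivation d2P).

Lemma lringmap_mono (d : O -> O) : derivation d -> forall a b,
  lringmap (map_poly d) (U a b) = 0.
Proof.
move=> dP a b; rewrite -[U a b]mul1r -(rmorph1 (@cst P)) -polyC1.
by rewrite (lringmap_coef dP) (der1 dP) !rmorph0 mul0r.
Qed.

Lemma twist1_mono a b :
  twist theta (pot q1 q2) (lringmap (map_poly d1)) (U a b) =
  - (cst (S * Q1) * U (a - 1) (b + 2) + cst (T * Q2) * U a (b - 1)).
Proof.
rewrite /twist lringmap_mono // (lringmap_pot d1P d1q1 d1q2) mulr0 sub0r.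
rewrite mulrDl -(mulrA _ (term3 q1)) -(mulrA _ (term4 q2)).
by rewrite term3_mono term4_mono !rmorphM !mulrA.
Qed.

Lemma twist2_mono a b :
  twist theta (pot q1 q2) (lringmap (map_poly d2)) (U a b) =
  - (cst Q2 * U a (b - 1)).
Proof.
have e1 : d2 q1 = 0 * q1 by rewrite mul0r.
have e2 : d2 q2 = 1 * q2 by rewrite mul1r.
rewrite /twist lringmap_mono // (lringmap_pot d2P e1 e2) mulr0 sub0r.
by rewrite !rmorph0 !rmorph1 mul0r add0r mul1r term4_mono.
Qed.

(** * The inverse of gamma, obtained from the walk on the A-side *)

Section Coordinates.
Variable v : int -> int -> 'rV[P]_4.
Hypothesis v00 : v 0 0 = e0.
Hypothesis vS : forall a b, [/\ X_ a (v a b) = v (a + 1) b,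
  Y_ b (v a b) = v a (b + 1), Z_ (v a b) = v a (b - 1) &
  P_ (v a b) = v (a - 1) (b + 2)].

Definition coord (f : L) : 'rV[P]_4 :=
  lsum (fun k c => c *: v k.1 k.2) (lval f).

Lemma coordD : {morph coord : f g / f + g}.
Proof.
move=> f g; rewrite /coord lvalD.
by apply: lsumD => k c c'; rewrite scalerDl.
Qed.

Lemma coord_monomial c a b : coord (cst c * U a b) = c *: v a b.
Proof. by rewrite /coord lval_monomial /monomial lsumU // scale0r. Qed.

Lemma coord_mono a b : coord (U a b) = v a b.
Proof. by have := coord_monomial 1 a b; rewrite rmorph1 mul1r scale1r. Qed.

Lemma coordZ c f : coord (cst c * f) = c *: coord f.
Proof.
move: f; apply: lring_ext => [f g|f g|c' a b].
- by rewrite mulrDr coordD.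
- by rewrite coordD scalerDr.
by rewrite mulrA -rmorphM !coord_monomial scalerA.
Qed.

Let coordN := morphDN coordD.
Let coord2 f : coord (2%:R * f) = 2%:R *: coord f.
Proof. by rewrite mulr_natl mulr2n coordD -mulr2n scaler_nat. Qed.

Let Q1p1 u : Q1 *: (- p1 *: u) = - u :> 'rV[P]_4.
Proof. by rewrite scalerA mulrN -rmorphM divrr // rmorph1 scaleN1r. Qed.
Let Q2p2 u : Q2 *: (- p2 *: u) = - u :> 'rV[P]_4.
Proof. by rewrite scalerA mulrN -rmorphM divrr // rmorph1 scaleN1r. Qed.

(** On a monomial this is the equation that [stepX] solves for v(a + 1, b). *)
Lemma coord_tw1 f : coord (tw1 q1 q2 f) = 0.
Proof.
have D1 := lder1_derivation P.
move: f; apply: lring_ext => [f g|f g|c a b]; rewrite ?addr0 //.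
  by rewrite [tw1 _ _ _](twistD _ _ D1) coordD.
rewrite [tw1 _ _ _](twistM _ _ D1) lder1_cst mulr0 mul0r add0r coordZ.
rewrite -[twist _ _ _ _]/(tw1 q1 q2 (U a b)) tw1_mono !coordD coordN.
rewrite !coord_monomial coord_mono.
have [<- _ _ <-] := vS a b; rewrite /stepX /stepP Q1p1.
move: (K1 (v a b)) (v a b) => u1 u; apply/rowP => i; rewrite !mxE; ring.
Qed.

Lemma coord_tw2 f : coord (tw2 q1 q2 f) = 0.
Proof.
have D2 := lder2_derivation P.
move: f; apply: lring_ext => [f g|f g|c a b]; rewrite ?addr0 //.
  by rewrite [tw2 _ _ _](twistD _ _ D2) coordD.
rewrite [tw2 _ _ _](twistM _ _ D2) lder2_cst mulr0 mul0r add0r coordZ.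
rewrite -[twist _ _ _ _]/(tw2 q1 q2 (U a b)) tw2_mono !coordD !coordN coord2.
rewrite !coord_monomial coord_mono.
have [_ <- <- <-] := vS a b; rewrite /stepY /stepP /stepZ Q1p1 Q2p2.
move: (K1 (v a b)) (K2 (v a b)) (v a b) => u1 u2 u.
by apply/rowP => i; rewrite !mxE; ring.
Qed.

Definition coord_cls (x : G) : 'rV[P]_4 := coord (LRing (modrepr x)).

Lemma coord_clsE f : coord_cls (cl f) = coord f.
Proof.
have /clsP [g1 [g2 e]] : cl (LRing (modrepr (cl f))) = cl f.
  exact: modreprK.
apply/eqP; rewrite -subr_eq0 -coordN -coordD e coordD coordN.
by rewrite coord_tw1 coord_tw2 subr0.
Qed.

Lemma coord_clsD : {morph coord_cls : x y / x + y}.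
Proof.
move=> x y; elim/cls_ind: x => f; elim/cls_ind: y => g.
by rewrite -clsD !coord_clsE coordD.
Qed.

Lemma coord_clsZ c x : coord_cls (c *: x) = c *: coord_cls x.
Proof. by elim/cls_ind: x => f; rewrite clsZ !coord_clsE coordZ. Qed.

Lemma coord_twist (d : O -> O) X : derivation d ->
  (forall c, D X c = map_poly d c) ->
  (forall a b, coord (twist theta (pot q1 q2) (lringmap (map_poly d)) (U a b)) =
     conn X (v a b)) ->
  forall f, coord (twist theta (pot q1 q2) (lringmap (map_poly d)) f) =
    conn X (coord f).
Proof.
move=> dP Dd H; have mP := map_poly_derivation dP.
have DL := lringmap_derivation mP.
apply: lring_ext => [f g|f g|c a b].
- by rewrite (twistD _ _ DL) coordD.
- by rewrite coordD cD.
rewrite (twistM _ _ DL) coordD !coordZ H coord_mono cZ Dd.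
by rewrite (lringmap_cst (derD mP)) -rmorphM coord_monomial.
Qed.

Let SsV : S * sV = 1. Proof. by rewrite -rmorphM divrr // rmorph1. Qed.

(** On a monomial, the coefficients s and t of r_1 d/dr_1 in the q coordinates recombine K_1 and K_2
    into [conn VR1]. *)
Lemma coord_bconn1 x : coord_cls (bconn VR1 x) = conn VR1 (coord_cls x).
Proof.
elim/cls_ind: x => f; rewrite /= gm_base_cls // !coord_clsE.
apply: coord_twist => // a b; rewrite twist1_mono coordN coordD !coord_monomial.
have [_ _ <- <-] := vS a b.
rewrite /stepZ /stepP -!scalerA Q1p1 Q2p2 /nablaq1 /nablaq2.
have := SsV; move: (conn VR1 (v a b)) (conn VR2 (v a b)) => u1 u2 h.
by rewrite !scalerN -opprD opprK scalerA h scale1r subrK.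
Qed.

Lemma coord_bconn2 x : coord_cls (bconn VR2 x) = conn VR2 (coord_cls x).
Proof.
elim/cls_ind: x => f; rewrite /= gm_base_cls // !coord_clsE.
apply: coord_twist => // a b; rewrite twist2_mono coordN coord_monomial.
by have [_ _ <- _] := vS a b; rewrite /stepZ Q2p2 opprK.
Qed.

(** [coord_cls] sends the class of 1 to [e0] and intertwines the connections, hence sends the four
    generators to the standard rows. *)
Lemma gammaK a : coord_cls (gamma a) = a.
Proof.
have e : coord_cls gen0 = e0 by rewrite coord_clsE -mono0 coord_mono.
have E1 : coord_cls gen1 = row4 0 1 0 0 by rewrite coord_bconn1 e conn1_e0.
have E2 : coord_cls gen2 = row4 0 0 1 0 by rewrite coord_bconn2 e conn2_e0.
have E3 : coord_cls gen3 = row4 0 0 0 1.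
  rewrite /gen3 -scaleNr coord_clsD coord_clsZ e coord_bconn2 E1 conn_row2.
  rewrite !row4E D20 D21 rmorphM; apply: row4P; rewrite !coord4E; ring.
rewrite gamma_ofE; move: e E1 E2 E3; move: gen0 gen1 gen2 gen3 => g0 g1 g2 g3.
rewrite !coord_clsD !coord_clsZ => -> -> -> ->.
by apply: row4P; rewrite !coord4E; ring.
Qed.

(** Both sides agree at (0, 0) and obey the same four recursions, on the right because [tw1] and
    [tw2] of a monomial have class 0. This makes [gamma] surjective. *)
Lemma gamma_walk a b : gamma (v a b) = cl (U a b).
Proof.
have gZ c u : gamma (c *: u) = c *: gamma u by exact: linearZ.
have gD u u' : gamma (u + u') = gamma u + gamma u' by exact: linearD.
have gN u : gamma (- u) = - gamma u by exact: linearN.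
have clN := morphDN (@clsD O q1 q2).
move: a b; apply: lattice_ind => [|a b IH].
  by rewrite v00 mono0 -gamma_of_g0.
have b2 : bconn VR2 (cl (U a b)) = - (Q2 *: cl (U a (b - 1))).
  by rewrite /= gm_base_cls // twist2_mono clN clsZ.
have b1 : bconn VR1 (cl (U a b)) =
    - (S *: (Q1 *: cl (U (a - 1) (b + 2))) + T *: (Q2 *: cl (U a (b - 1)))).
  by rewrite /= gm_base_cls // twist1_mono clN clsD !rmorphM -!mulrA !clsZ.
have gK2 : gamma (K2 (v a b)) = - (Q2 *: cl (U a (b - 1))).
  by rewrite /nablaq2 -gamma_conn IH b2.
have gK1 : gamma (K1 (v a b)) = - (Q1 *: cl (U (a - 1) (b + 2))).
  rewrite /nablaq1 gZ gD gN gZ -!gamma_conn IH b1 b2 scalerN opprK opprD addrNK.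
  by rewrite scalerN [sV *: _]scalerA [sV * S]mulrC SsV scale1r.
have tw1 : cl (U (a + 1) b) =
    ('X * a%:~R) *: cl (U a b) + Q1 *: cl (U (a - 1) (b + 2)).
  have := cls_tw1 q1 q2 (U a b); rewrite tw1_mono clsD clsB -!clsZ => h.
  by apply/esym/eqP; rewrite -subr_eq0 -h addrAC.
have tw2 : cl (U a (b + 1)) = ('X * b%:~R) *: cl (U a b)
    - 2%:R *: (Q1 *: cl (U (a - 1) (b + 2))) + Q2 *: cl (U a (b - 1)).
  have := cls_tw2 q1 q2 (U a b); rewrite tw2_mono clsD !clsB !clsZ rmorph_nat.
  move: (cl _) (cl _) (cl _) (cl _) => c1 c2 c3 c4 h.
  apply/esym/eqP; rewrite -subr_eq0 -h -!addrA; apply/eqP; congr (_ + _).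
  by rewrite [RHS]addrC -!addrA.
have [<- <- <- <-] := vS a b.
rewrite /stepX /stepY /stepZ /stepP; move: gK1 gK2.
move: (K1 (v a b)) (K2 (v a b)) => k1 k2 gk1 gk2.
split; rewrite !(gD, gN, gZ) ?gk1 ?gk2 ?IH.
- by rewrite opprK -tw1.
- by rewrite opprK scalerN -tw2.
- by rewrite scaleNr scalerN opprK scalerA p21 scale1r.
have p1Q1 : p1 * Q1 = 1 by rewrite -rmorphM mulVr ?rmorph1.
by rewrite scaleNr scalerN opprK scalerA p1Q1 scale1r.
Qed.

Lemma coord_clsK x : gamma (coord_cls x) = x.
Proof.
elim/cls_ind: x => f; rewrite coord_clsE.
have gD u u' : gamma (u + u') = gamma u + gamma u' by exact: linearD.
move: f; apply: lring_ext => [f g|f g|c a b]; first by rewrite coordD gD.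
  by rewrite clsD.
rewrite coord_monomial -clsZ -gamma_walk; exact: linearZ.
Qed.

End Coordinates.

Lemma gamma_inverse :
  exists gammaV : G -> 'rV[P]_4, cancel gamma gammaV /\ cancel gammaV gamma.
Proof.
have [v [v00 vS]] := walk_exists.
by exists (coord_cls v); split; [exact: gammaK|exact: coord_clsK].
Qed.

(** * Transport of the A-side structure along gamma *)

Section System.
Variables (V : lmodType P) (b : vfield -> V -> V) (gam : 'rV[P]_4 -> V)
  (gamV : V -> 'rV[P]_4) (eps : 'I_4 -> V).
Hypotheses (gamZ : forall c a, gam (c *: a) = c *: gam a)
  (gamD : {morph gam : a a' / a + a'}).
Hypotheses (gamK : cancel gam gamV) (gamVK : cancel gamV gam).
Hypothesis gam_conn : forall X a, b X (gam a) = gam (conn X a).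
Hypotheses (eps0E : eps i0 = gam (row4 1 0 0 0))
  (eps1E : eps i1 = gam (row4 0 0 (- 1) 0))
  (eps2E : eps i2 = gam (row4 0 0 0 1))
  (eps3E : eps i3 = gam (row4 0 1 0 0)).

Definition eps_gram (i j : 'I_4) : O :=
  match val i, val j with
  | 0, 2 | 2, 0 => 1
  | 1, 1 => 2%:R
  | 3, 1 | 1, 3 => - 1
  | _, _ => 0
  end.

Definition eps_pair (x y : V) : P :=
  \sum_i \sum_j coordinates eps x i * theta_conj (coordinates eps y j)
                * ((eps_gram i j)%:P * 'X^2).

Definition qds_eps : qds O := Qds eps b 2 eps_pair.

(** The basis epsilon_0, ..., epsilon_3 corresponds to 1, - H, f \cup H, f, which also explains the
    entries of [eps_gram]. *)
Definition eps_coord (a : 'rV[P]_4) (i : 'I_4) : P :=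
  nth 0 [:: a 0 i0; - a 0 i2; a 0 i3; a 0 i1] i.

Let gamN : {morph gam : a / - a} := morphDN gamD.
Lemma gam_inj : injective gam. Proof. exact: can_inj gamK. Qed.
Lemma gam_surj x : exists a, x = gam a. Proof. by exists (gamV x). Qed.

Lemma eps_sum (c : 'I_4 -> P) :
  \sum_i c i *: eps i = gam (row4 (c i0) (c i3) (- c i1) (c i2)).
Proof.
rewrite sum4 eps0E eps1E eps2E eps3E -!gamZ -!gamD; congr gam.
by apply: row4P; rewrite !coord4E; ring.
Qed.

Lemma gam_eps a : gam a = \sum_i eps_coord a i *: eps i.
Proof.
rewrite [RHS]eps_sum; congr gam.
by apply: row4P; rewrite row4E /eps_coord inordK //= opprK.
Qed.

Lemma eps_coord_uniq a (c : 'I_4 -> P) : gam a = \sum_i c i *: eps i ->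
  forall i, c i = eps_coord a i.
Proof.
move=> e; have {e}-> := gam_inj (etrans e (eps_sum c)).
by apply: ord4P; rewrite /eps_coord inordK //= row4E ?opprK.
Qed.

(** [coordinates] picks some expansion by choice; injectivity of [gam] makes the expansion
    unique. *)
Lemma coordinates_gam a i : coordinates eps (gam a) i = eps_coord a i.
Proof.
rewrite /coordinates; case: pselect => [h|[]]; last first.
  by exists (eps_coord a); exact: gam_eps.
by case: cid => c /= e; apply: eps_coord_uniq.
Qed.

Lemma eps_pair_gam a a' : eps_pair (gam a) (gam a') = pair_row a a'.
Proof.
rewrite /eps_pair sum4 !sum4 !coordinates_gam /eps_coord /eps_gram /=.
rewrite !inordK //=.
rewrite /pair_row poincareE !map_row_E !theta_conjN.
by rewrite !(rmorphN, rmorph1, rmorph0, rmorph_nat); ring.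
Qed.

Definition eps_const (j i : 'I_4) : O :=
  nth 0 (nth [::] [:: [:: 1; 0; 0; 0]; [:: 0; 0; - 1; 0]; [:: 0; 0; 0; 1];
                      [:: 0; 1; 0; 0]] j) i.

Lemma eps_constE j : eps j = gam (\row_i (eps_const j i)%:P).
Proof.
move: j; apply: ord4P; rewrite ?eps0E ?eps1E ?eps2E ?eps3E;
  congr gam; apply: row4P;
  by rewrite row4E mxE /eps_const !inordK //= ?rmorphN ?rmorph1 ?rmorph0.
Qed.

Lemma vact_eps_const X j i : D X (eps_const j i)%:P = 0.
Proof.
move: j i; apply: ord4P; apply: ord4P; rewrite /eps_const !inordK //=;
  rewrite ?rmorphN ?rmorph1 ?rmorph0 ?(derN (DP X)) ?(der0 (DP X));
  by rewrite ?(der1 (DP X)) ?oppr0.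
Qed.

Lemma bconn_eps_poles X j : exists u v : 'I_4 -> O,
  b X (eps j) = \sum_i ((u i)%:P + (v i)%:P * 'X) *: eps i.
Proof.
rewrite eps_constE gam_conn gam_eps; set r := conn X _.
have H : forall i, affine (r 0 i).
  by apply: conn_row_const => // i; exact: vact_eps_const.
exists (fun i => (eps_coord r i)`_0), (fun i => (eps_coord r i)`_1).
apply: eq_bigr => i _; congr (_ *: _); apply: affineE; move: i.
apply: ord4P; rewrite /eps_coord !inordK //=.
(* Only the H-coordinate enters [eps_coord] with a sign, so it alone needs new witnesses. *)
have [u [v ->]] := H i2; exists (- u), (- v).
by rewrite !rmorphN /= mulNr opprD.
Qed.

Lemma eps_pair_nondegenerate : exists2 M : 'M[O]_4, M \in unitmx &
  forall i j, eps_pair (eps i) (eps j) = (M i j)%:P * 'X^2.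
Proof.
exists (\matrix_(i, j) eps_gram i j).
  (* The second matrix is the inverse: the block of epsilon_1, epsilon_3 is (2, - 1; - 1, 0), with
     inverse (0, - 1; - 1, - 2). *)
  apply: (proj1 (mulmx1_unit (B := \matrix_(i, j) nth 0 (nth [::]
    [:: [:: 0; 0; 1; 0]; [:: 0; 0; 0; - 1]; [:: 1; 0; 0; 0];
        [:: 0; - 1; 0; - 2%:R]] (i : 'I_4)) (j : 'I_4)) _)).
  apply/matrixP => i j; rewrite !mxE sum4 !mxE /eps_gram /= !inordK //.
  move: i j; apply: ord4P; apply: ord4P; rewrite -!val_eqE /= !inordK //=;
    ring.
apply: ord4P; apply: ord4P; rewrite /= ?eps0E ?eps1E ?eps2E ?eps3E;
  rewrite eps_pair_gam /pair_row poincareE !map_row_E !row4E;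
  rewrite ?theta_conjN ?theta_conj1 ?theta_conj0 mxE /eps_gram /= !inordK //=;
  by rewrite ?rmorphN ?rmorph1 ?rmorph0 ?rmorph_nat; ring.
Qed.

Lemma qds_epsP : is_qds d1 d2 qds_eps.
Proof.
split.
- move=> x; have [a ->] := gam_surj x.
  exists [ffun i => eps_coord a i]; split.
    by rewrite [LHS]gam_eps; apply: eq_bigr => i _; rewrite ffunE.
  by move=> c e; apply/ffunP => i; rewrite ffunE -(eps_coord_uniq e).
- move=> X x y; have [a ->] := gam_surj x; have [a' ->] := gam_surj y.
  by rewrite /= -gamD !gam_conn -gamD; congr gam; exact: cD.
- move=> X c x; have [a ->] := gam_surj x.
  by rewrite /= -gamZ !gam_conn -!gamZ -gamD; congr gam; exact: cZ.
- exact: bconn_eps_poles.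
- move=> X Y x; have [a ->] := gam_surj x.
  rewrite /= !gam_conn -!gamZ -!gamN -!gamD; congr gam.
  exact: (conn_row_flat d1P d2P d12 d1x1 d1x2 d2x1 d2x2).
- move=> c x y z; have [a ->] := gam_surj x; have [a2 ->] := gam_surj y.
  have [a' ->] := gam_surj z.
  by rewrite /= -gamZ -gamD !eps_pair_gam; exact: pair_row_linear.
- move=> c x y z; have [a ->] := gam_surj x; have [a2 ->] := gam_surj y.
  have [a' ->] := gam_surj z.
  by rewrite /= -gamZ -gamD !eps_pair_gam; exact: pair_row_conjlinear.
- exact: eps_pair_nondegenerate.
- move=> X x y; have [a ->] := gam_surj x; have [a2 ->] := gam_surj y.
  rewrite /= !gam_conn !eps_pair_gam.
  exact: (pair_row_flat x1 x2 d1P d2P).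
Qed.

Variables (C : comNzRingType) (scal : {rmorphism C -> O}).
Hypotheses (d1scal : forall c, d1 (scal c) = 0)
  (d2scal : forall c, d2 (scal c) = 0).
Hypothesis gam_linear : exists gl : {linear 'rV[P]_4 -> V}, gl =1 gam.

Local Notation QA := (qds_row d1 d2 x1 x2).
Local Notation QB := qds_eps.
Local Notation qp := (qprod x1%:P x2%:P).
Local Notation const c := (map_mx (fun z => (scal z)%:P) c : 'rV[P]_4).

Definition mirror_spec (g : 'rV[P]_4 -> V) :=
  [/\ g (c1 P) = eps i0, g (cf P) = b VR1 (eps i0), g (cH P) = b VR2 (eps i0) &
      g (qp (cH P) (cf P)) = b VR2 (b VR1 (eps i0))].

Let w := (x1%:P * x2%:P : P).

Let conn2_f : conn VR2 (row4 0 1 0 0) = row4 w 0 0 1.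
Proof.
rewrite conn_row2 !row4E D20 D21.
by apply: row4P; rewrite !row4E /w; ring.
Qed.

Let qpHf : qp (cH P) (cf P) = row4 w 0 0 1.
Proof.
rewrite qprod_cH /cf !delta4 !row4E.
by apply: row4P; rewrite !row4E /w; ring.
Qed.

Lemma mirror_spec_gam : mirror_spec gam.
Proof.
rewrite /mirror_spec qpHf /c1 /cf /cH !delta4 eps0E.
by rewrite !gam_conn conn1_e0 conn2_e0 conn2_f.
Qed.

Lemma mirror_spec_uniq (g : {linear 'rV[P]_4 -> V}) : mirror_spec g -> g =1 gam.
Proof.
have [m0 m1 m2 m3] := mirror_spec_gam; case=> h0 h1 h2 h3.
move: (etrans h0 (esym m0)) (etrans h1 (esym m1)) (etrans h2 (esym m2)).
move: (etrans h3 (esym m3)) => {m0 m1 m2 m3 h0 h1 h2 h3}.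
rewrite qpHf /c1 /cf /cH !delta4 => e3 e0' e1 e2 a.
(* The specification prescribes values on 1, f, H and H o f = f \cup H + r_1 r_2, a triangular
   change of the standard basis. *)
have -> : a = (a 0 i0 - a 0 i3 * w) *: row4 1 0 0 0 + a 0 i1 *: row4 0 1 0 0
    + a 0 i2 *: row4 0 0 1 0 + a 0 i3 *: row4 w 0 0 1.
  by apply: row4P; rewrite !coord4E; ring.
by rewrite !linearD !linearZ /= e0' e1 e2 e3 !gamD !gamZ.
Qed.

Lemma global_rowP (x : 'rV[P]_4) :
  is_global (Q := QA) x <-> forall i, exists u, x 0 i = u%:P.
Proof.
split=> [[c ->] i|h].
  exists (c i); rewrite summxE (bigD1 i) //= big1 => [|j /negPf ji].
    by rewrite addr0 !mxE !eqxx mulr1.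
  by rewrite !mxE eq_sym ji andbF mulr0.
exists (fun i => projT1 (cid (h i))); rewrite [LHS]row_sum_delta.
by apply: eq_bigr => i _; case: cid => u /= ->.
Qed.

Lemma global_gam (x : 'rV[P]_4) :
  is_global (Q := QB) (gam x) <-> is_global (Q := QA) x.
Proof.
rewrite global_rowP; split=> [[c e]|h].
  have {e}-> := gam_inj (etrans e (eps_sum _)).
  apply: ord4P; rewrite row4E; try by eexists.
  by exists (- c i1); rewrite rmorphN.
have [[u0 e0'] [u1 e1] [u2 e2] [u3 e3]] := And4 (h i0) (h i1) (h i2) (h i3).
exists (fun i => nth 0 [:: u0; - u2; u3; u1] i); rewrite [LHS]gam_eps.
apply: eq_bigr => i _; congr (_ *: _); rewrite /eps_coord e0' e1 e2 e3.
by move: i; apply: ord4P; rewrite !inordK //= rmorphN.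
Qed.

Lemma conn_const1 (c : 'rV[C]_4) : conn VR1 (const c) = qp (cf P) (const c).
Proof.
rewrite conn_row1 qprod_cf !map_row_E !D1C !d1scal rmorph0.
by apply: row4P; rewrite !row4E; ring.
Qed.

Lemma conn_const2 (c : 'rV[C]_4) : conn VR2 (const c) = qp (cH P) (const c).
Proof.
rewrite conn_row2 qprod_cH !map_row_E !D2C !d2scal rmorph0.
by apply: row4P; rewrite !row4E; ring.
Qed.

Lemma global_const1 (c : 'rV[C]_4) : is_global (Q := QA) (qp (cf P) (const c)).
Proof.
apply/global_rowP; apply: ord4P; rewrite qprod_cf row4E !map_row_E;
  eexists; rewrite -?(rmorphM, rmorphD, rmorphB); exact: erefl.
Qed.

Lemma global_const2 (c : 'rV[C]_4) : is_global (Q := QA) (qp (cH P) (const c)).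
Proof.
apply/global_rowP; apply: ord4P;
  rewrite qprod_cH row4E !map_row_E -1?(rmorph1 polyC) -1?(rmorph_nat polyC);
  eexists; rewrite -?(rmorphM, rmorphD, rmorphB); exact: erefl.
Qed.

Theorem mirror : [/\ is_qds d1 d2 QA, is_qds d1 d2 QB,
  exists g : {linear QA -> QB}, mirror_spec g &
  forall g : {linear QA -> QB}, mirror_spec g ->
  [/\ is_qds_isomorphism g,
      exists gV : QB -> QA, [/\ cancel g gV, cancel gV g &
        forall c : 'rV[C]_4,
          (exists2 y : QB, at_theta0 (Q := QB) (qconn VR1 (g (const c))) y
             & qp (cf P) (const c) = gV y) /\
          (exists2 y : QB, at_theta0 (Q := QB) (qconn VR2 (g (const c))) y
             & qp (cH P) (const c) = gV y)] &
      forall a a' : 'rV[C]_4, qpair (q := QB) (g (const a)) (g (const a')) =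
        (scal (poincare a a'))%:P * 'X^2]].
Proof.
split; [exact: qds_rowP|exact: qds_epsP| |].
  have [gl glE] := gam_linear; exists gl.
  by have := mirror_spec_gam; rewrite /mirror_spec -!glE.
move=> g gS; have gE := mirror_spec_uniq gS.
(* For a constant class, theta nabla contains no theta term, so the section is already its own
   restriction to theta = 0 and the remainder is 0. *)
have at0 X u y : conn X u = y -> is_global (Q := QA) y ->
    at_theta0 (Q := QB) (b X (g u)) (gam y).
  move=> uy yG; split; first exact/global_gam.
  by exists 0; rewrite scaler0 addr0 gE gam_conn uy.
split.
- split=> [|x|X x|x y].
  + by exists gamV => x; [rewrite gE gamK|rewrite gE gamVK].
  + by rewrite gE; exact: global_gam.
  + by rewrite !gE; exact: esym (gam_conn X x).
  + by rewrite !gE; exact: eps_pair_gam.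
- exists gamV; split=> [x|x|c]; [by rewrite gE gamK|by rewrite gE gamVK|].
  split.
    exists (gam (qp (cf P) (const c))); last by rewrite gamK.
    by apply: at0; [exact: conn_const1|exact: global_const1].
  exists (gam (qp (cH P) (const c))); last by rewrite gamK.
  by apply: at0; [exact: conn_const2|exact: global_const2].
move=> a a'; rewrite !gE [LHS]eps_pair_gam /pair_row !poincareE !map_row_E.
rewrite !theta_conjC; congr (_ * _).
by rewrite !(rmorphD, rmorphM, rmorph_nat).
Qed.

End System.

Lemma gen1E : gen1 = cl (- (cst S * term3 q1 + cst T * term4 q2)).
Proof. exact: gm_base1. Qed.

Lemma gen2E : gen2 = cl (- term4 q2).
Proof. exact: gm_base2. Qed.

Lemma gen3E : gen3 = cl (term4 q2 * term3 q1).
Proof.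
have e : bconn VR2 gen1 = gm_base d1 (gm_base d2 (cl 1)).
  exact: gm_base_comm d2P d1P (fun x => esym (d12 x)) (cl 1).
by rewrite /gen3 e wE; exact: gm_base12 d1P d2P sE d1q1 d1q2 d2q1 d2q2.
Qed.

Section Epsilon.
Variables (C : comNzRingType) (scal : {rmorphism C -> O}) (eps : 'I_4 -> G).
Hypotheses (d1scal : forall c, d1 (scal c) = 0)
  (d2scal : forall c, d2 (scal c) = 0).
Hypotheses (eps0E : eps i0 = cl 1) (eps1E : eps i1 = cl (term4 q2))
  (eps2E : eps i2 = cl (term4 q2 * term3 q1))
  (eps3E : eps i3 = - S *: cl (term3 q1) - T *: cl (term4 q2)).
Local Notation QA := (qds_row d1 d2 x1 x2).
Local Notation QB := (qds_eps bconn eps).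
Local Notation qp := (qprod x1%:P x2%:P).
Local Notation const c := (map_mx (fun z => (scal z)%:P) c : 'rV[P]_4).

Theorem brieskorn_mirror : [/\ is_qds d1 d2 QA, is_qds d1 d2 QB,
  exists g : {linear QA -> QB}, mirror_spec bconn eps g &
  forall g : {linear QA -> QB}, mirror_spec bconn eps g ->
  [/\ is_qds_isomorphism g,
      exists gV : QB -> QA, [/\ cancel g gV, cancel gV g &
        forall c : 'rV[C]_4,
          (exists2 y : QB, at_theta0 (Q := QB) (qconn VR1 (g (const c))) y
             & qp (cf P) (const c) = gV y) /\
          (exists2 y : QB, at_theta0 (Q := QB) (qconn VR2 (g (const c))) y
             & qp (cH P) (const c) = gV y)] &
      forall a a' : 'rV[C]_4, qpair (q := QB) (g (const a)) (g (const a')) =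
        (scal (poincare a a'))%:P * 'X^2]].
Proof.
have [gV [gK gVK]] := gamma_inverse.
have clN := morphDN (@clsD O q1 q2).
apply: (mirror (gam := gamma) (gamV := gV)) => //.
- by move=> c a; exact: linearZ.
- by move=> a a'; exact: linearD.
- exact: gamma_conn.
- by rewrite -[gamma _]gamma_of_g0.
- have -> : row4 0 0 (- 1) 0 = - row4 0 0 1 0 :> 'rV[P]_4.
    by apply: row4P; rewrite !coord4E ?oppr0.
  have -> : gamma (- row4 0 0 1 0) = - gamma (row4 0 0 1 0) by exact: linearN.
  by rewrite eps1E -[gamma _]gamma_of_g2 gen2E clN opprK.
- by rewrite eps2E -[gamma _]gamma_of_g3 gen3E.
- rewrite eps3E -[gamma _]gamma_of_g1 gen1E clN clsD opprD scaleNr.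
  by rewrite !clsZ.
by exists gamma.
Qed.

End Epsilon.

End Mirror.

(** * The coordinates r_1, r_2 *)

Lemma scaled_derivation (A : comPzRingType) (c : A) (d : A -> A) :
  derivation d -> derivation (fun x => c * d x).
Proof. by move=> dP; split=> x y; rewrite ?(derD dP) ?(derM dP); ring. Qed.

Lemma scaled_comm (A : comPzRingType) (a b : A) (d e : A -> A) :
  derivation d -> derivation e -> d b = 0 -> e a = 0 ->
  (forall x, d (e x) = e (d x)) ->
  forall x, a * d (b * e x) = b * e (a * d x).
Proof.
move=> dP eP db ea de x; rewrite (derM dP) (derM eP) db ea de.
by rewrite !mul0r !add0r mulrCA.
Qed.

Section Coordinates.
Variables (K : fieldType) (s : {mpoly K[2]}).
Hypothesis s0 : s != 0.

Lemma partial_coordinate (i j : 'I_2) :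
  partial i (coordinate s j) = (i == j)%:R.
Proof.
rewrite /coordinate (partial_of_mpoly s0) mderivX mnm1E eq_sym.
case: eqP => [->|_]; last by rewrite scale0r rmorph0.
have -> : (U_(j) - U_(j) = 0 :> 'X_{1..2})%MM.
  by apply/mnmP => k; rewrite mnmBE subnn mnm0E.
by rewrite mpolyX0 scale1r rmorph1.
Qed.

Lemma partial_constant (i : 'I_2) c : partial i (Defs.constant s c) = 0.
Proof. by rewrite /Defs.constant (partial_of_mpoly s0) mderivC rmorph0. Qed.

End Coordinates.

Section Substitution.
Variables (A : comUnitRingType) (x1 x2 : A) (d1 d2 : A -> A).
Hypotheses (d1P : derivation d1) (d2P : derivation d2).
Hypotheses (d1x1 : d1 x1 = x1) (d1x2 : d1 x2 = 0)
  (d2x1 : d2 x1 = 0) (d2x2 : d2 x2 = x2).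
Hypothesis yU : 1 + x1 \is a GRing.unit.
Local Notation t := (x1 / (1 + x1)).
Local Notation s := ((1 - x1) / (1 + x1)).
Local Notation q1 := (x1 / (1 + x1) ^+ 2).
Local Notation q2 := (x2 * (1 + x1)).

Let eq_mod c a b : a - b = c * ((1 + x1)^-1 * (1 + x1) - 1) -> a = b.
Proof. by move/eqP; rewrite mulVr // subrr mulr0 subr_eq0 => /eqP. Qed.

Lemma subst_s : s = 1 - 2%:R * t.
Proof. by apply: (@eq_mod 1); ring. Qed.
Lemma subst_q1 : q1 = t * (1 - t).
Proof. by rewrite -exprVn; apply: (@eq_mod (x1 * (1 + x1)^-1)); ring. Qed.
Lemma subst_w : x1 * x2 = t * q2.
Proof. by apply: (@eq_mod (- x1 * x2)); ring. Qed.
Lemma subst_z : x2 * (1 - x1) = s * q2.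
Proof. by apply: (@eq_mod (- x2 * (1 - x1))); ring. Qed.
Lemma subst_4q1 : 4%:R * q1 - 1 = - s ^+ 2.
Proof. by rewrite subst_q1 subst_s; ring. Qed.

Let d1y : d1 (1 + x1) = x1.
Proof. by rewrite (derD d1P) (der1 d1P) d1x1 add0r. Qed.
Let d2y : d2 (1 + x1) = 0.
Proof. by rewrite (derD d2P) (der1 d2P) d2x1 add0r. Qed.

Lemma subst_d1t : d1 t = q1.
Proof. by rewrite (der_divr _ d1P yU) d1y d1x1 subst_q1; ring. Qed.
Lemma subst_d2t : d2 t = 0.
Proof. by rewrite (der_divr _ d2P yU) d2y d2x1; ring. Qed.
Lemma subst_d1q1 : d1 q1 = s * q1.
Proof.
rewrite {1}subst_q1 (derM d1P) (derB d1P) (der1 d1P) subst_d1t subst_s subst_q1.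
by ring.
Qed.
Lemma subst_d2q1 : d2 q1 = 0.
Proof.
by rewrite subst_q1 (derM d2P) (derB d2P) (der1 d2P) subst_d2t; ring.
Qed.
Lemma subst_d1q2 : d1 q2 = t * q2.
Proof. by rewrite (derM d1P) d1y d1x2 mul0r add0r mulrC subst_w. Qed.
Lemma subst_d2q2 : d2 q2 = q2.
Proof. by rewrite (derM d2P) d2y d2x2 mulr0 addr0. Qed.

End Substitution.

Section Instance.
Variable R : realType.
Local Notation C := (complex R).
Local Notation O := (OMt R).
Local Notation r1 := (r1 R).
Local Notation r2 := (r2 R).
Local Notation X0 := ('X_ord0 : {mpoly C[2]}).
Local Notation X1 := ('X_ord_max : {mpoly C[2]}).

Lemma mpoly2_neq0 (p : {mpoly C[2]}) (v : 'I_2 -> C) : p.@[v] != 0 -> p != 0.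
Proof. by apply: contraNN => /eqP ->; rewrite meval0. Qed.

Lemma M_locus_neq0 : M_locus R != 0.
Proof.
apply: (@mpoly2_neq0 _ (fun=> 1)).
rewrite /M_locus !mevalM mevalB mevalZ !mevalXU meval1 !mulr1 mul1r.
by rewrite subr_eq0 -[1]/(1%:R) Num.Theory.eqr_nat.
Qed.

Lemma Mt_locus_neq0 : Mt_locus R != 0.
Proof.
apply: (@mpoly2_neq0 _ (fun=> 2%:R)).
rewrite /Mt_locus !mevalM mevalB mevalD !mevalXU meval1.
rewrite !mulf_neq0 ?Num.Theory.pnatr_eq0 //.
  by rewrite subr_eq0 -[1]/(1%:R) Num.Theory.eqr_nat.
by rewrite natr1 Num.Theory.pnatr_eq0.
Qed.

Let Mt0 := Mt_locus_neq0.

Lemma r1d1_derivation : derivation (@r1d1 R).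
Proof. exact: scaled_derivation (partial_derivation Mt0 _). Qed.
Lemma r2d2_derivation : derivation (@r2d2 R).
Proof. exact: scaled_derivation (partial_derivation Mt0 _). Qed.
Lemma q1d1_derivation : derivation (@q1d1 R).
Proof. exact: scaled_derivation (partial_derivation M_locus_neq0 _). Qed.
Lemma q2d2_derivation : derivation (@q2d2 R).
Proof. exact: scaled_derivation (partial_derivation M_locus_neq0 _). Qed.

Lemma r1d1_r1 : r1d1 r1 = r1.
Proof. by rewrite /r1d1 (partial_coordinate Mt0) eqxx mulr1. Qed.
Lemma r1d1_r2 : r1d1 r2 = 0.
Proof. by rewrite /r1d1 (partial_coordinate Mt0) mulr0. Qed.
Lemma r2d2_r1 : r2d2 r1 = 0.
Proof. by rewrite /r2d2 (partial_coordinate Mt0) mulr0. Qed.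
Lemma r2d2_r2 : r2d2 r2 = r2.
Proof. by rewrite /r2d2 (partial_coordinate Mt0) eqxx mulr1. Qed.

Lemma r_comm x : r1d1 (r2d2 x) = r2d2 (r1d1 x) :> O.
Proof.
apply: (@scaled_comm O r1 r2 (partial ord0) (partial ord_max)).
- exact: partial_derivation.
- exact: partial_derivation.
- exact: (partial_coordinate Mt0 ord0 ord_max).
- exact: (partial_coordinate Mt0 ord_max ord0).
- exact: (partial_comm Mt0 ord0 ord_max).
Qed.

Lemma q1d1_q : (q1d1 (q1 R) = q1 R) * (q1d1 (q2 R) = 0).
Proof.
by rewrite /q1d1 !(partial_coordinate M_locus_neq0) eqxx mulr1 mulr0.
Qed.
Lemma q2d2_q : (q2d2 (q1 R) = 0) * (q2d2 (q2 R) = q2 R).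
Proof.
by rewrite /q2d2 !(partial_coordinate M_locus_neq0) eqxx mulr1 mulr0.
Qed.

Lemma scal_zmod_morphism : zmod_morphism (@scal R).
Proof. by move=> a b; rewrite /scal /Defs.constant -!rmorphB. Qed.
Lemma scal_monoid_morphism : monoid_morphism (@scal R).
Proof. split=> [|a b]; rewrite /scal /Defs.constant; first by rewrite !rmorph1.
by rewrite !rmorphM. Qed.
HB.instance Definition _ := GRing.isZmodMorphism.Build C O (@scal R)
  scal_zmod_morphism.
HB.instance Definition _ := GRing.isMonoidMorphism.Build C O (@scal R)
  scal_monoid_morphism.

Lemma r1d1_scal c : r1d1 (scal c) = 0 :> O.
Proof. by rewrite /r1d1 (partial_constant Mt0) mulr0. Qed.
Lemma r2d2_scal c : r2d2 (scal c) = 0 :> O.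
Proof. by rewrite /r2d2 (partial_constant Mt0) mulr0. Qed.

Lemma r1_unit : r1 \is a GRing.unit.
Proof.
apply: (of_mpoly_unit Mt0 (q := X1 * (X0 - 1) * (X0 + 1))).
by rewrite /Mt_locus !mulrA.
Qed.
Lemma r2_unit : r2 \is a GRing.unit.
Proof.
apply: (of_mpoly_unit Mt0 (q := X0 * (X0 - 1) * (X0 + 1))).
by rewrite /Mt_locus !mulrA [X1 * X0]mulrC.
Qed.
Lemma r1D1_unit : 1 + r1 \is a GRing.unit.
Proof.
have -> : 1 + r1 = of_mpoly (Mt_locus R) (X0 + 1).
  by rewrite rmorphD rmorph1 addrC.
apply: (of_mpoly_unit Mt0 (q := X0 * X1 * (X0 - 1))).
by rewrite /Mt_locus mulrC.
Qed.
Lemma r1B1_unit : 1 - r1 \is a GRing.unit.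
Proof.
have -> : 1 - r1 = - of_mpoly (Mt_locus R) (X0 - 1).
  by rewrite rmorphB rmorph1 opprB.
rewrite unitrN; apply: (of_mpoly_unit Mt0 (q := X0 * X1 * (X0 + 1))).
by rewrite /Mt_locus [RHS]mulrAC mulrC.
Qed.

Local Notation t := (r1 / (1 + r1)).
Local Notation s := ((1 - r1) / (1 + r1)).

Let s_unit : s \is a GRing.unit.
Proof. by rewrite unitrM unitrV r1B1_unit r1D1_unit. Qed.

Lemma coord_change0 : coord_change R ord0 = r1 / (1 + r1) ^+ 2.
Proof. by []. Qed.
Lemma coord_change1 : coord_change R ord_max = r2 * (1 + r1).
Proof. by []. Qed.

Lemma q1_unit : r1 / (1 + r1) ^+ 2 \is a GRing.unit.
Proof. by rewrite unitrM unitrV r1_unit unitrX // r1D1_unit. Qed.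
Lemma q2_unit : r2 * (1 + r1) \is a GRing.unit.
Proof. by rewrite unitrM r2_unit r1D1_unit. Qed.

Lemma mmap_coord (i : 'I_2) :
  mmap (@scal R) (@coord_change R) ('X_i) = coord_change R i.
Proof. by rewrite mmapX mmap1U. Qed.

(** The change of coordinates lands in M: 4 q_1 - 1 becomes - s^2, invertible because r_1 <> 1. This
    is what makes [nu] a ring morphism. *)
Lemma mmap_M_locus_unit :
  mmap (@scal R) (@coord_change R) (M_locus R) \is a GRing.unit.
Proof.
rewrite /M_locus !rmorphM /= rmorphB rmorph1 /= mmapZ !mmap_coord rmorph_nat.
rewrite coord_change0 coord_change1 (subst_4q1 r1D1_unit).
by rewrite unitrM unitrN unitrX ?s_unit // andbT unitrM q1_unit q2_unit.
Qed.

Lemma nu_zmod_morphism : zmod_morphism (@nu R).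
Proof. exact: (regular_comp_zmod_morphism mmap_M_locus_unit). Qed.
Lemma nu_monoid_morphism : monoid_morphism (@nu R).
Proof. exact: (regular_comp_monoid_morphism mmap_M_locus_unit). Qed.
HB.instance Definition _ := GRing.isZmodMorphism.Build (OM R) O (@nu R)
  nu_zmod_morphism.
HB.instance Definition _ := GRing.isMonoidMorphism.Build (OM R) O (@nu R)
  nu_monoid_morphism.

Lemma nu_q1 : nu (q1 R) = r1 / (1 + r1) ^+ 2.
Proof.
rewrite /nu (regular_comp_of_mpoly mmap_M_locus_unit).
exact: mmap_coord.
Qed.
Lemma nu_q2 : nu (q2 R) = r2 * (1 + r1).
Proof.
rewrite /nu (regular_comp_of_mpoly mmap_M_locus_unit).
exact: mmap_coord.
Qed.

Lemma omega0E : omega0 R = cls (q1 R) (q2 R) 1.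
Proof. by rewrite /omega0 /cls lval1. Qed.

Lemma omega1E : omega1 R = cls (q1 R) (q2 R) (term4 (q2 R)).
Proof.
have [e1 e2] := q2d2_q.
rewrite /omega1 omega0E [gm_base _ _](gm_base2 q2d2_derivation e1 e2).
by rewrite (morphDN (@clsD _ _ _)) opprK.
Qed.

Let gm1 : gm_base (@q1d1 R) (omega0 R) = cls (q1 R) (q2 R) (- term3 (q1 R)).
Proof.
have [e1 e2] := q1d1_q.
by rewrite omega0E; exact: gm_base_q1 q1d1_derivation e1 e2.
Qed.

Lemma omega2E : omega2 R = cls (q1 R) (q2 R) (term4 (q2 R) * term3 (q1 R)).
Proof.
have [e1 e2] := q2d2_q.
by rewrite /omega2 gm1; exact: gm_base_term3 q2d2_derivation e1 e2.
Qed.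

Lemma omega3E : omega3 R = cls (q1 R) (q2 R) (term3 (q1 R)).
Proof. by rewrite /omega3 gm1 (morphDN (@clsD _ _ _)) opprK. Qed.

Local Notation Cl := (cls (nu (q1 R)) (nu (q2 R))).

Lemma pull_cls f :
  pull (cls (q1 R) (q2 R) f) = Cl (lringmap (map_poly (@nu R)) f).
Proof. exact: brieskorn_pullback_cls. Qed.

Lemma pull_omega1 : pull (omega1 R) = Cl (term4 (nu (q2 R))).
Proof. by rewrite omega1E pull_cls lringmap_term4. Qed.

Lemma epsilon0E : epsilon R i0 = Cl 1.
Proof.
by rewrite /epsilon /= inordK // omega0E pull_cls lringmap1.
Qed.

Lemma epsilon1E : epsilon R i1 = Cl (term4 (nu (q2 R))).
Proof. by rewrite /epsilon /= inordK // pull_omega1. Qed.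

Lemma epsilon2E : epsilon R i2 = Cl (term4 (nu (q2 R)) * term3 (nu (q1 R))).
Proof.
rewrite /epsilon /= inordK // omega2E pull_cls lringmapM; last 2 first.
- exact: rmorphD.
- exact: rmorphM.
by rewrite lringmap_term4 lringmap_term3.
Qed.

(** The branch chosen for (1 - 4 q_1)^(1/2) is the opposite of s; this fixes the signs in
    epsilon_3. *)
Lemma rootE : Defs.root R = - s.
Proof. by rewrite /Defs.root [r1 + 1]addrC -mulNr opprB. Qed.

Lemma root_half : 2%:R^-1 * (Defs.root R + 1) = t.
Proof.
have u2 : (2%:R : O) \is a GRing.unit.
  rewrite -(rmorph_nat (@scal R)) rmorph_unit // unitfE.
  by rewrite Num.Theory.pnatr_eq0.
rewrite rootE (subst_s r1D1_unit).
have -> : - (1 - 2%:R * t) + 1 = 2%:R * t by rewrite opprB subrK.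
by rewrite mulKr.
Qed.

(** The right side is the class of [gm_base1], so epsilon_3 = theta r_1 nabla epsilon_0, the image
    of f. *)
Lemma epsilon3E :
  epsilon R i3 =
  - s%:P *: Cl (term3 (nu (q1 R))) - t%:P *: Cl (term4 (nu (q2 R))).
Proof.
have -> : - s%:P = (Defs.root R)%:P by rewrite rootE polyCN.
rewrite -root_half -pull_omega1 -lringmap_term3 -pull_cls -omega3E.
by rewrite /epsilon /= inordK.
Qed.

End Instance.

Theorem theorem11p4p3 (R : realType) :
  let d1 := @r1d1 R in
  let d2 := @r2d2 R in
  let QA := Q_A R in
  let QB := Q_B R in
  let one := @c1 {poly OMt R} : QA in
  let f := @cf {poly OMt R} : QA in
  let H := @cH {poly OMt R} : QA in
  let qp : QA -> QA -> QA := qprod (r1 R)%:P (r2 R)%:P in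
  let eps0 : QB := epsilon R (inord 0) in
  let gamma_spec (gamma : {linear QA -> QB}) :=
    [/\ gamma one = eps0,
        gamma f = qconn VR1 eps0,
        gamma H = qconn VR2 eps0 &
        gamma (qp H f) = qconn VR2 (qconn VR1 eps0)] in
  [/\ is_qds d1 d2 QA, is_qds d1 d2 QB,
      exists gamma : {linear QA -> QB}, gamma_spec gamma &
      forall gamma : {linear QA -> QB}, gamma_spec gamma ->
      [/\ is_qds_isomorphism gamma,
          exists gammaV : QB -> QA,
            [/\ cancel gamma gammaV, cancel gammaV gamma &
                forall c : 'rV[complex R]_4,
                  (exists2 y : QB, at_theta0 (qconn VR1 (gamma (of_class c))) y
                    & qp f (of_class c) = gammaV y) /\
                  (exists2 y : QB, at_theta0 (qconn VR2 (gamma (of_class c))) y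
                    & qp H (of_class c) = gammaV y)] &
          forall a b : 'rV[complex R]_4,
            qpair (gamma (of_class a)) (gamma (of_class b)) =
            (scal (poincare a b))%:P * 'X^2]].
Proof.
have yU := r1D1_unit R; have d1P := r1d1_derivation R.
have d2P := r2d2_derivation R.
have nu1 := nu_q1 R; have nu2 := nu_q2 R.
have d1q1 := subst_d1q1 d1P (r1d1_r1 R) yU.
have d1q2 := subst_d1q2 d1P (r1d1_r1 R) (r1d1_r2 R) yU.
have d1t := subst_d1t d1P (r1d1_r1 R) yU.
have d2q1 := subst_d2q1 d2P (r2d2_r1 R) yU.
have d2q2 := subst_d2q2 d2P (r2d2_r1 R) (r2d2_r2 R).
have d2t := subst_d2t d2P (r2d2_r1 R) yU.
have sE := subst_s yU; have q1E := subst_q1 yU.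
have wE := subst_w (r2 R) yU; have zE := subst_z (r2 R) yU.
have q1U := q1_unit R; have q2U := q2_unit R.
(* [nu q1] and [nu q2] occur in the type of the pulled-back lattice, so the relations are restated
   for them instead of substituting their values there. *)
move: d1q1 d1q2 d1t d2q1 d2q2 q1E wE zE q1U q2U; rewrite -nu1 -nu2.
move=> d1q1 d1q2 d1t d2q1 d2q2 q1E wE zE q1U q2U.
have sU : (1 - r1 R) / (1 + r1 R) \is a GRing.unit.
  by rewrite unitrM unitrV r1B1_unit.
(* [Q_A] and [Q_B] are convertible to [qds_row] and [qds_eps] for these data, so the abstract
   theorem applies directly. *)
exact: (brieskorn_mirror d1P d2P (@r_comm R) (r1d1_r1 R) (r1d1_r2 R)
  (r2d2_r1 R) (r2d2_r2 R) d1q1 d1q2 d1t d2q1 d2q2 d2t sE q1E wE zE (esym nu2)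
  sU q1U q2U (@r1d1_scal R) (@r2d2_scal R)
  (epsilon0E R) (epsilon1E R) (epsilon2E R) (epsilon3E R)).
Qed.
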